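(* Let $(M,H,\theta,J)$ be a compact Sasakian manifold of dimension $2n+1$. Then, for $0\le k\le 2n+1$, $$\mathscr{F}_3^k(\Delta_t)=\bigcap_{t>0}\operatorname{Ker}\bigl(\Delta_t\colon\Omega^k(M)\to\Omega^k(M)\bigr)\quad\text{for }k\ne n,n+1,$$ $$\mathscr{F}_5^k(\Delta_t)=\bigcap_{t>0}\operatorname{Ker}\bigl(\Delta_t\colon\Omega^k(M)\to\Omega^k(M)\bigr)\quad\text{for }k=n,n+1.$$
   Context: Contact and Sasakian manifolds. An orientable contact manifold $(M,H)$ of dimension $2n+1$ is a manifold with a codimension-one subbundle $H\subset TM$ for which there is a 1-form $\theta$ (a contact form) with $\operatorname{Ker}\theta=H$ and $\theta\wedge(d\theta)^n\neq 0$ everywhere. The Reeb vector field $T$ is the unique vector field with $\theta(T)=1$, $\operatorname{Int}_T d\theta=0$ ($\operatorname{Int}_T$ is the interior product, $\mathcal{L}_T$ the Lie derivative). An almost complex structure associated with $\theta$ is $J\in\operatorname{End}(TM)$ preserving $H$ with $J^2=-\mathrm{Id}$ on $H$, $JT=0$, and $d\theta(\cdot,J\cdot)$ positive definite on $H$. The Riemannian metric is $g_{\theta,J}(X,Y)=d\theta(X,JY)+\theta(X)\theta(Y)$. Put $H^{1,0}=\{v\in\mathbb{C}H: Jv=\sqrt{-1}v\}$. $(M,H,\theta,J)$ is Sasakian if $\mathcal{L}_TJ=0$ and $[C^\infty(M,H^{1,0}),C^\infty(M,H^{1,0})]\subset C^\infty(M,H^{1,0})$. Rescaled operators. $\Omega^k(M)$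 is the space of smooth $k$-forms. Identify $H^*$ with $\{\phi\in T^*M:\phi(T)=0\}$; then every form is uniquely $\alpha_H+\theta\wedge\alpha_T$ with $\alpha_H,\alpha_T\in C^\infty(M,\bigwedge^\bullet H^* )$ (horizontal forms). The exterior derivative splits as $d=d_0+d_b+d_T$, where: $d_0=\operatorname{Int}_T d\theta\wedge$, i.e. $d_0(\alpha_H+\theta\wedge\alpha_T)=d\theta\wedge\alpha_T$; $d_T=\theta\wedge\mathcal{L}_T$, i.e. $d_T(\alpha_H+\theta\wedge\alpha_T)=\theta\wedge\mathcal{L}_T\alpha_H$; $d_b\phi=d\phi-\theta\wedge(\operatorname{Int}_Td\phi)$ for horizontal $\phi$ and $d_b\theta=0$, so that $d_b(\theta\wedge\alpha_T)=-\theta\wedge d_b\alpha_T$. For $t\in[0,\infty)$ put $d_t=d_0+td_b+t^2d_T$ and $\Delta_t=d_td_t^*+d_t^*d_t\colon\Omega^\bullet(M)\to\Omega^\bullet(M)$, where $d_t^*$ is the formal adjoint of $d_t$ for the ($t$-independent) $L^2$-inner product on $\Omega^\bullet(M)$ given by $g_{\theta,J}$. The spaces $\mathscr{F}_p^k$. Let $X=M\times[0,\infty)$ and let ${}^{\mathrm{sR}}\Omega^k(X)$ be the space of families of the form $u_0+tu_1+\cdots+t^qu_q$ with $q\in\mathbb{Z}_{\ge0}$, $u_j\in\Omega^k(M)$, $t\ge0$ (polynomials in $t$ with coefficients in $\Omega^k(M)$). For $p\ge0$, $$\mathscr{F}_p^k(\Delta_t)=\{u\in\Omega^k(M) : \exists\,\tilde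 u\in{}^{\mathrm{sR}}\Omega^k(X)\text{ with }\tilde u|_{t=0}=u\text{ and }\Delta_t\tilde u=O(t^p)\},$$ where $O(t^p)$ is understood as $t\to0$, i.e. all coefficients of $t^j$ with $j<p$ in the polynomial $\Delta_t\tilde u$ vanish. *)

(* Defs.v *)
From HB Require Import structures.
From mathcomp Require Import all_boot all_order all_algebra.
From mathcomp Require Import all_classical all_reals all_analysis.

Set Implicit Arguments.
Unset Strict Implicit.
Unset Printing Implicit Defensive.

Import Order.TTheory GRing.Theory Num.Theory numFieldNormedType.Exports.

Local Open Scope classical_set_scope.
Local Open Scope ring_scope.

Section SmoothOnOpen.
Variables (R : realType) (m : nat).
Implicit Types (W : set 'rV[R]_m) (f g : 'rV[R]_m -> R).

(* C^k regularity on W; only meaningful for W open *)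
Fixpoint Ck_on (k : nat) W f : Prop :=
  (forall x, W x -> {for x, continuous f}) /\
  if k is k'.+1 then
    forall i : 'I_m, (forall x, W x -> derivable f x (delta_mx 0 i)) /\
                     Ck_on k' W (fun x => 'D_(delta_mx 0 i) f x)
  else True.

Definition smooth_on W f : Prop := forall k, Ck_on k W f.

Lemma eq_derivable f g (W : set 'rV[R]_m) (x v : 'rV[R]_m) :
  open W -> W x -> (forall y, W y -> f y = g y) ->
  (derivable f x v -> derivable g x v) /\ 'D_v f x = 'D_v g x.
Proof.
move=> oW Wx fg.
have near_fg : {near x, f =1 g}.
  by near=> y; apply: fg; near: y; exact: open_nbhs_nbhs.
split; last exact: near_eq_derive.
exact: near_eq_derivable.
Unshelve. all: by end_near. Qed.

Lemma Ck_on_ext k W f g : open W -> (forall y, W y -> f y = g y) ->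
  Ck_on k W f -> Ck_on k W g.
Proof.
move=> oW.
have cont f1 g1 : (forall y, W y -> f1 y = g1 y) ->
    (forall x, W x -> {for x, continuous f1}) ->
    forall x, W x -> {for x, continuous g1}.
  move=> e c x Wx; suff : g1 @ x --> f1 x by rewrite e.
  have near_fg : {near x, f1 =1 g1}.
    by near=> y; apply: e; near: y; exact: open_nbhs_nbhs.
  exact: cvg_trans (near_eq_cvg near_fg) (c x Wx).
elim: k f g => [|k IH] f g e /= [c h]; split; try exact: cont c; last first.
- move=> i; have [hd hk] := h i; split.
    by move=> x Wx; apply: (eq_derivable (delta_mx 0 i) oW Wx e).1; exact: hd.
  by apply: IH hk => y Wy; apply: (eq_derivable (delta_mx 0 i) oW Wy e).2.
- by [].
Unshelve. all: by end_near. Qed.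

Lemma Ck_onW k W f : Ck_on k.+1 W f -> Ck_on k W f.
Proof.
elim: k f => [|k IH] f [c h]; split => //.
by move=> i; have [hd hk] := h i; split=> //; exact: IH.
Qed.

Lemma Ck_on_cst k W (a : R) : Ck_on k W (cst a).
Proof.
elim: k a => [|k IH] a /=; split=> //; try by move=> x _; exact: cst_continuous.
move=> i; split; first by move=> x _; exact: derivable_cst.
have -> : (fun x => 'D_(delta_mx 0 i) (cst a) x) = cst 0 :> ('rV[R]_m -> R).
  by apply/funext => x; exact: derive_cst.
exact: IH.
Qed.

Lemma Ck_onD k W f g : open W ->
  Ck_on k W f -> Ck_on k W g -> Ck_on k W (f + g).
Proof.
move=> oW; elim: k f g => [|k IH] f g [cf hf] [cg hg].
  by split=> // x Wx; exact: (continuousD (cf x Wx) (cg x Wx)).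
split=> [x Wx|i]; first exact: (continuousD (cf x Wx) (cg x Wx)).
have [df kf] := hf i; have [dg kg] := hg i; split.
  by move=> x Wx; apply: derivableD; [exact: df | exact: dg].
apply: (Ck_on_ext oW _ (IH _ _ kf kg)) => x Wx.
by rewrite deriveD //; [exact: df | exact: dg].
Qed.

Lemma Ck_onM k W f g : open W ->
  Ck_on k W f -> Ck_on k W g -> Ck_on k W (f * g).
Proof.
move=> oW; elim: k f g => [|k IH] f g Hf Hg; move: (Hf) (Hg) => [cf hf] [cg hg].
  by split=> // x Wx; exact: (continuousM (cf x Wx) (cg x Wx)).
split=> [x Wx|i]; first exact: (continuousM (cf x Wx) (cg x Wx)).
have [df kf] := hf i; have [dg kg] := hg i; split.
  by move=> x Wx; apply: derivableM; [exact: df | exact: dg].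
have := Ck_onD oW (IH _ _ (Ck_onW Hf) kg) (IH _ _ (Ck_onW Hg) kf).
apply: (Ck_on_ext oW) => x Wx.
by rewrite deriveM //; [exact: df | exact: dg].
Qed.

End SmoothOnOpen.

Section Manifold.
Variables (R : realType) (m : nat).

Record chart (M : topologicalType) := Chart {
  chart_dom : set M;
  chart_map : M -> 'rV[R]_m;
  chart_inv : 'rV[R]_m -> M;
  chart_dom_open : open chart_dom;
  chart_cod_open : open (chart_map @` chart_dom);
  chart_mapK : forall x, chart_dom x -> chart_inv (chart_map x) = x;
  chart_map_continuous : forall x, chart_dom x -> {for x, continuous chart_map};
  chart_inv_continuous :
    forall y, (chart_map @` chart_dom) y -> {for y, continuous chart_inv}
}.

Definition chart_cod (M : topologicalType) (c : chart M) : set 'rV[R]_m :=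
  chart_map c @` chart_dom c.

Definition compatible (M : topologicalType) (c c' : chart M) : Prop :=
  forall j : 'I_m,
    smooth_on (chart_map c @` (chart_dom c `&` chart_dom c'))
              (fun y => chart_map c' (chart_inv c y) 0 j).

(* Second countability is not a field: for compact manifolds it is automatic. *)
Record smoothManifold := SmoothManifold {
  carrier :> topologicalType;
  manifold_hausdorff : hausdorff_space carrier;
  atlas : set (chart carrier);
  atlas_cover : forall x, exists2 c, atlas c & chart_dom c x;
  atlas_compatible : forall c c', atlas c -> atlas c' -> compatible c c'
}.

End Manifold.

Section SmoothFunctions.
Variables (R : realType) (m : nat) (M : smoothManifold R m).

Definition smooth_fun : {pred M -> R} :=
  [pred f : M -> R | `[< forall c, atlas c ->
     smooth_on (chart_cod c) (fun y => f (chart_inv c y)) >]].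

Lemma smooth_funP (f : M -> R) :
  reflect (forall c, atlas c ->
             smooth_on (chart_cod c) (fun y => f (chart_inv c y)))
          (f \in smooth_fun).
Proof. exact: asboolP. Qed.

Fact smooth_fun_cst (a : R) : cst a \in smooth_fun.
Proof. by apply/smooth_funP => c _ k; exact: Ck_on_cst. Qed.

Fact smooth_funD (f g : M -> R) :
  f \in smooth_fun -> g \in smooth_fun -> f + g \in smooth_fun.
Proof.
move=> /smooth_funP hf /smooth_funP hg; apply/smooth_funP => c hc k.
have oW : open (chart_cod c) by exact: chart_cod_open.
by apply: (Ck_on_ext oW _ (Ck_onD oW (hf c hc k) (hg c hc k))).
Qed.

Fact smooth_funM (f g : M -> R) :
  f \in smooth_fun -> g \in smooth_fun -> f * g \in smooth_fun.
Proof.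
move=> /smooth_funP hf /smooth_funP hg; apply/smooth_funP => c hc k.
have oW : open (chart_cod c) by exact: chart_cod_open.
by apply: (Ck_on_ext oW _ (Ck_onM oW (hf c hc k) (hg c hc k))).
Qed.

Fact smooth_fun_scaler : GRing.scaler_closed smooth_fun.
Proof. by move=> a f hf; exact: smooth_funM (smooth_fun_cst a) hf. Qed.

Fact smooth_fun_subring : GRing.subring_closed smooth_fun.
Proof.
split; [exact: smooth_fun_cst | | exact: smooth_funM].
by move=> f g hf hg; rewrite -scaleN1r smooth_funD ?smooth_fun_scaler.
Qed.

HB.instance Definition _ :=
  GRing.isSubringClosed.Build (M -> R) smooth_fun smooth_fun_subring.
HB.instance Definition _ :=
  GRing.isScaleClosed.Build R (M -> R) smooth_fun smooth_fun_scaler.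

Record Cinf := MkCinf { Cinf_val :> M -> R; _ : Cinf_val \in smooth_fun }.

HB.instance Definition _ := [isSub for Cinf_val].
HB.instance Definition _ := [Choice of Cinf by <:].
HB.instance Definition _ := GRing.SubChoice_isSubComPzRing.Build _ _ Cinf
  (GRing.subringClosedP smooth_fun).
HB.instance Definition _ := [SubZmodule_isSubLmodule of Cinf by <:].

End SmoothFunctions.

(* A vector field is a derivation of the R-algebra C^oo(M); accordingly tensor
   fields are C^oo(M)-multilinear maps on vector fields. *)
Section VectorFields.
Variables (R : realType) (m : nat) (M : smoothManifold R m).
Local Notation A := (Cinf M).

Definition is_derivation (D : A -> A^o) : Prop :=
  (forall (a : R) (f g : A), D (a *: f + g) = a *: (D f : A) + D g) /\
  (forall f g : A, D (f * g) = D f * g + f * D g).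

Definition derivation : {pred A -> A^o} := [pred D | `[< is_derivation D >]].

Lemma derivationP (D : A -> A^o) : reflect (is_derivation D) (D \in derivation).
Proof. exact: asboolP. Qed.

Fact scaler_mulAr (a : R) (f g : A) : f * (a *: g) = a *: (f * g).
Proof. by apply/val_inj/funext => x; exact: mulrCA. Qed.

Fact scaler_mulAl (a : R) (f g : A) : (a *: f) * g = a *: (f * g).
Proof. by apply/val_inj/funext => x; exact: esym (mulrA _ _ _). Qed.

Fact derivation_submod : GRing.subsemimod_closed derivation.
Proof.
split; first split.
- apply/derivationP; split=> [a f g|f g].
    by rewrite /= [RHS](_ : _ = a *: (0 : A) + 0) // scaler0 addr0.
  by rewrite [RHS](_ : _ = (0 : A) * g + f * (0 : A)) // mul0r mulr0 addr0.
- move=> D E /derivationP[Dl DM] /derivationP[El EM].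
  apply/derivationP; split=> [a f g|f g].
    rewrite [LHS](_ : _ = (D (a *: f + g) : A) + E (a *: f + g)) // Dl El.
    by rewrite addrACA -scalerDr.
  rewrite [LHS](_ : _ = (D (f * g) : A) + E (f * g)) // DM EM.
  by rewrite addrACA -mulrDl -mulrDr.
- move=> h D /derivationP[Dl DM]; apply/derivationP; split=> [a f g|f g].
    rewrite [LHS](_ : _ = h * (D (a *: f + g) : A)) // Dl mulrDr.
    by rewrite scaler_mulAr.
  rewrite [LHS](_ : _ = h * (D (f * g) : A)) // DM mulrDr mulrA.
  by congr (_ + _); rewrite mulrCA.
Qed.

HB.instance Definition _ :=
  GRing.isSubmodClosed.Build A (A -> A^o) derivation derivation_submod.

Record vfield := MkVfield { vf_val :> A -> A^o; _ : vf_val \in derivation }.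

HB.instance Definition _ := [isSub for vf_val].
HB.instance Definition _ := [Choice of vfield by <:].
HB.instance Definition _ := [SubChoice_isSubLmodule of vfield by <:].

Fact vbracket_subproof (X Y : vfield) :
  (fun f : A => (X (Y f) : A) - Y (X f)) \in derivation.
Proof.
case: X Y => [X /derivationP[Xl XM]] [Y /derivationP[Yl YM]] /=.
have XD (f g : A) : X (f + g) = (X f : A) + X g.
  by have := Xl 1 f g; rewrite !scale1r.
have YD (f g : A) : Y (f + g) = (Y f : A) + Y g.
  by have := Yl 1 f g; rewrite !scale1r.
apply/derivationP; split=> [a f g|f g].
  by rewrite Yl Xl Xl Yl opprD addrACA -scalerBr.
rewrite YM XM XD YD !XM !YM mulrBl mulrBr.
have aux (V : zmodType) (a b c d u v : V) :
    a + u + (v + c) - (b + v + (u + d)) = a - b + (c - d).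
  have -> : a + u + (v + c) = a + c + (u + v) by rewrite [v + c]addrC addrACA.
  have -> : b + v + (u + d) = u + v + (b + d).
    by rewrite addrC [b + v]addrC addrACA [d + b]addrC.
  by rewrite addrKA opprD addrACA.
exact: (aux A).
Qed.

Definition vbracket (X Y : vfield) : vfield := MkVfield (vbracket_subproof X Y).

End VectorFields.

Section DifferentialForms.
Variables (R : realType) (m : nat) (M : smoothManifold R m).
Local Notation A := (Cinf M).
Local Notation V := (vfield M).

(* Total forms: alpha evaluated on a sequence of k vector fields is the degree-k
   component of alpha, so that Omega^*(M) is the direct sum of the Omega^k(M). *)
Definition cochain : Type := seq V -> A.

HB.instance Definition _ := GRing.Lmodule.on cochain.

Implicit Types (alpha beta : cochain) (X Y : V) (s : seq V).

(* C^oo(M)-multilinear and alternating; degrees > m vanish automatically. *)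
Definition is_form alpha : Prop :=
  (forall s1 s2 (f : A) X Y,
     alpha (s1 ++ (f *: X + Y) :: s2) =
       f * alpha (s1 ++ X :: s2) + alpha (s1 ++ Y :: s2)) /\
  (forall s1 s2 s3 X, alpha (s1 ++ X :: s2 ++ X :: s3) = 0).

Definition Omega (k : nat) : set cochain :=
  [set alpha | is_form alpha /\ forall s, size s != k -> alpha s = 0].

Definition omit (i : nat) s : seq V := take i s ++ drop i.+1 s.

Definition interior X alpha : cochain := fun s => alpha (X :: s).

Definition lie X alpha : cochain := fun s =>
  X (alpha s) - \sum_(i < size s) alpha (set_nth 0 s i (vbracket X s`_i)).

(* Koszul's formula, without the factor 1/(k+1) *)
Definition dext alpha : cochain := fun s =>
  \sum_(i < size s) (-1 : R) ^+ i *: (s`_i (alpha (omit i s)) : A) +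
  \sum_(j < size s) \sum_(i < j)
    (-1 : R) ^+ (i + j) *:
      alpha (vbracket s`_i s`_j :: omit i (omit j s)).

(* number of inversions of the shuffle putting the positions selected by b
   before the others *)
Definition shuffle_inversions (b : bitseq) : nat :=
  \sum_(j < size b) \sum_(i < j) (~~ nth false b i && nth false b j).

Definition wedge alpha beta : cochain := fun s =>
  \sum_(b : (size s).-tuple bool) (-1 : R) ^+ shuffle_inversions b *:
    (alpha (mask b s) * beta (mask (map negb b) s)).

Definition form1 : cochain := fun s => if s is [::] then 1 else 0.

Definition wedge_pow alpha (n : nat) : cochain := iter n (wedge alpha) form1.

End DifferentialForms.

Section Sasakian.
Variables (R : realType) (n : nat) (M : smoothManifold R (2 * n).+1).
Local Notation A := (Cinf M).
Local Notation V := (vfield M).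

Definition horizontal (theta : cochain M) : set V :=
  [set X | theta [:: X] = 0].

Definition is_contact_form (theta : cochain M) : Prop :=
  Omega 1 theta /\
  forall x : M, exists s : seq V,
    wedge theta (wedge_pow (dext theta) n) s x != 0.

Definition is_reeb (theta : cochain M) (T : V) : Prop :=
  theta [:: T] = 1 /\ interior T (dext theta) = 0.

Definition is_associated_acs (theta : cochain M) (T : V) (J : V -> V) : Prop :=
  [/\ (forall (f : A) (X Y : V), J (f *: X + Y) = f *: J X + J Y),
      (forall X : V, horizontal theta X ->
         horizontal theta (J X) /\ J (J X) = - X),
      J T = 0,
      (forall X Y : V, horizontal theta X -> horizontal theta Y ->
         dext theta [:: X; J Y] = dext theta [:: Y; J X]) &
      (forall (X : V) (x : M), horizontal theta X ->
         (exists f : A, X f x != 0 :> R) -> 0 < dext theta [:: X; J X] x)].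

(* Complex vector fields: (X, Y) stands for X + sqrt(-1) Y. *)
Definition cfield : Type := (V * V)%type.

Definition cbracket (Z W : cfield) : cfield :=
  (vbracket Z.1 W.1 - vbracket Z.2 W.2, vbracket Z.1 W.2 + vbracket Z.2 W.1).

Definition H10 (theta : cochain M) (J : V -> V) : set cfield :=
  [set Z | [/\ horizontal theta Z.1, horizontal theta Z.2 &
              (J Z.1, J Z.2) = (- Z.2, Z.1)]].

(* The contact distribution H is Ker theta, with sections [horizontal theta]. *)
Record sasakian := Sasakian {
  contact_form : cochain M;
  reeb : V;
  acs : V -> V;
  contact_formP : is_contact_form contact_form;
  reebP : is_reeb contact_form reeb;
  acsP : is_associated_acs contact_form reeb acs;
  reeb_acs : forall X, vbracket reeb (acs X) = acs (vbracket reeb X);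
  H10_involutive : forall Z W, H10 contact_form acs Z ->
    H10 contact_form acs W -> H10 contact_form acs (cbracket Z W)
}.

Variable S : sasakian.
Local Notation theta := (contact_form S).
Local Notation T := (reeb S).
Local Notation J := (acs S).

Definition metric (X Y : V) : A :=
  dext theta [:: X; J Y] + theta [:: X] * theta [:: Y].

Definition is_coord_field (c : chart R (2 * n).+1 M) (x : M)
    (i : 'I_(2 * n).+1) : set V :=
  [set X : V | forall f : A, X f x =
     'D_(delta_mx 0 i) (fun y => f (chart_inv c y)) (chart_map c x)].

Definition coord_field c x i : V := xget 0 (is_coord_field c x i).

Definition riemannian_density (c : chart R (2 * n).+1 M) (x : M) : R :=
  Num.sqrt (\det (\matrix_(i, j) metric (coord_field c x i) (coord_field c x j) x)).

(* Lebesgue integral over R^m, as an iterated integral *)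
Fixpoint iterated_integral (m : nat) : ('rV[R]_m -> R) -> R :=
  match m with
  | 0 => fun F => F 0
  | m'.+1 => fun F => \int[@lebesgue_measure R]_(x in setT)
      iterated_integral (fun v : 'rV[R]_m' => F (row_mx (const_mx x : 'rV_1) v))
  end.

(* Integration against the Riemannian volume density. By partitions of unity
   these conditions determine the value of I on C^oo(M). *)
Definition is_riemannian_integral (I : (M -> R) -> R) : Prop :=
  (forall (a : R) (f g : A), I (a *: f + g) = a * I f + I g) /\
  (forall c (f : A), atlas c -> closure [set x | f x != 0] `<=` chart_dom c ->
     I f = iterated_integral
             ((fun y => f (chart_inv c y) * riemannian_density c (chart_inv c y))
                \_ (chart_cod c))).

Definition is_orthonormal_frame (x : M) : set ('I_(2 * n).+1 -> V) :=
  [set e | forall i j, metric (e i) (e j) x = (i == j)%:R].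

(* Pointwise inner product: increasing k-tuples of an orthonormal coframe have
   norm 1, whence the factor 1/k! when summing over all k-tuples. *)
Definition form_dot (alpha beta : cochain M) (x : M) : R :=
  let e := xget (fun=> 0) (is_orthonormal_frame x) in
  \sum_(k < (2 * n).+2) (k`!%:R)^-1 *
    \sum_(s : k.-tuple 'I_(2 * n).+1) alpha (map e s) x * beta (map e s) x.

Definition L2dot (I : (M -> R) -> R) (alpha beta : cochain M) : R :=
  I (form_dot alpha beta).

Definition is_formal_adjoint (I : (M -> R) -> R)
    (P Q : cochain M -> cochain M) : Prop :=
  (forall beta, is_form beta -> is_form (Q beta)) /\
  (forall alpha beta, is_form alpha -> is_form beta ->
     L2dot I (P alpha) beta = L2dot I alpha (Q beta)).

(* alpha = hpart alpha + theta /\ tpart alpha *)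
Definition tpart (alpha : cochain M) : cochain M := interior T alpha.
Definition hpart (alpha : cochain M) : cochain M :=
  alpha - wedge theta (tpart alpha).

Definition d_0 (alpha : cochain M) : cochain M :=
  wedge (dext theta) (tpart alpha).

Definition d_T (alpha : cochain M) : cochain M :=
  wedge theta (lie T (hpart alpha)).

Definition d_b_hor (phi : cochain M) : cochain M :=
  dext phi - wedge theta (interior T (dext phi)).

Definition d_b (alpha : cochain M) : cochain M :=
  d_b_hor (hpart alpha) - wedge theta (d_b_hor (tpart alpha)).

Definition d_t (t : R) (alpha : cochain M) : cochain M :=
  d_0 alpha + t *: d_b alpha + t ^+ 2 *: d_T alpha.

Definition Laplacian (dstar : R -> cochain M -> cochain M) (t : R)
    (alpha : cochain M) : cochain M :=
  d_t t (dstar t alpha) + dstar t (d_t t alpha).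

Definition poly_family (q : nat) (u : nat -> cochain M) (t : R) : cochain M :=
  \sum_(j < q.+1) t ^+ j *: u j.

Definition F_space (Delta : R -> cochain M -> cochain M) (p k : nat) :
    set (cochain M) :=
  [set u | Omega k u /\ exists (q : nat) (us : nat -> cochain M),
     [/\ forall j, Omega k (us j),
         poly_family q us 0 = u &
         exists (N : nat) (ws : nat -> cochain M),
           [/\ forall j, Omega k (ws j),
               forall j, (j < p)%N -> ws j = 0 &
               forall t, 0 <= t ->
                 Delta t (poly_family q us t) = poly_family N ws t]]].

Definition Ker_on (k : nat) (P : cochain M -> cochain M) : set (cochain M) :=
  [set u | Omega k u /\ P u = 0].

End Sasakian.

(* Main.v *)
(* Write L for the exterior product with d theta, Lam for its adjoint, D = d_b
   and t for the Lie derivative along T, so that d_s = L i_T + s D + s^2 theta t.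
   From <Delta_s v, v> = |d_s v|^2 + |d_s^* v|^2 the coefficients of s^r in d_s v
   and d_s^* v vanish as soon as 2 r < p.  In degree k <= n, those with r <= 1 say
   that u = v(0) is horizontal and primitive, D^* u = 0 and D u = L b for some
   horizontal b.  The transverse Kaehler identities make the Laplacians of D and
   of D^c = [D, J] agree, which gives Lam b = 0, |D u|^2 = (c + 1) |b|^2 and
   (c + 1) |b|^2 = |D^c u|^2 + (c + 1)^2 |b|^2 with c = n - k.  So b = 0 when
   c > 0, and D^2 = - L t yields c t u = 0; when c = 0 the coefficient r = 2
   supplies t u + D b = 0, whence |t u|^2 = - <D b, t u> = 0 and again b = 0.
   Degrees k > n follow by exchanging L with Lam and D with D^* throughout.
   Adjointness for the given integral is the divergence theorem, proved by a
   partition of unity; the commutation relations come from the Tanaka-Webster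
   connection, whose torsion is d theta tensor T. *)

From HB Require Import structures.
From mathcomp Require Import all_boot all_order all_algebra.
From mathcomp Require Import all_classical all_reals all_analysis.
From mathcomp Require Import ring lra zify.
Require Import Defs.

Set Implicit Arguments.
Unset Strict Implicit.
Unset Printing Implicit Defensive.

Import Order.TTheory GRing.Theory Num.Theory numFieldNormedType.Exports.

Local Open Scope classical_set_scope.
Local Open Scope ring_scope.

(** * Calculus on open subsets of R^m *)

(** Vector fields are only derivations of the algebra of smooth functions, and forms only
    multilinear maps on them, so no local expression comes for free. Hadamard's lemma and smooth
    cutoffs give global fields that are coordinate fields near a point; compactness then yields a
    finite dual basis of the module of fields, and a correction of its Gram matrix yields a global
    pair of frames with X equal to the sum of the g(X, F a) E a. Sums over such a pair replace sums
    over an orthonormal frame, which may not exist globally. Forms of all degrees are treated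
    together as maps on lists: an operator on them is known from its value on the empty list and its
    commutation with contractions, which turns Cartan's formula, the sl2 relation and the Kaehler
    identities into short algebra. The vanishing argument uses only a positive definite inner
    product and adjointness, so it is carried out in an abstract inner product space, with no
    completeness, ellipticity or Hodge decomposition. *)

Section EuclideanCalculus.
Variables (R : realType) (m : nat).
Implicit Types (W : set 'rV[R]_m) (f g : 'rV[R]_m -> R) (i j : 'I_m).

Lemma is_derive_line f p (v : 'rV[R]_m) (s : R) :
  derivable f (p + s *: v) v ->
  is_derive s (1 : R) (fun r : R => f (p + r *: v)) ('D_v f (p + s *: v)).
Proof.
move=> df.
have e : (fun h : R => h^-1 *: (f (p + (h *: (1 : R) + s) *: v) - f (p + s *: v)))
   = (fun h : R => h^-1 *: (f (h *: v + (p + s *: v)) - f (p + s *: v))).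
  by apply/funext => h; rewrite [h *: 1]mulr1 scalerDl addrCA.
by split; rewrite /derivable /derive /= e.
Qed.

Lemma mvt_line f p (v : 'rV[R]_m) (c : R) :
  (forall s : R, 0 <= s <= 1 -> derivable f (p + (s * c) *: v) v) ->
  exists2 s : R, 0 <= s <= 1 &
    f (p + c *: v) - f p = c * 'D_v f (p + (s * c) *: v).
Proof.
move=> df.
pose G (s : R) := f (p + (s * c) *: v).
have dG (s : R) : 0 <= s <= 1 ->
    is_derive s (1 : R) G (c * 'D_v f (p + (s * c) *: v)).
  move=> s01; have -> : G = (fun r : R => f (p + r *: v)) \o (fun s : R => s * c) by [].
  have /is_derive_line d1 := df _ s01.
  have d2 : is_derive s (1 : R) (fun s : R => s * c) c.
    by apply: is_derive_eq; rewrite scaler0 add0r [c *: 1]mulr1.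
  have := @is_derive1_comp _ _ (fun s : R => s * c) s _ _ d1 d2.
  by rewrite [_ * c]mulrC.
have [s s01 es] : exists2 s, s \in `[0, 1]%R & G 1 - G 0 =
    (c * 'D_v f (p + (s * c) *: v)) * (1 - 0).
  apply: MVT_segment => //.
    by move=> s; rewrite in_itv /= => /andP[s0 s1]; apply: dG; rewrite !ltW.
  apply: derivable_within_continuous => s; rewrite in_itv /= => s01.
  by apply: ex_derive; exact: dG.
exists s; first by move: s01; rewrite in_itv.
by move: es; rewrite /G mul1r mul0r scale0r addr0 subr0 mulr1.
Qed.

(** Consecutive truncations differ in a single coordinate, so an increment of a function telescopes
    into increments along the axes. *)
Definition trunc_row (k : nat) (h : 'rV[R]_m) : 'rV[R]_m :=
  \row_j (if (j < k)%N then h 0 j else 0).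

Lemma trunc_row0 h : trunc_row 0 h = 0.
Proof. by apply/rowP => j; rewrite !mxE. Qed.

Lemma trunc_row_full h : trunc_row m h = h.
Proof. by apply/rowP => j; rewrite !mxE ltn_ord. Qed.

Lemma trunc_rowS i h :
  trunc_row i.+1 h = trunc_row i h + h 0 i *: delta_mx 0 i.
Proof.
apply/rowP => j; rewrite !mxE eqxx /= ltnS leq_eqVlt.
have [->|ji] := eqVneq j i; first by rewrite eqxx ltnn mulr1 add0r.
rewrite (_ : (val j == val i) = false) ?mulr0 ?addr0 //.
by apply/negbTE; rewrite (inj_eq val_inj).
Qed.

Lemma norm_row_le (x : 'rV[R]_m) (e : R) : 0 <= e ->
  (`|x| <= e) = [forall j, `|x 0 j| <= e].
Proof.
move=> e0; rewrite /Num.Def.normr /= mx_normrE.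
apply/idP/forallP => [h j|h].
  by apply: le_trans h; exact: (le_bigmax _ (fun i : 'I_1 * 'I_m => `|x i.1 i.2|) (0, j)).
apply/bigmax_leP; split => // -[a j] _ /=.
by rewrite (ord1 a); exact: h.
Qed.

Lemma norm_coord_le (x : 'rV[R]_m) j : `|x 0 j| <= `|x|.
Proof.
have := norm_row_le x (normr_ge0 x); rewrite lexx => /esym/forallP.
exact.
Qed.

Lemma near_row_norm (e : R) : 0 < e -> \forall h \near (0 : 'rV[R]_m), `|h| < e.
Proof.
move=> e0; apply/nbhs_ballP; exists e => //= y.
by rewrite mx_norm_ball /ball_ /= sub0r normrN.
Qed.

Definition grad_form f (x v : 'rV[R]_m) : R := \sum_j v 0 j * 'D_(delta_mx 0 j) f x.

Lemma grad_form_linear f x : linear (grad_form f x : 'rV[R]_m -> R).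
Proof.
move=> a u v; rewrite /grad_form [a *: (\sum_j _)]mulr_sumr -big_split /=.
by apply: eq_bigr => j _; rewrite !mxE mulrDl mulrA.
Qed.

HB.instance Definition _ f x := GRing.isLinear.Build R 'rV[R]_m R *:%R (grad_form f x)
  (grad_form_linear f x).

(** Moving from [x] to [h + x] one coordinate at a time, each increment is a partial derivative at
    an intermediate point, by the mean value theorem; continuity of the partials at [x] bounds the
    error. *)
Lemma C1_expansion W f x (eps : {posnum R}) : open W -> Ck_on 1 W f -> W x ->
  \forall h \near (0 : 'rV[R]_m),
    `|f (h + x) - (f x + grad_form f x h)| <= eps%:num * `|h|.
Proof.
move=> oW [_ hf] Wx.
have cD j : {for x, continuous (fun y => 'D_(delta_mx 0 j) f y)}.
  by have [_ [c _]] := hf j; exact: c.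
(* Each of the [m] increments may cost [e] times the norm of [h]; dividing by [m.+1] also covers
   [m = 0]. *)
pose e := eps%:num / m.+1%:R.
have e0 : 0 < e by rewrite divr_gt0.
have [r /= r0 hr] : exists2 r : R, 0 < r & forall y, `|y - x| < r ->
    W y /\ forall j, `|'D_(delta_mx 0 j) f y - 'D_(delta_mx 0 j) f x| <= e.
  have : \forall y \near x, W y /\
      forall j, `|'D_(delta_mx 0 j) f y - 'D_(delta_mx 0 j) f x| <= e.
    near=> y; split; first by near: y; exact: open_nbhs_nbhs.
    near: y; apply: filter_forall => j.
    by have /cvgrPdistC_le := cD j; apply.
  move=> /nbhs_ballP[r /= r0 hr]; exists r => // y yx; apply: hr.
  by rewrite mx_norm_ball /ball_ /= distrC.
near=> h.
have hlt : `|h| < r by near: h; exact: near_row_norm.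
have fE : f (h + x) - f x =
    \sum_(j < m) (f (x + trunc_row j.+1 h) - f (x + trunc_row j h)).
  rewrite -(big_mkord xpredT (fun j : nat => f (x + trunc_row j.+1 h) - f (x + trunc_row j h))).
  rewrite (telescope_sumr (fun j : nat => f (x + trunc_row j h))) //.
  by rewrite trunc_row0 trunc_row_full addr0 [h + x]addrC.
rewrite opprD addrA fE /grad_form -sumrB.
apply: (@le_trans _ _ (\sum_(j < m) (`|h| * e))); last first.
  rewrite sumr_const card_ord -mulr_natr -mulrA [X in _ <= X]mulrC.
  apply: ler_wpM2l => //; rewrite /e -mulrA.
  by rewrite ger_pMr // mulrC ler_pdivrMr // mul1r ler_nat.
apply: (le_trans (ler_norm_sum _ _ _)); apply: ler_sum => j _.
have near_seg (s : R) : 0 <= s <= 1 ->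
    `|x + trunc_row j h + (s * h 0 j) *: delta_mx 0 j - x| < r.
  move=> /andP[s0 s1]; apply: le_lt_trans hlt.
  rewrite addrAC [x + _]addrC addrK norm_row_le //.
  apply/forallP => l; rewrite !mxE eqxx /=.
  have [->|lj] := eqVneq l j.
    rewrite ltnn add0r mulr1 normrM ger0_norm //.
    apply: le_trans (norm_coord_le h j).
    by rewrite ler_piMl.
  by rewrite mulr0 addr0; case: ifP => _; rewrite ?normr0 ?normr_ge0 ?norm_coord_le.
have [s s01 ->] : exists2 s : R, 0 <= s <= 1 &
    f (x + trunc_row j.+1 h) - f (x + trunc_row j h) =
    h 0 j * 'D_(delta_mx 0 j) f (x + trunc_row j h + (s * h 0 j) *: delta_mx 0 j).
  rewrite trunc_rowS addrA; apply: mvt_line => s s01.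
  have [d _] := hf j; apply: d.
  by have [] := hr _ (near_seg s s01).
rewrite -mulrBr normrM; apply: ler_pM => //; first exact: norm_coord_le.
by have [_] := hr _ (near_seg s s01); exact.
Unshelve. all: by end_near. Qed.

Lemma grad_form_continuous f x : continuous (grad_form f x).
Proof.
suff h (y : 'rV[R]_m) : grad_form f x @ y --> grad_form f x y by exact: h.
have FF : Filter (nbhs y) by exact: nbhs_filter.
rewrite /grad_form.
apply: (@cvg_big _ _ +%R 0 xpredT add_continuous _ _ _
  (fun j (v : 'rV[R]_m) => v 0 j * 'D_(delta_mx 0 j) f x)) => j _.
apply: cvgM; last exact: cvg_cst.
exact: coord_continuous.
Qed.

(** [Ck_on] speaks of partial derivatives only; this is the passage to total differentiability on
    which the chain rule rests. *)
Lemma C1_differentiable W f x : open W -> Ck_on 1 W f -> W x ->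
  differentiable f x /\ 'd f x = grad_form f x :> ('rV[R]_m -> R).
Proof.
move=> oW cf Wx.
have dE : 'd f x = grad_form f x :> ('rV[R]_m -> R).
  apply: diff_unique; first exact: grad_form_continuous.
  by apply/eqaddoP => _/posnumP[eps]; exact: (C1_expansion _ oW cf Wx).
split=> //; apply/diff_locallyP; rewrite dE; split; first exact: grad_form_continuous.
by apply/eqaddoP => _/posnumP[eps]; exact: (C1_expansion _ oW cf Wx).
Qed.

End EuclideanCalculus.

(** * Chain rule and smoothness of composites *)

Section Composition.
Variable R : realType.

Lemma row_continuous p m (tau : 'rV[R]_p -> 'rV[R]_m) (x : 'rV[R]_p) :
  (forall j, {for x, continuous (fun y => tau y 0 j)}) ->
  {for x, continuous tau}.
Proof.
move=> h; have FF : Filter (nbhs x) by exact: nbhs_filter.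
apply/cvgrPdist_le => e e0.
near=> y; rewrite norm_row_le ?ltW //; apply/forallP => j.
move: j; near: y; apply: filter_forall => j.
have /cvgrPdist_le /(_ e e0) := h j.
by apply: filterS => y; rewrite !mxE.
Unshelve. all: by end_near. Qed.

(** Only a directional derivative of [tau] is given, so the chain rule is applied along the path
    [h *: v + x] followed by [tau], a differentiable function of one variable at 0. *)
Lemma derive_comp (U V : normedModType R) (tau : U -> V) (f : V -> R) x v :
  differentiable f (tau x) -> derivable tau x v ->
  derivable (f \o tau) x v /\ 'D_v (f \o tau) x = 'd f (tau x) ('D_v tau x).
Proof.
move=> df dt.
pose phi (h : R) := tau (h *: v + x).
have phi0 : phi 0 = tau x by rewrite /phi scale0r add0r.
have dphi : differentiable phi 0.
  by apply/derivable1_diffP; exact: (derivable1P tau x v).1.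
have df' : differentiable f (phi 0) by rewrite phi0.
have lineD (W : normedModType R) (g : U -> W) :
    'D_v g x = 'D_(1 : R) (fun h : R => g (h *: v + x)) 0.
  rewrite /derive (_ : (fun h : R => h^-1 *: ((g \o shift x) (h *: v) - g x)) =
    (fun h : R => h^-1 *: (((fun h : R => g (h *: v + x)) \o shift 0) (h *: (1 : R)) -
                           g (0 *: v + x)))) //.
  by apply/funext => h /=; rewrite addr0 scale0r add0r [h%:A]mulr1.
have dc : differentiable (f \o phi) 0 by exact: differentiable_comp.
split; first by apply: (derivable1P _ x v).2; apply/derivable1_diffP.
rewrite !lineD -[fun h : R => _]/(f \o phi) -/phi -!derive1E derive1E' //.
by rewrite diff_comp // -phi0 (derive1E' dphi).
Qed.

Lemma Ck_on_comp p m k (tau : 'rV[R]_p -> 'rV[R]_m) W' W f :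
  open W' -> open W -> (forall x, W' x -> W (tau x)) ->
  (forall j, smooth_on W' (fun x => tau x 0 j)) ->
  Ck_on k W f -> Ck_on k W' (f \o tau).
Proof.
move=> oW' oW sub st; elim: k f => [|k IH] f cf.
  split=> // x W'x; apply: continuous_comp; last by apply: cf.1; exact: sub.
  by apply: row_continuous => j; have [c _] := st j 0%N; exact: c.
have dtau x i : W' x -> derivable tau x (delta_mx 0 i).
  move=> W'x; apply/derivable_mxP => a j; rewrite (ord1 a).
  by have [_ h] := st j 1%N; have [d _] := h i; exact: d.
have cf1 : Ck_on 1 W f by elim: k {IH} cf => // k IH /Ck_onW.
have dd x i : W' x -> derivable (f \o tau) x (delta_mx 0 i) /\
    'D_(delta_mx 0 i) (f \o tau) x =
    (\sum_j (fun y => 'D_(delta_mx 0 i) (fun z => tau z 0 j) y) *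
       ('D_(delta_mx 0 j) f \o tau)) x.
  move=> W'x; have [df dfE] := C1_differentiable oW cf1 (sub _ W'x).
  have [dc ->] := derive_comp df (dtau x i W'x); split => //.
  rewrite dfE /grad_form fct_sumE; apply: eq_bigr => j _.
  by rewrite derive_mx ?mxE //; exact: dtau.
have [cf0 cfS] := cf.
split=> [x W'x|i].
  apply: continuous_comp; last by apply: cf0; exact: sub.
  by apply: row_continuous => j; have [c _] := st j 0%N; exact: c.
split=> [x W'x|]; first by have [] := dd x i W'x.
apply: (Ck_on_ext oW' (fun y W'y => esym (dd y i W'y).2)).
elim/big_ind : _ => [|g1 g2|j _]; first exact: Ck_on_cst.
  exact: Ck_onD.
apply: Ck_onM => //.
  by have [_ h] := st j k.+1; have [_ ?] := h i.
by apply: IH; have [_ ?] := cfS j.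
Qed.

(* [G] is a family of functions on the line which is closed under
   differentiation on [U]; its members are then smooth there. *)
Lemma smooth_on_comp1 m (G : set (R -> R)) (U : set R) W (phi : 'rV[R]_m -> R) :
  (forall g, G g -> exists2 g', G g' & forall s, U s -> is_derive s 1 g (g' s)) ->
  open W -> (forall x, W x -> U (phi x)) -> smooth_on W phi ->
  forall g, G g -> smooth_on W (g \o phi).
Proof.
move=> HG oW sub sphi g Gg k; elim: k g Gg => [|k IH] g Gg.
  have [g' _ dg] := HG g Gg.
  split=> // x Wx; apply: continuous_comp; first by have [c _] := sphi 0%N; exact: c.
  apply: differentiable_continuous; apply/derivable1_diffP.
  by have [] := dg _ (sub _ Wx).
have [g' Gg' dg] := HG g Gg.
have dd x i : W x -> derivable (g \o phi) x (delta_mx 0 i) /\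
   'D_(delta_mx 0 i) (g \o phi) x =
   ((g' \o phi) * (fun y => 'D_(delta_mx 0 i) phi y)) x.
  move=> Wx; have dgx := dg _ (sub _ Wx).
  have dif : differentiable g (phi x) by apply/derivable1_diffP; have [] := dgx.
  have [_ h] := sphi 1%N; have [dphi _] := h i.
  have [dc ->] := derive_comp dif (dphi x Wx); split => //.
  rewrite diff1E // derive1E (derive_val (is_derive := dgx)).
  by rewrite mulrfctE /= mulrC.
split=> [x Wx|i].
  apply: continuous_comp; first by have [c _] := sphi 0%N; exact: c.
  apply: differentiable_continuous; apply/derivable1_diffP.
  by have [] := dg _ (sub _ Wx).
split=> [x Wx|]; first by have [] := dd x i Wx.
apply: (Ck_on_ext oW (fun y Wy => esym (dd y i Wy).2)).
apply: Ck_onM => //; first exact: IH.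
by have [_ h] := sphi k.+1; have [_] := h i.
Qed.

Lemma smooth_onV m W (phi : 'rV[R]_m -> R) : open W ->
  (forall x, W x -> phi x != 0) -> smooth_on W phi ->
  smooth_on W (fun x => (phi x)^-1).
Proof.
move=> oW nz sphi.
pose G := [set g : R -> R | exists c n, g = fun s : R => c * s^-1 ^+ n].
apply: (@smooth_on_comp1 m G [set s | s != 0] W phi _ oW nz sphi
  (fun s => s^-1)); last by exists 1, 1%N; apply/funext => s; rewrite mul1r expr1.
move=> _ [c [n ->]]; exists (fun s => (- (c * n%:R)) * s^-1 ^+ n.+1).
  by exists (- (c * n%:R)), n.+1.
move=> s /= s0.
have dV : is_derive s (1 : R) (fun s : R => s^-1) (- s ^- 2).
  have := is_deriveV s0 (is_derive_id s (1 : R)).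
    by rewrite scaleNr [_ *: 1]mulr1.
have dX := @is_deriveX _ _ (fun s : R => s^-1) n s 1 _ dV.
have := is_deriveZ c dX.
have -> : (c \*: (fun s : R => s^-1) ^+ n) = (fun s1 : R => c * s1^-1 ^+ n).
  by apply/funext => r; rewrite /= exprfctE.
have -> // : c *: ((n%:R * s^-1 ^+ n.-1) *: - s ^- 2) = - (c * n%:R) * s^-1 ^+ n.+1.
rewrite [c *: _]mulrA -/(_ *: _) /GRing.scale /=.
case: n {dX} => [|n]; first by rewrite !mulr0 !mul0r !mulr0 ?oppr0 ?mul0r.
rewrite /= -exprVn expr2 !exprS.
by ring.
Qed.

End Composition.

Section SmoothClosure.
Variables (R : realType) (m : nat) (W : set 'rV[R]_m).
Hypothesis oW : open W.

Lemma smooth_on_cst (a : R) : smooth_on W (fun=> a).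
Proof. by move=> k; exact: Ck_on_cst. Qed.

Lemma smooth_onD f g : smooth_on W f -> smooth_on W g ->
  smooth_on W (fun x => f x + g x).
Proof. by move=> sf sg k; exact: Ck_onD. Qed.

Lemma smooth_onM f g : smooth_on W f -> smooth_on W g ->
  smooth_on W (fun x => f x * g x).
Proof. by move=> sf sg k; exact: Ck_onM. Qed.

Lemma smooth_onN f : smooth_on W f -> smooth_on W (fun x => - f x).
Proof.
move=> sf k; apply: (Ck_on_ext oW _ (smooth_onM (smooth_on_cst (-1)) sf k)).
by move=> x _; rewrite mulN1r.
Qed.

Lemma smooth_onB f g : smooth_on W f -> smooth_on W g ->
  smooth_on W (fun x => f x - g x).
Proof. by move=> sf sg; apply: smooth_onD => //; exact: smooth_onN. Qed.

Lemma smooth_on_ext f g : (forall x, W x -> f x = g x) ->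
  smooth_on W f -> smooth_on W g.
Proof. by move=> e sf k; exact: Ck_on_ext (sf k). Qed.

Lemma smooth_on_prod (I : Type) (r : seq I) (P : pred I) (F : I -> 'rV[R]_m -> R) :
  (forall i, P i -> smooth_on W (F i)) ->
  smooth_on W (fun x => \prod_(i <- r | P i) F i x).
Proof.
move=> h; elim: r => [|a r IH].
  by apply: (smooth_on_ext _ (smooth_on_cst 1)) => x _; rewrite big_nil.
case Pa : (P a); last first.
  by apply: smooth_on_ext IH => x _; rewrite big_cons Pa.
apply: (smooth_on_ext _ (smooth_onM (h a Pa) IH)) => x _.
by rewrite big_cons Pa.
Qed.

Lemma is_derive_coord (x v : 'rV[R]_m) j :
  is_derive x v (fun y : 'rV[R]_m => y 0 j) (v 0 j).
Proof.
have d : derivable (id : 'rV[R]_m -> 'rV[R]_m) x v by exact: derivable_id.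
split; first by move: d => /derivable_mxP; exact.
by have := derive_id x v; rewrite derive_mx // => /rowP/(_ j); rewrite mxE.
Qed.

Lemma smooth_on_coord j : smooth_on W (fun y => y 0 j).
Proof.
have c : {in W, continuous (fun y : 'rV[R]_m => y 0 j)}.
  by move=> x _; exact: coord_continuous.
case=> [|k]; first by split=> // x Wx; apply: c; exact/mem_set.
split=> [x Wx|i]; first by apply: c; exact/mem_set.
split=> [x _|]; first by have [] := is_derive_coord x (delta_mx 0 i) j.
apply: (Ck_on_ext oW _ (smooth_on_cst ((delta_mx 0 i : 'rV[R]_m) 0 j) k)) => x _.
by rewrite (derive_val (is_derive := is_derive_coord x (delta_mx 0 i) j)).
Qed.

Lemma smooth_on_D f i : smooth_on W f ->
  smooth_on W (fun x => 'D_(delta_mx 0 i) f x).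
Proof. by move=> sf k; have [_ h] := sf k.+1; have [_] := h i. Qed.

Lemma smooth_on_derivable f i x : smooth_on W f -> W x ->
  derivable f x (delta_mx 0 i).
Proof. by move=> sf Wx; have [_ h] := sf 1%N; have [d _] := h i; exact: d. Qed.

Lemma smooth_on_continuous f x : smooth_on W f -> W x -> {for x, continuous f}.
Proof. by move=> sf Wx; have [c _] := sf 0%N; exact: c. Qed.

Lemma smooth_onW (W' : set 'rV[R]_m) f : W' `<=` W -> smooth_on W f -> smooth_on W' f.
Proof.
move=> s sf k; move: f {sf}(sf k); elim: k => [|k IH] f [c h].
  by split=> // x W'x; apply: c; exact: s.
split=> [x W'x|i]; first by apply: c; exact: s.
by have [d e] := h i; split; [move=> x W'x; apply: d; exact: s | exact: IH].
Qed.

End SmoothClosure.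

Lemma smooth_on_local (R : realType) m (W : set 'rV[R]_m) f :
  (forall x, W x -> exists2 U, U x & smooth_on U f) -> smooth_on W f.
Proof.
move=> h k.
have {}h x : W x -> exists2 U, U x & Ck_on k U f.
  by move=> /h[U Ux sU]; exists U.
elim: k f h => [|k IH] f h.
  by split=> // x Wx; have [U Ux [c _]] := h x Wx; exact: c.
split=> [x Wx|i]; first by have [U Ux [c _]] := h x Wx; exact: c.
split=> [x Wx|].
  by have [U Ux [_ d]] := h x Wx; have [e _] := d i; exact: e.
by apply: IH => x Wx; have [U Ux [_ d]] := h x Wx; have [_] := d i; exists U.
Qed.

(** * Flat functions and smooth cutoffs *)

Section FlatFunction.
Variable R : realType.

(** The polynomial factor makes the family stable under differentiation; [P = 1] is exp(-1/s)
    extended by 0. *)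
Definition flat_exp (P : {poly R}) (s : R) : R :=
  if 0 < s then P.[s^-1] * expR (- s^-1) else 0.

(** With u = 1/s, the exponential series gives u^(k+2) <= (k+2)! exp u for each coefficient of [P].
    A quadratic bound is what forces a zero derivative at the origin. *)
Lemma flat_bound P : exists2 C : R, 0 <= C & forall s, `|flat_exp P s| <= C * s ^+ 2.
Proof.
exists (\sum_(k < size P) `|P`_k| * (k.+2)`!%:R).
  by apply: sumr_ge0 => k _; rewrite mulr_ge0.
move=> s; rewrite /flat_exp; case: ifPn => [s0|_]; last first.
  rewrite normr0 mulr_ge0 ?sqr_ge0 //.
  by apply: sumr_ge0 => k _; rewrite mulr_ge0.
have u0 : 0 < s^-1 by rewrite invr_gt0.
rewrite normrM (ger0_norm (expR_ge0 _)) horner_coef mulr_suml.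
apply: (@le_trans _ _ ((\sum_(k < size P) `|P`_k| * s^-1 ^+ k) * expR (- s^-1))).
  apply: ler_wpM2r; first exact: expR_ge0.
  apply: (le_trans (ler_norm_sum _ _ _)); apply: ler_sum => k _.
  by rewrite normrM normrX (gtr0_norm u0).
rewrite mulr_suml; apply: ler_sum => k _; rewrite -!mulrA.
apply: ler_wpM2l => //.
have h := expR_ge1Dxn k.+1 (ltW u0).
have {}h : s^-1 ^+ k.+2 <= (k.+2)`!%:R * expR s^-1.
  rewrite mulrC -ler_pdivrMr ?ltr0n ?fact_gt0 //; apply: le_trans h.
  by rewrite lerDr.
rewrite expRN ler_pdivrMr ?expR_gt0 // mulrAC.
rewrite -ler_pdivrMr ?exprn_gt0 //; apply: le_trans h.
by rewrite -exprVn -exprD addn2.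
Qed.

(** For [s > 0] the chain rule gives (P - P')(1/s) exp(-1/s) / s^2, whence the factor ['X^2]; at 0
    the quadratic bound sends the difference quotient to 0. *)
Lemma is_derive_flat P (s : R) :
  is_derive s 1 (flat_exp P) (flat_exp ('X^2 * (P - P^`())) s).
Proof.
have [s0|s0|->] := ltgtP s 0.
- rewrite /flat_exp ltNge (ltW s0) /=.
  apply: (@near_eq_is_derive _ _ _ (cst 0)) => //.
  by near=> r; rewrite ltNge ltW //=; near: r; exact: lt_nbhsl.
- rewrite /flat_exp s0.
  apply: (@near_eq_is_derive _ _ _ (fun r : R => P.[r^-1] * expR (- r^-1))) => //.
    by near=> r; rewrite (_ : 0 < r) //; near: r; exact: lt_nbhsr.
  have dV : is_derive s (1 : R) (fun s : R => s^-1) (- s ^- 2).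
    have := is_deriveV (lt0r_neq0 s0) (is_derive_id s (1 : R)).
    by rewrite scaleNr [_ *: 1]mulr1.
  have d1 := @is_derive1_comp _ (horner P) (fun s : R => s^-1) s _ _
     (is_derive_poly P s^-1) dV.
  have dE : is_derive (- s^-1) (1 : R) (@expR R) (expR (- s^-1)).
    exact: is_derive_expR.
  have d2 := @is_derive1_comp _ (@expR R) (- (fun s : R => s^-1)) s _ _ dE
     (is_deriveN dV).
  have := is_deriveM d1 d2.
  have -> : (horner P \o (fun s : R => s^-1)) * (@expR R \o - (fun s : R => s^-1)) =
     (fun r : R => P.[r^-1] * expR (- r^-1)) by apply/funext.
  move/is_derive_eq; apply.
  rewrite !hornerE -!exprVn opprK /GRing.scale /=.
  by ring.
- have [C C0 hC] := flat_bound P.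
  have f0 Q : flat_exp Q 0 = 0 by rewrite /flat_exp ltxx.
  rewrite f0.
  have lim0 : h^-1 *: ((flat_exp P \o shift 0) (h *: (1 : R)) - flat_exp P 0) @[h --> 0^']
      --> (0 : R).
    apply/cvgrPdist_le => e e0; near=> h.
    rewrite sub0r normrN /= addr0 [h *: 1]mulr1 f0 subr0 normrM normfV.
    have h0 : h != 0 by near: h; exact: nbhs_dnbhs_neq.
    rewrite mulrC ler_pdivrMr ?normr_gt0 //; apply: (le_trans (hC h)).
    rewrite -[h ^+ 2]ger0_norm ?sqr_ge0 // normrX expr2 mulrA.
    apply: ler_wpM2r => //.
    apply: (@le_trans _ _ ((C + 1) * `|h|)).
      by apply: ler_wpM2r => //; rewrite lerDl.
    rewrite mulrC -ler_pdivlMr ?ltr_wpDl //.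
    apply: ltW; near: h; apply: dnbhs0_lt.
    by rewrite divr_gt0 // ltr_wpDl.
  by apply: DeriveDef; [apply/cvg_ex; exists 0 | exact/cvg_lim].
Unshelve. all: by end_near. Qed.

Lemma flat_ge0 s : 0 <= flat_exp 1 s.
Proof. by rewrite /flat_exp; case: ifP => // _; rewrite hornerC mul1r expR_ge0. Qed.

Lemma flat_gt0 s : (0 < flat_exp 1 s) = (0 < s).
Proof.
by rewrite /flat_exp; case: ifP => // s0; rewrite ?ltxx // hornerC mul1r expR_gt0.
Qed.

Lemma smooth_on_flat m (W : set 'rV[R]_m) (phi : 'rV[R]_m -> R) : open W ->
  smooth_on W phi -> smooth_on W (fun x => flat_exp 1 (phi x)).
Proof.
move=> oW sphi.
apply: (@smooth_on_comp1 R m [set g | exists P, g = flat_exp P] setT W phi _ oW _ sphi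
  (flat_exp 1)) => //; last by exists 1.
move=> _ [P ->]; exists (flat_exp ('X^2 * (P - P^`()))); first by exists ('X^2 * (P - P^`())).
by move=> s _; exact: is_derive_flat.
Qed.

End FlatFunction.

Section Bumps.
Variables (R : realType) (m : nat).
Implicit Types (q y : 'rV[R]_m) (r : R).

Definition cube_bump q r y : R := \prod_j flat_exp 1 (r ^+ 2 - (y 0 j - q 0 j) ^+ 2).

Definition cutoff (r s : R) : R :=
  flat_exp 1 ((2 * r) ^+ 2 - s ^+ 2) *
  (flat_exp 1 ((2 * r) ^+ 2 - s ^+ 2) + flat_exp 1 (s ^+ 2 - r ^+ 2))^-1.

Definition plateau q r y : R := \prod_j cutoff r (y 0 j - q 0 j).

Lemma smooth_bump (W : set 'rV[R]_m) q r : open W -> smooth_on W (cube_bump q r).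
Proof.
move=> oW; apply: smooth_on_prod => // j _; apply: smooth_on_flat => //.
apply: smooth_onB; [by []|exact: smooth_on_cst|].
by apply: smooth_onM => //; apply: smooth_onB => //;
  [exact: smooth_on_coord|exact: smooth_on_cst|exact: smooth_on_coord|exact: smooth_on_cst].
Qed.

Lemma cutoff_den_gt0 r s : 0 < r ->
  0 < flat_exp 1 ((2 * r) ^+ 2 - s ^+ 2) + flat_exp 1 (s ^+ 2 - r ^+ 2).
Proof.
move=> r0; have [h|h] := ltP (s ^+ 2) ((2 * r) ^+ 2).
  by apply: ltr_pwDl; rewrite ?flat_ge0 // flat_gt0 subr_gt0.
apply: ltr_wpDl; rewrite ?flat_ge0 // flat_gt0 subr_gt0; apply: lt_le_trans h.
by nra.
Qed.

Lemma smooth_plateau (W : set 'rV[R]_m) q r : 0 < r -> open W ->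
  smooth_on W (plateau q r).
Proof.
move=> r0 oW; apply: smooth_on_prod => // j _.
have sj : smooth_on W (fun y => y 0 j - q 0 j).
  by apply: smooth_onB => //; [exact: smooth_on_coord|exact: smooth_on_cst].
have s2 := smooth_onM oW sj sj.
have c a : smooth_on W (fun=> a : R) by exact: smooth_on_cst.
have f1 : smooth_on W (fun y => flat_exp 1 ((2 * r) ^+ 2 - (y 0 j - q 0 j) ^+ 2)).
  by apply: smooth_on_flat => //; exact: smooth_onB.
have f2 : smooth_on W (fun y => flat_exp 1 ((y 0 j - q 0 j) ^+ 2 - r ^+ 2)).
  by apply: smooth_on_flat => //; exact: smooth_onB.
apply: smooth_onM => //; apply: smooth_onV => //; last exact: smooth_onD.
by move=> x _; rewrite gt_eqF // cutoff_den_gt0.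
Qed.

Lemma bump_ge0 q r y : 0 <= cube_bump q r y.
Proof. by apply: prodr_ge0 => j _; exact: flat_ge0. Qed.

Lemma sqr_lt_norm (r s : R) : 0 < r -> (0 < r ^+ 2 - s ^+ 2) = (`|s| < r).
Proof.
move=> r0; rewrite subr_gt0 -[s ^+ 2]real_normK ?num_real //.
by rewrite ltr_pXn2r // nnegrE ltW.
Qed.

Lemma bump_gt0 q r y : 0 < r -> (forall j, `|y 0 j - q 0 j| < r) -> 0 < cube_bump q r y.
Proof. by move=> r0 h; apply: prodr_gt0 => j _; rewrite flat_gt0 sqr_lt_norm. Qed.

Lemma flat_eq0 (s : R) : s <= 0 -> flat_exp 1 s = 0.
Proof. by rewrite /flat_exp ltNge => ->. Qed.

Lemma bump_eq0 q r y : 0 < r -> cube_bump q r y != 0 -> forall j, `|y 0 j - q 0 j| < r.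
Proof.
move=> r0 + j; apply: contraNT; rewrite -sqr_lt_norm // -leNgt => h.
by rewrite /cube_bump (bigD1 j) //= flat_eq0 // mul0r.
Qed.

Lemma plateau1 q r y : 0 < r -> (forall j, `|y 0 j - q 0 j| <= r) -> plateau q r y = 1.
Proof.
move=> r0 h; apply: big1 => j _; rewrite /cutoff.
rewrite (@flat_eq0 (_ - r ^+ 2)) ?addr0; last first.
  rewrite subr_le0 -[X in X <= _]real_normK ?num_real //.
  by rewrite ler_pXn2r // nnegrE ltW.
rewrite divff // gt_eqF // flat_gt0 sqr_lt_norm ?mulr_gt0 //.
by apply: le_lt_trans (h j) _; rewrite ltr_pMl // ltr1n.
Qed.

Lemma plateau_eq0 q r y : 0 < r -> plateau q r y != 0 ->
  forall j, `|y 0 j - q 0 j| < 2 * r.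
Proof.
move=> r0 + j; apply: contraNT; rewrite -sqr_lt_norm ?mulr_gt0 // -leNgt => h.
by rewrite /plateau (bigD1 j) //= /cutoff flat_eq0 // !mul0r.
Qed.

End Bumps.

(** * Uniform Taylor estimates on closed balls *)

Section ClosedBall.
Variables (R : realType) (m : nat).
Implicit Types (q x y z : 'rV[R]_m) (r : R) (f : 'rV[R]_m -> R).

Definition cball q r : set 'rV[R]_m := [set y | `|y - q| <= r].
Definition oball q r : set 'rV[R]_m := [set y | `|y - q| < r].

Lemma dist_continuous q : continuous (fun y => `|y - q|).
Proof.
suff h (y : 'rV[R]_m) : `|z - q| @[z --> y] --> `|y - q| by exact: h.
have FF : Filter (nbhs y) by exact: nbhs_filter.
apply: (cvg_norm (V := 'rV[R]_m)); apply: cvgB; [exact: cvg_id|exact: cvg_cst].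
Qed.

Lemma oball_open q r : open (oball q r).
Proof.
apply: (@open_comp _ _ (fun y => `|y - q|) [set s | s < r]).
  by move=> y _; exact: dist_continuous.
exact: open_lt.
Qed.

Lemma cball_closed q r : closed (cball q r).
Proof.
apply: (@closed_comp _ _ (fun y => `|y - q|) [set s | s <= r]).
  by move=> y _; exact: dist_continuous.
exact: closed_le.
Qed.

Lemma cball_compact q r : compact (cball q r).
Proof.
apply: bounded_closed_compact; last exact: cball_closed.
exists (r + `|q|); split; first exact: num_real.
move=> b rb y /= yr; apply: ltW; apply: le_lt_trans rb.
by rewrite -[y](subrK q) (le_trans (ler_normD _ _)) // lerD2r.
Qed.

Lemma cball_convex q r x y (t : R) : 0 <= t <= 1 ->
  cball q r x -> cball q r y -> cball q r (x + t *: (y - x)).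
Proof.
move=> /andP[t0 t1] hx hy; rewrite /cball /=.
have -> : x + t *: (y - x) - q = (1 - t) *: (x - q) + t *: (y - q).
  by apply/rowP => j; rewrite !mxE; ring.
apply: (le_trans (ler_normD _ _)); rewrite !normrZ.
have t1' : 0 <= 1 - t by rewrite subr_ge0.
rewrite !ger0_norm //.
apply: (@le_trans _ _ ((1 - t) * r + t * r)); last by rewrite -mulrDl subrK mul1r.
by apply: lerD; apply: ler_wpM2l.
Qed.

Lemma compact_bounded_abs (K : set 'rV[R]_m) f : compact K ->
  (forall x, K x -> {for x, continuous f}) ->
  exists2 C : R, 0 <= C & forall x, K x -> `|f x| <= C.
Proof.
move=> cK cf; have [K0|/set0P/negP/negPn/eqP K0] := pselect (K !=set0); last first.
  by exists 0 => // x; rewrite K0.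
have cn : {within K, continuous (fun x => `|f x|)}.
  apply: continuous_in_subspaceT => x /set_mem Kx.
  by apply: (@continuous_comp _ _ _ f (fun s => `|s|)); [exact: cf|exact: norm_continuous].
have [c _ hc] := EVT_max_rV K0 cK cn.
by exists `|f c| => // x Kx; apply: hc; exact: mem_set.
Qed.

Section Estimates.
Variables (W : set 'rV[R]_m) (oW : open W) (q : 'rV[R]_m) (r : R).
Hypothesis sub : cball q r `<=` W.

Lemma C1_lipschitz f : smooth_on W f -> exists2 C : R, 0 <= C &
  forall x y, cball q r x -> cball q r y -> `|f y - f x| <= C * `|y - x|.
Proof.
move=> sf.
have b j : exists2 C : R, 0 <= C &
    forall x, cball q r x -> `|'D_(delta_mx 0 j) f x| <= C.
  apply: compact_bounded_abs; first exact: cball_compact.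
  by move=> x /sub Wx; apply: smooth_on_continuous Wx; exact: smooth_on_D.
pose C j := sval (cid2 (b j)).
have C0 j : 0 <= C j by rewrite /C; case: cid2.
have hC j x : cball q r x -> `|'D_(delta_mx 0 j) f x| <= C j.
  by rewrite /C; case: cid2 => /= c _; exact.
exists (\sum_j C j); first by apply: sumr_ge0.
move=> x y bx bz.
have dif z : cball q r z -> differentiable f z /\ 'd f z = grad_form f z :> (_ -> _).
  by move=> /sub Wz; exact: C1_differentiable (sf 1%N) Wz.
have [s s01] : exists2 s : R, 0 <= s <= 1 & f (x + 1 *: (y - x)) - f x =
    1 * 'D_(y - x) f (x + (s * 1) *: (y - x)).
  apply: mvt_line => s s01; rewrite mulr1; apply: diff_derivable.
  by apply: (dif _ _).1; exact: cball_convex.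
rewrite scale1r mulr1 mul1r [x + (y - x)]addrC subrK => ->.
set z := x + _; have bzz : cball q r z by exact: cball_convex.
have [dfz ez] := dif z bzz.
rewrite deriveE // ez /grad_form mulr_suml.
apply: (le_trans (ler_norm_sum _ _ _)); apply: ler_sum => j _.
rewrite normrM mulrC; apply: ler_pM => //; first exact: hC.
exact: norm_coord_le.
Qed.

(** The remainder is uniform on the ball, so difference quotients can be compared with derivatives
    under an integral sign without a convergence theorem. *)
Lemma C2_taylor f i : smooth_on W f -> exists2 C : R, 0 <= C &
  forall x (h : R), cball q r x -> cball q r (x + h *: delta_mx 0 i) ->
    `|f (x + h *: delta_mx 0 i) - f x - h * 'D_(delta_mx 0 i) f x| <= C * h ^+ 2.
Proof.
move=> sf; have [C C0 hC] := C1_lipschitz (smooth_on_D i sf).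
exists C => // x h bx bh.
have seg (s : R) : 0 <= s <= 1 -> cball q r (x + (s * h) *: delta_mx 0 i).
  move=> s01; have := cball_convex s01 bx bh.
  by rewrite [x + h *: _]addrC addrK scalerA.
have [s s01 ->] : exists2 s : R, 0 <= s <= 1 & f (x + h *: delta_mx 0 i) - f x =
    h * 'D_(delta_mx 0 i) f (x + (s * h) *: delta_mx 0 i).
  apply: mvt_line => s s01.
  by apply: smooth_on_derivable sf _; apply: sub; exact: seg.
rewrite -mulrBr normrM.
have := hC _ _ bx (seg s s01).
rewrite [x + _ - x]addrAC subrr add0r normrZ normrM => hC'.
apply: (@le_trans _ _ (`|h| * (C * `|h|))).
  apply: ler_wpM2l => //; apply: (le_trans hC'); apply: ler_wpM2l => //.
  have -> : `|delta_mx 0 i : 'rV[R]_m| = 1.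
    apply/eqP; rewrite eq_le norm_row_le // -{2}[1](@normr1 R); apply/andP; split.
      by apply/forallP => j; rewrite !mxE eqxx /=; case: eqP => _;
         rewrite ?normr1 ?normr0.
    by have := norm_coord_le (delta_mx 0 i : 'rV[R]_m) i; rewrite !mxE !eqxx.
  case/andP: s01 => s0 s1; rewrite mulr1 (ger0_norm s0).
  by rewrite ler_piMl.
by rewrite mulrCA -normrM -expr2 ger0_norm ?sqr_ge0.
Qed.

End Estimates.
End ClosedBall.

(** * Hadamard's lemma on a ball *)

Section Hadamard.
Variables (R : realType) (m : nat).
Implicit Types (F f : 'rV[R]_m -> R).
Local Notation mu := (@lebesgue_measure R).

Definition avg (u : R -> R) : R := \int[mu]_(t in `[0, 1]) u t.

Definition cont01 (u : R -> R) := forall t : R, 0 <= t <= 1 -> {for t, continuous u}.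

Lemma cont01_integrable u : cont01 u ->
  mu.-integrable (`[0, 1] : set R) (EFin \o u).
Proof.
move=> cu; apply: continuous_compact_integrable; first exact: segment_compact.
by apply: continuous_in_subspaceT => t /set_mem; rewrite /= in_itv /=; exact: cu.
Qed.

Lemma mu01 : fine (mu (`[0, 1] : set R)) = 1.
Proof. by rewrite lebesgue_measure_itv /= lte_fin ltr01 -EFinD /= subr0. Qed.

Lemma avg_bound u (C : R) : cont01 u -> (forall t, 0 <= t <= 1 -> `|u t| <= C) ->
  `|avg u| <= C.
Proof.
move=> cu hC; have iu := cont01_integrable cu.
have h : `|\int[mu]_(t in `[0, 1]) u t| <= \int[mu]_(t in `[0, 1]) `|u t|.
  by apply: le_normr_Rintegral => //; exact: measurable_itv.
apply: (le_trans h).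
have <- : avg (fun=> C) = C by rewrite /avg Rintegral_cst // mu01 mulr1.
apply: le_Rintegral => //.
- have cn : cont01 (fun t => `|u t|).
    move=> t t01; apply: (@continuous_comp _ _ _ u (fun s => `|s|)).
      exact: cu.
    exact: norm_continuous.
  exact: cont01_integrable cn.
- by apply: (@cont01_integrable (fun=> C)) => t _; exact: cst_continuous.
Qed.

Lemma avgB u v : cont01 u -> cont01 v -> avg (fun t => u t - v t) = avg u - avg v.
Proof.
by move=> cu cv; rewrite /avg RintegralB //; exact: cont01_integrable.
Qed.

Lemma avgZ (c : R) u : cont01 u -> avg (fun t => c * u t) = c * avg u.
Proof. by move=> cu; rewrite /avg RintegralZl //; exact: cont01_integrable. Qed.

Lemma avg_sum (n : nat) (u : 'I_n -> R -> R) : (forall j, cont01 (u j)) ->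
  avg (fun t => \sum_j u j t) = \sum_j avg (u j).
Proof.
elim: n u => [|n IH] u cu.
  rewrite big_ord0 /avg (@eq_Rintegral _ _ _ mu _ (fun=> 0)); last first.
    by move=> t _; rewrite big_ord0.
  by rewrite Rintegral_cst // mul0r.
rewrite big_ord_recr /= -IH // /avg -RintegralD //; last 2 first.
- apply: (@cont01_integrable (fun t => \sum_(j < n) u (widen_ord (leqnSn n) j) t)).
  move=> t t01; apply: (@cvg_big _ _ +%R 0 xpredT add_continuous _ _ _
    (fun j t => u (widen_ord (leqnSn n) j) t)) => j _; exact: cu.
- exact: cont01_integrable.
by apply: eq_Rintegral => t _; rewrite big_ord_recr.
Qed.

Section Star.
Variables (q x : 'rV[R]_m) (rho : R).
Hypothesis bx : oball q rho x.
Local Notation W := (oball q rho).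

Definition ray (y : 'rV[R]_m) (t : R) : 'rV[R]_m := x + t *: (y - x).

Lemma oball_cball y : W y -> exists2 r, cball q r x & [/\ `|y - q| < r & r < rho].
Proof.
move=> Wy; pose a := Num.max `|x - q| `|y - q|.
have arho : a < rho by rewrite gt_max; apply/andP; split; [exact: bx|exact: Wy].
exists ((a + rho) / 2); rewrite /cball /=.
  by apply: le_trans (ltW (midf_lt arho).1); rewrite le_max lexx.
split; last exact: (midf_lt arho).2.
by apply: le_lt_trans (midf_lt arho).1; rewrite le_max lexx orbT.
Qed.

Lemma cball_sub_oball r : r < rho -> cball q r `<=` W.
Proof. by move=> h y /= yr; exact: le_lt_trans h. Qed.

Lemma ray_in y t : W y -> 0 <= t <= 1 -> W (ray y t).
Proof.
move=> Wy t01; have [r xr [yr rr]] := oball_cball Wy.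
by apply: (cball_sub_oball rr); apply: cball_convex => //; exact: ltW.
Qed.

Lemma ray_continuous y : continuous (ray y).
Proof.
move=> t; rewrite /ray /continuous_at.
by apply: cvgD; [exact: cvg_cst|apply: cvgZr_tmp; exact: cvg_id].
Qed.

Lemma cont01_ray F a y : smooth_on W F -> W y ->
  cont01 (fun t => t ^+ a * F (ray y t)).
Proof.
move=> sF Wy t t01; apply: (@continuousM R R); first exact: exprn_continuous.
apply: (@continuous_comp _ _ _ (ray y) F); first exact: ray_continuous.
by apply: smooth_on_continuous sF _; exact: ray_in.
Qed.

(** Differentiation in [y] brings out a factor [t]; carrying the power [t ^+ a] keeps the family
    closed under differentiation. *)
Definition ray_avg a F y : R := avg (fun t => t ^+ a * F (ray y t)).

Lemma expr01 (t : R) a : 0 <= t <= 1 -> `|t ^+ a| <= 1.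
Proof.
by move=> /andP[t0 t1]; rewrite ger0_norm ?exprn_ge0 // exprn_ile1.
Qed.

Lemma ray_avg_continuous a F y : smooth_on W F -> W y ->
  {for y, continuous (ray_avg a F)}.
Proof.
move=> sF Wy; have [r xr [yr rr]] := oball_cball Wy.
have oW := @oball_open R m q rho.
have [C C0 hC] := C1_lipschitz oW (cball_sub_oball rr) sF.
suff h : ray_avg a F z @[z --> (y : 'rV[R]_m)] --> ray_avg a F y by exact: h.
have FF : Filter (nbhs (y : 'rV[R]_m)) by exact: nbhs_filter.
apply/cvgrPdist_le => e e0; near=> z.
have Wz : `|z - q| < r.
  by near: z; exact: (open_nbhs_nbhs (conj (@oball_open R m q r) yr)).
rewrite /ray_avg -avgB; last 2 first.
- exact: cont01_ray.
- by apply: cont01_ray => //; exact: lt_trans rr.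
apply: avg_bound.
  move=> t t01; apply: (@continuousB R R).
    exact: (cont01_ray (a := a) sF Wy t01).
  by apply: (cont01_ray (a := a) sF _ t01); exact: lt_trans rr.
move=> t t01; rewrite -mulrBr normrM.
apply: (@le_trans _ _ (1 * (C * `|y - z|))); last first.
  rewrite mul1r; apply: (@le_trans _ _ ((C + 1) * `|y - z|)).
    by apply: ler_wpM2r => //; rewrite lerDl.
  rewrite mulrC -ler_pdivlMr ?ltr_wpDl //.
  apply: ltW; rewrite distrC; near: z.
  apply: (open_nbhs_nbhs (conj (@oball_open R m y (e / (C + 1))) _)).
  by rewrite /oball /= subrr normr0 divr_gt0 // ltr_wpDl.
apply: ler_pM => //; first exact: expr01.
apply: (le_trans (hC _ _ _ _)); try (apply: cball_convex => //; exact: ltW).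
apply: ler_wpM2l => //.
have -> : ray y t - ray z t = t *: (y - z).
  by rewrite /ray opprD addrACA subrr add0r -scalerBr opprB addrA subrK.
rewrite normrZ ler_piMl //; case/andP: t01 => t0 t1.
by rewrite ger0_norm.
Unshelve. all: by end_near. Qed.

(** The Taylor bound holds for all [t] in [0, 1] at once, since the segments issuing from [x] stay
    in one closed ball; averaging it over [t] gives the derivative. *)
Lemma ray_avg_derive a F y i : smooth_on W F -> W y ->
  is_derive y (delta_mx 0 i) (ray_avg a F)
    (ray_avg a.+1 (fun z => 'D_(delta_mx 0 i) F z) y).
Proof.
move=> sF Wy; have [r xr [yr rr]] := oball_cball Wy.
have oW := @oball_open R m q rho.
have sdF := smooth_on_D i sF.
have [C C0 hC] := C2_taylor oW (cball_sub_oball rr) i sF.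
set e_ := delta_mx 0 i.
have lim0 : h^-1 *: ((ray_avg a F \o shift y) (h *: e_) - ray_avg a F y) @[h --> 0^']
     --> ray_avg a.+1 (fun z => 'D_e_ F z) y.
  apply/cvgrPdist_le => e e0; near=> h.
  have h0 : h != 0 by near: h; exact: nbhs_dnbhs_neq.
  have hr : `|y + h *: e_ - q| < r.
    rewrite addrAC; apply: (le_lt_trans (ler_normD _ _)).
    rewrite -ltrBrDl normrZ.
    apply: (@le_lt_trans _ _ (`|h| * (`|e_| + 1))).
      by apply: ler_wpM2l => //; rewrite lerDl.
    rewrite -ltr_pdivlMr ?ltr_wpDl //; near: h; apply: dnbhs0_lt.
    by apply: divr_gt0; [rewrite subr_gt0|exact: ltr_wpDl].
  have Wh : W (y + h *: e_) by exact: lt_trans rr.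
  rewrite /= [h *: e_ + y]addrC.
  have c1 := cont01_ray (a := a) sF Wh; have c2 := cont01_ray (a := a) sF Wy.
  have c3 := cont01_ray (a := a.+1) sdF Wy.
  rewrite [_ *: _]mulrC -[X in `|X - _|](mulfK h0) -mulrBl normrM normfV.
  rewrite ler_pdivrMr ?normr_gt0 //.
  rewrite distrC /ray_avg -avgB // [avg _ * h]mulrC -avgZ // -avgB //; last 2 first.
  - by move=> t t01; apply: (@continuousB R R); [exact: c1|exact: c2].
  - by move=> t t01; apply: (@continuousM R R); [exact: cst_continuous|exact: c3].
  apply: (@le_trans _ _ (C * h ^+ 2)); last first.
    rewrite -[h ^+ 2]ger0_norm ?sqr_ge0 // normrX expr2 mulrA.
    apply: ler_wpM2r => //.
    apply: (@le_trans _ _ ((C + 1) * `|h|)).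
      by apply: ler_wpM2r => //; rewrite lerDl.
    rewrite mulrC -ler_pdivlMr ?ltr_wpDl //.
    apply: ltW; near: h; apply: dnbhs0_lt.
    by rewrite divr_gt0 // ltr_wpDl.
  apply: avg_bound.
    move=> t t01; apply: (@continuousB R R).
      by apply: (@continuousB R R); [exact: c1|exact: c2].
    by apply: (@continuousM R R); [exact: cst_continuous|exact: c3].
  move=> t t01.
  have rayD : ray (y + h *: e_) t = ray y t + (t * h) *: e_.
    by apply/rowP => j; rewrite /ray !mxE; ring.
  have -> : t ^+ a * F (ray (y + h *: e_) t) - t ^+ a * F (ray y t) -
      h * (t ^+ a.+1 * 'D_e_ F (ray y t)) =
      t ^+ a * (F (ray y t + (t * h) *: e_) - F (ray y t) -
                (t * h) * 'D_e_ F (ray y t)).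
    by rewrite rayD exprS; ring.
  rewrite normrM -[C * _]mul1r; apply: ler_pM => //; first exact: expr01.
  apply: (le_trans (hC _ _ _ _)).
  - by apply: cball_convex => //; exact: ltW.
  - by rewrite -rayD; apply: cball_convex => //; exact: ltW.
  apply: ler_wpM2l => //; rewrite exprMn ler_piMl ?sqr_ge0 //.
  by case/andP: t01 => t0 t1; rewrite exprn_ile1.
by apply: DeriveDef; [apply/cvg_ex; eexists; exact: lim0 | exact/cvg_lim].
Unshelve. all: by end_near. Qed.

Lemma smooth_ray_avg a F : smooth_on W F -> smooth_on W (ray_avg a F).
Proof.
move=> sF k; elim: k a F sF => [|k IH] a F sF.
  by split=> // y; exact: ray_avg_continuous.
split=> [y|i]; first exact: ray_avg_continuous.
split=> [y Wy|]; first by have [] := ray_avg_derive a i sF Wy.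
apply: (Ck_on_ext (@oball_open R m q rho) _ (IH a.+1 _ (smooth_on_D i sF))).
by move=> y Wy; rewrite (derive_val (is_derive := ray_avg_derive a i sF Wy)).
Qed.

(** The fundamental theorem of calculus on the segment from [x] to [y]: the coefficients are
    averages of the partial derivatives along it. *)
Lemma hadamard f : smooth_on W f ->
  exists g : 'I_m -> 'rV[R]_m -> R,
  [/\ forall i, smooth_on W (g i),
      forall i, g i x = 'D_(delta_mx 0 i) f x &
      forall y, W y -> f y = f x + \sum_i (y 0 i - x 0 i) * g i y].
Proof.
move=> sf; exists (fun i => ray_avg 0 (fun z => 'D_(delta_mx 0 i) f z)); split.
- by move=> i; apply: smooth_ray_avg; exact: smooth_on_D.
- move=> i; rewrite /ray_avg /avg (@eq_Rintegral _ _ _ mu _ (fun=> 'D_(delta_mx 0 i) f x)).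
    by rewrite Rintegral_cst // mu01 mulr1.
  by move=> t _; rewrite expr0 mul1r /ray subrr scaler0 addr0.
move=> y Wy; apply/eqP; rewrite addrC -subr_eq; apply/eqP.
pose u t := f (ray y t).
pose du t := \sum_i (y 0 i - x 0 i) * (t ^+ 0 * 'D_(delta_mx 0 i) f (ray y t)).
have dui i : cont01 (fun t => t ^+ 0 * 'D_(delta_mx 0 i) f (ray y t)).
  exact: (cont01_ray (a := 0%N) (smooth_on_D i sf) Wy).
have dui2 i : cont01 (fun t => (y 0 i - x 0 i) * (t ^+ 0 * 'D_(delta_mx 0 i) f (ray y t))).
  by move=> t t01; apply: (@continuousM R R); [exact: cst_continuous|exact: dui].
have dU (t : R) : 0 <= t <= 1 -> is_derive t (1 : R) u (du t).
  move=> t01; have [d e] := C1_differentiable (@oball_open R m q rho) (sf 1%N) (ray_in Wy t01).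
  have := is_derive_line (diff_derivable (v := y - x) d).
  rewrite -/(ray _ _) deriveE // e /grad_form => h.
  apply: is_derive_eq h _; apply: eq_bigr => i _.
  by rewrite expr0 mul1r !mxE.
have cU (t : R) : 0 <= t <= 1 -> {for t, continuous u}.
  by move=> t01; apply: differentiable_continuous; apply/derivable1_diffP;
     have [] := dU t t01.
have -> : \sum_i (y 0 i - x 0 i) * ray_avg 0 (fun z => 'D_(delta_mx 0 i) f z) y = avg du.
  by rewrite /du avg_sum //; apply: eq_bigr => i _; rewrite avgZ.
have ftc := @continuous_FTC2 R du u 0 1 ltr01.
rewrite /avg /Rintegral ftc.
- by rewrite -EFinD /= /u /ray scale1r [x + _]addrC subrK scale0r addr0.
- apply: continuous_in_subspaceT => t /set_mem; rewrite /= in_itv /= => t01.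
  by apply: (@cvg_big _ _ +%R 0 xpredT add_continuous _ _ _
    (fun i t => (y 0 i - x 0 i) * (t ^+ 0 * 'D_(delta_mx 0 i) f (ray y t)))) => i _; exact: dui2.
- split.
  + by move=> t; rewrite in_itv /= => /andP[t0 t1]; have [] := dU t _; rewrite ?ltW.
  + by apply: cvg_at_right_filter; apply: cU; rewrite lexx ler01.
  + by apply: cvg_at_left_filter; apply: cU; rewrite lexx ler01.
- move=> t; rewrite in_itv /= => /andP[t0 t1].
  have t01 : 0 <= t <= 1 by rewrite !ltW.
  by rewrite derive1E (derive_val (is_derive := dU t t01)).
Qed.

End Star.
End Hadamard.

(** * Vector fields on a compact manifold *)

Section Manifolds.
Variables (R : realType) (m : nat) (M : smoothManifold R m).
Local Notation A := (Cinf M).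
Local Notation V := (vfield M).
Implicit Types (c : chart R m M) (q : 'rV[R]_m) (r : R) (f g : A) (X Y : V) (x : M).

Lemma cinf_ext f g : (forall x, f x = g x) -> f = g.
Proof. by move=> h; apply/val_inj/funext. Qed.

Lemma cinfD f g x : (f + g) x = f x + g x. Proof. by []. Qed.
Lemma cinfN f x : (- f) x = - f x. Proof. by []. Qed.
Lemma cinfB f g x : (f - g) x = f x - g x. Proof. by []. Qed.
Lemma cinfM f g x : (f * g) x = f x * g x. Proof. by []. Qed.
Lemma cinfZ (a : R) f x : (a *: f) x = a * f x. Proof. by []. Qed.
Lemma cinf0 x : (0 : A) x = 0. Proof. by []. Qed.
Lemma cinf1 x : (1 : A) x = 1. Proof. by []. Qed.

Lemma cinf_sum (I : Type) (s : seq I) (P : pred I) (F : I -> A) x :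
  (\sum_(i <- s | P i) F i) x = \sum_(i <- s | P i) F i x.
Proof. by elim/big_rec2 : _ => // i u v _ <-. Qed.

Lemma vfield_ext X Y : (forall f, X f = Y f) -> X = Y.
Proof. by move=> h; apply/val_inj/funext. Qed.

Lemma vf_derivation X : is_derivation X.
Proof. by apply/derivationP; case: X. Qed.

Lemma vfP X (a : R) f g : X (a *: f + g) = a *: (X f : A) + X g.
Proof. by have [-> _] := vf_derivation X. Qed.

Lemma vfM X f g : X (f * g) = (X f : A) * g + f * X g.
Proof. by have [_ ->] := vf_derivation X. Qed.

Lemma vfD X f g : X (f + g) = (X f : A) + X g.
Proof. by have := vfP X 1 f g; rewrite !scale1r. Qed.

Lemma vf0 X : X 0 = 0 :> A.
Proof. by apply: (addrI (X 0 : A)); rewrite -vfD !addr0. Qed.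

Lemma vfN X f : X (- f) = - (X f : A).
Proof. by apply: (addrI (X f : A)); rewrite -vfD !subrr vf0. Qed.

Lemma vfB X f g : X (f - g) = (X f : A) - X g.
Proof. by rewrite vfD vfN. Qed.

Lemma vfZ X (a : R) f : X (a *: f) = a *: (X f : A).
Proof. by have := vfP X a f 0; rewrite vf0 !addr0. Qed.

Lemma vf1 X : X 1 = 0 :> A.
Proof.
have h := vfM X 1 1; apply: (addrI (X 1 : A)); rewrite addr0.
by rewrite mulr1 mul1r mulr1 in h.
Qed.

Lemma vf_sum X (I : Type) (s : seq I) (P : pred I) (F : I -> A) :
  X (\sum_(i <- s | P i) F i) = \sum_(i <- s | P i) (X (F i) : A).
Proof.
elim: s => [|i s IH]; first by rewrite !big_nil vf0.
by rewrite !big_cons; case: (P i) => //; rewrite vfD IH.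
Qed.

Lemma vfieldD X Y f : (X + Y : V) f = (X f : A) + Y f. Proof. by []. Qed.
Lemma vfieldN X f : (- X : V) f = - (X f : A). Proof. by []. Qed.
Lemma vfieldZ (h : A) X f : (h *: X : V) f = h * (X f : A). Proof. by []. Qed.
Lemma vfield0 f : (0 : V) f = 0 :> A. Proof. by []. Qed.

Lemma vfield_sum (I : Type) (s : seq I) (P : pred I) (F : I -> V) f :
  (\sum_(i <- s | P i) F i : V) f = \sum_(i <- s | P i) (F i f : A).
Proof. by elim/big_rec2 : _ => // i u v _ <-. Qed.

Lemma vbracketE X Y f : vbracket X Y f = (X (Y f) : A) - Y (X f).
Proof. by []. Qed.

Lemma chart_codO c : open (chart_cod c). Proof. exact: chart_cod_open. Qed.

Lemma chart_preimage_open c (O : set M) : open O ->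
  open (chart_cod c `&` chart_inv c @^-1` O).
Proof.
move=> oO; rewrite openE => y [cy Oy].
have oc := @chart_codO c.
apply: (@filterI _ (nbhs y)); first exact: (open_nbhs_nbhs (conj oc cy)).
exact: (chart_inv_continuous cy (open_nbhs_nbhs (conj oO Oy))).
Qed.

Lemma chart_invK c y : chart_cod c y ->
  chart_dom c (chart_inv c y) /\ chart_map c (chart_inv c y) = y.
Proof. by case=> x dx <-; rewrite chart_mapK. Qed.

Lemma chart_overlapE c c' : chart_map c @` (chart_dom c `&` chart_dom c') =
  chart_cod c `&` chart_inv c @^-1` chart_dom c'.
Proof.
apply/seteqP; split => [_ [x [dx dx'] <-]|y [cy dy]].
  by split; [exists x|rewrite /= chart_mapK].
by have [d1 e] := chart_invK cy; exists (chart_inv c y).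
Qed.

Definition ext_chart c (F : 'rV[R]_m -> R) : M -> R :=
  fun x => if `[< chart_dom c x >] then F (chart_map c x) else 0.

Lemma ext_chartE c F x : chart_dom c x -> ext_chart c F x = F (chart_map c x).
Proof. by move=> dx; rewrite /ext_chart asboolT. Qed.

Lemma chart_image_closed c (K : set 'rV[R]_m) : compact K -> K `<=` chart_cod c ->
  closed (chart_inv c @` K).
Proof.
move=> cK sub; apply: compact_closed; first exact: manifold_hausdorff.
apply: continuous_compact => //; apply: continuous_in_subspaceT => y /set_mem Ky.
by apply: chart_inv_continuous; exact: sub.
Qed.

(** The image of [K] in the manifold is compact, hence closed by the Hausdorff property. So each
    point has a neighbourhood inside the chart, where a change of charts gives smoothness, or one
    off the image, where the function is 0. *)
Lemma ext_chart_smooth c F (K : set 'rV[R]_m) : atlas c -> compact K ->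
  K `<=` chart_cod c -> smooth_on (chart_cod c) F ->
  (forall y, chart_cod c y -> ~ K y -> F y = 0) -> ext_chart c F \in @smooth_fun R m M.
Proof.
move=> ac cK sub sF F0; apply/smooth_funP => c' ac'.
apply: smooth_on_local => y cy.
have [Kx|nKx] := pselect ((chart_inv c @` K) (chart_inv c' y)).
  have dx : chart_dom c (chart_inv c' y).
    by case: Kx => z Kz <-; exact: (chart_invK (sub _ Kz)).1.
  exists (chart_cod c' `&` chart_inv c' @^-1` chart_dom c) => //.
  have oU := @chart_preimage_open c' _ (chart_dom_open c).
  apply: (@smooth_on_ext _ _ _ oU (F \o (fun z => chart_map c (chart_inv c' z)))).
    by move=> z [_ dz] /=; rewrite ext_chartE.
  move=> k; apply: (Ck_on_comp oU (@chart_codO c) _ _ (sF k)).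
    by move=> z [_ dz]; exists (chart_inv c' z).
  by move=> j; rewrite -chart_overlapE; exact: atlas_compatible.
exists (chart_cod c' `&` chart_inv c' @^-1` (~` (chart_inv c @` K))) => //.
have oU : open (chart_cod c' `&` chart_inv c' @^-1` (~` (chart_inv c @` K))).
  by apply: chart_preimage_open; apply: closed_openC; exact: chart_image_closed.
apply: (smooth_on_ext oU _ (smooth_on_cst _ 0)) => z [_ nz].
rewrite /ext_chart; case: asboolP => // dz; rewrite F0 //.
  by exists (chart_inv c' z).
move=> Kz; apply: nz; exists (chart_map c (chart_inv c' z)) => //.
by rewrite chart_mapK.
Qed.

(** A non-smooth [F] is sent to the default 0; computations go through [to_cinfE], which asks for
    smoothness. *)
Definition to_cinf (F : M -> R) : A := insubd 0 F.

Lemma to_cinfE F : F \in @smooth_fun R m M -> to_cinf F = F :> (M -> R).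
Proof. by move=> sF; rewrite /to_cinf; have := insubdK (0 : A) sF. Qed.

Opaque to_cinf.

Definition inverse f : A := to_cinf (fun x => (f x)^-1).

Lemma inverseE f x : (forall x, f x != 0) -> inverse f x = (f x)^-1.
Proof.
move=> nz; rewrite /inverse to_cinfE //; apply/smooth_funP => c ac.
apply: smooth_onV => //; first exact: chart_cod_open.
by move: (valP f) => /smooth_funP; exact.
Qed.

Lemma cinf_mulV f : (forall x, f x != 0) -> f * inverse f = 1.
Proof. by move=> nz; apply: cinf_ext => x; rewrite cinfM inverseE // divff. Qed.

Record box := Box { bchart : chart R m M; bcenter : 'rV[R]_m; bradius : R }.

(** The bump lives within the radius r, the plateau is 1 up to r and 0 beyond 2 r, and the margin up
    to 3 r keeps both closed balls inside the chart. *)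
Definition is_box (b : box) : Prop :=
  [/\ atlas (bchart b), 0 < bradius b &
      oball (bcenter b) (3 * bradius b) `<=` chart_cod (bchart b)].

Definition box_bump (b : box) : A :=
  to_cinf (ext_chart (bchart b) (cube_bump (bcenter b) (bradius b))).

Definition box_coord (b : box) (i : 'I_m) : A :=
  to_cinf (ext_chart (bchart b) (fun y => plateau (bcenter b) (bradius b) y * y 0 i)).

Definition box_partial (b : box) (i : 'I_m) : A -> A^o := fun f =>
  to_cinf (ext_chart (bchart b) (fun y => plateau (bcenter b) (bradius b) y *
     'D_(delta_mx 0 i) (fun z => f (chart_inv (bchart b) z)) y)).

Definition box_field (b : box) (i : 'I_m) : V := insubd 0 (box_partial b i).

Lemma cball_coord q r y : 0 <= r -> cball q r y = (forall j, `|y 0 j - q 0 j| <= r).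
Proof.
move=> r0; apply/propext; rewrite /cball /= norm_row_le //; split.
  by move=> /forallP h j; have := h j; rewrite !mxE.
by move=> h; apply/forallP => j; rewrite !mxE.
Qed.

Lemma smooth_repr f c : atlas c -> smooth_on (chart_cod c) (fun y => f (chart_inv c y)).
Proof. by move: (valP f) => /smooth_funP; exact. Qed.

Section Box.
Variable b : box.
Hypothesis bb : is_box b.
Local Notation c := (bchart b).
Local Notation q := (bcenter b).
Local Notation r := (bradius b).

Lemma box_atlas : atlas c. Proof. by case: bb. Qed.
Lemma box_radius_gt0 : 0 < r. Proof. by case: bb. Qed.
Lemma box_sub s : s < 3 * r -> cball q s `<=` chart_cod c.
Proof. by case: bb => _ _ sub sr y /= ys; apply: sub; exact: le_lt_trans sr. Qed.

Let r0 := box_radius_gt0.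
Let ltr3 : r < 3 * r. Proof. by rewrite ltr_pMl // ltr1n. Qed.
Let ltr23 : 2 * r < 3 * r. Proof. by rewrite ltr_pM2r // ltr_nat. Qed.

Lemma box_bumpE x : box_bump b x = ext_chart c (cube_bump q r) x.
Proof.
rewrite /box_bump to_cinfE //.
apply: (@ext_chart_smooth c _ (cball q r)); [exact: box_atlas|exact: cball_compact| | |].
- by apply: box_sub.
- by apply: smooth_bump; exact: chart_cod_open.
- move=> y _; apply: contra_notP => /eqP /(bump_eq0 r0) h.
  by rewrite cball_coord ?(ltW r0) // => j; exact: ltW.
Qed.

Lemma plateau_smooth_ext (F : 'rV[R]_m -> R) : smooth_on (chart_cod c) F ->
  ext_chart c (fun y => plateau q r y * F y) \in @smooth_fun R m M.
Proof.
move=> sF.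
apply: (@ext_chart_smooth c _ (cball q (2 * r)));
  [exact: box_atlas|exact: cball_compact| | |].
- by apply: box_sub.
- apply: smooth_onM => //; first exact: chart_cod_open.
  by apply: smooth_plateau => //; exact: chart_cod_open.
- move=> y _ nK; have -> : plateau q r y = 0; last by rewrite mul0r.
  move: nK; apply: contra_notP => /eqP /(plateau_eq0 r0) h.
  by rewrite cball_coord ?mulr_ge0 ?(ltW r0) // => j; exact: ltW.
Qed.

Lemma box_coordE i x : box_coord b i x =
  ext_chart c (fun y => plateau q r y * y 0 i) x.
Proof.
rewrite /box_coord to_cinfE // plateau_smooth_ext //.
by apply: smooth_on_coord; exact: chart_cod_open.
Qed.

Lemma box_partialE i f x : (box_partial b i f : A) x =
  ext_chart c (fun y => plateau q r y *
     'D_(delta_mx 0 i) (fun z => f (chart_inv c z)) y) x.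
Proof.
rewrite /box_partial to_cinfE // plateau_smooth_ext //.
by apply: smooth_on_D; apply: smooth_repr; exact: box_atlas.
Qed.

Lemma box_partial_derivation i : box_partial b i \in @derivation R m M.
Proof.
have dr f y : chart_cod c y ->
    derivable (fun z => f (chart_inv c z)) y (delta_mx 0 i).
  move=> cy; apply: smooth_on_derivable cy.
  by apply: smooth_repr; exact: box_atlas.
apply/derivationP; split=> [a f g|f g]; apply: cinf_ext => x.
  rewrite cinfD.
 rewrite cinfZ.
 rewrite [LHS]box_partialE [X in _ = _ * X + _]box_partialE.
 rewrite [X in _ = _ + X]box_partialE /ext_chart; case: asboolP => [dx|_]; last first.
    by rewrite mulr0 addr0.
  have cx : chart_cod c (chart_map c x) by exists x.
  have -> : (fun z => (a *: f + g) (chart_inv c z)) =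
     a \*: (fun z => f (chart_inv c z)) + (fun z => g (chart_inv c z)) by apply/funext.
  rewrite deriveD ?deriveZ; [|exact: dr|by apply: derivableZ; exact: dr|exact: dr].
  by rewrite /GRing.scale /=; ring.
rewrite cinfD !cinfM [LHS]box_partialE [X in _ = X * _ + _]box_partialE.
rewrite [X in _ = _ + _ * X]box_partialE /ext_chart; case: asboolP => [dx|_]; last first.
  by rewrite mul0r mulr0 addr0.
have cx : chart_cod c (chart_map c x) by exists x.
have -> : (fun z => (f * g) (chart_inv c z)) =
   (fun z => f (chart_inv c z)) * (fun z => g (chart_inv c z)) by apply/funext.
rewrite deriveM; [|exact: dr|exact: dr].
rewrite chart_mapK //.
rewrite [_ *: _ + _](_ : _ = f x * 'D_(delta_mx 0 i) (fun z => g (chart_inv c z)) (chart_map c x) + g x * 'D_(delta_mx 0 i) (fun z => f (chart_inv c z)) (chart_map c x)) //.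
by ring.
Qed.

Lemma box_fieldE i f x : (box_field b i f : A) x =
  ext_chart c (fun y => plateau q r y *
     'D_(delta_mx 0 i) (fun z => f (chart_inv c z)) y) x.
Proof.
rewrite -box_partialE /box_field.
by have := insubdK (0 : V) (box_partial_derivation i) => ->.
Qed.

Definition box_core : set M :=
  [set x | chart_dom c x /\ cball q r (chart_map c x)].

Lemma plateau_core x : box_core x -> plateau q r (chart_map c x) = 1.
Proof. by case=> _; rewrite cball_coord ?(ltW r0) // => h; exact: plateau1. Qed.

Lemma box_field_core i f x : box_core x -> (box_field b i f : A) x =
  'D_(delta_mx 0 i) (fun z => f (chart_inv c z)) (chart_map c x).
Proof. by move=> cx; rewrite box_fieldE ext_chartE ?plateau_core ?mul1r //; case: cx. Qed.

Lemma box_coord_core i x : box_core x -> box_coord b i x = chart_map c x 0 i.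
Proof. by move=> cx; rewrite box_coordE ext_chartE ?plateau_core ?mul1r //; case: cx. Qed.

Lemma box_bump_ge0 x : 0 <= box_bump b x.
Proof. by rewrite box_bumpE /ext_chart; case: asboolP => // _; exact: bump_ge0. Qed.

Lemma box_bump_supp x : box_bump b x != 0 ->
  chart_dom c x /\ forall j, `|chart_map c x 0 j - q 0 j| < r.
Proof.
rewrite box_bumpE /ext_chart; case: asboolP => [dx|_]; last by rewrite eqxx.
by move=> /(bump_eq0 r0).
Qed.

Lemma box_bump_core x : box_bump b x != 0 -> box_core x.
Proof.
move=> /box_bump_supp[dx h]; split=> //.
by rewrite cball_coord ?(ltW r0) // => j; exact: ltW.
Qed.

Lemma row_dist_lt (y z : 'rV[R]_m) s : 0 < s ->
  (forall j, `|y 0 j - z 0 j| < s) -> `|y - z| < s.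
Proof.
move=> s0 h; rewrite /Num.Def.normr /= mx_normrE.
by apply/bigmax_ltP; split => // -[a j] _ /=; rewrite (ord1 a) !mxE.
Qed.

Lemma bumpM_smooth y0 s (g : 'rV[R]_m -> R) : 0 < s ->
  cball y0 s `<=` oball q (3 * r) -> smooth_on (oball q (3 * r)) g ->
  ext_chart c (fun y => cube_bump y0 s y * g y) \in @smooth_fun R m M.
Proof.
move=> s0 sub sg.
have supp y : ~ cball y0 s y -> cube_bump y0 s y = 0.
  apply: contra_notP => /eqP /(bump_eq0 s0) h.
  by rewrite cball_coord ?(ltW s0) // => j; exact: ltW.
apply: (@ext_chart_smooth c _ (cball y0 s)); [exact: box_atlas|exact: cball_compact| | |].
- by case: bb => _ _ h y /sub /h.
- apply: smooth_on_local => y cy; have [by0|nb] := pselect (cball y0 s y).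
    exists (oball q (3 * r)); first exact: sub.
    apply: smooth_onM => //; first exact: oball_open.
    by apply: smooth_bump; exact: oball_open.
  exists (~` cball y0 s) => //; have oU := closed_openC (@cball_closed R m y0 s).
  by apply: (smooth_on_ext oU _ (smooth_on_cst _ 0)) => z nz; rewrite supp // mul0r.
- by move=> y _ ny; rewrite supp // mul0r.
Qed.

(* Hadamard's lemma writes f - f(x) near x as a sum of products of two smooth
   functions the first of which vanishes at x. *)
Lemma vf_expansion X f x : box_bump b x != 0 ->
  (X f : A) x = \sum_i (X (box_coord b i) : A) x * (box_field b i f : A) x.
Proof.
move=> bx; have cx := box_bump_core bx.
have [dx hx] := box_bump_supp bx.
set y0 := chart_map c x in hx *.
have nx : `|y0 - q| < r by exact: row_dist_lt.
pose s := r - `|y0 - q|; have s0 : 0 < s by rewrite subr_gt0.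
have sub : cball y0 s `<=` cball q r.
  move=> y; rewrite /cball /= => ys.
  have -> : y - q = (y - y0) + (y0 - q) by rewrite addrA subrK.
  by apply: (le_trans (ler_normD _ _)); rewrite -lerBrDr.
have sub3 : cball q r `<=` oball q (3 * r).
  by move=> y /= yr; exact: le_lt_trans ltr3.
have sf : smooth_on (oball q (3 * r)) (fun y => f (chart_inv c y)).
  case: bb => ac _ h; apply: (smooth_onW h); exact: smooth_repr.
have y0in : oball q (3 * r) y0 by exact: lt_trans ltr3.
have [g [sg g0 fE]] := hadamard y0in sf.
have smooth1 : smooth_on (oball q (3 * r)) (fun=> 1 : R) by exact: smooth_on_cst.
have subs : cball y0 s `<=` oball q (3 * r) by move=> y /sub /sub3.
(* A derivation acts on global functions only: a bump at [x] globalises the local Hadamard factors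
   [g i]. *)
pose beta : A := to_cinf (ext_chart c (fun y => cube_bump y0 s y * 1)).
have betaE z : beta z = ext_chart c (fun y => cube_bump y0 s y * 1) z.
  by rewrite /beta to_cinfE // bumpM_smooth.
pose bg i : A := to_cinf (ext_chart c (fun y => cube_bump y0 s y * g i y)).
have bgE i z : bg i z = ext_chart c (fun y => cube_bump y0 s y * g i y) z.
  by rewrite /bg to_cinfE // bumpM_smooth.
have beta0 : beta x != 0.
  rewrite betaE ext_chartE // mulr1 gt_eqF // bump_gt0 // => j.
  by rewrite subrr normr0.
pose k i : A := box_coord b i - (y0 0 i) *: (1 : A).
have kx i : k i x = 0.
  by rewrite /k cinfB cinfZ box_coord_core // cinf1 mulr1 subrr.
(* When [X] is applied to this identity at [x], only the terms survive in which it hits a factor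
   vanishing there, [f - f x] or [k i]; dividing by [beta x] twice leaves the expansion. *)
have key : beta * beta * (f - f x *: (1 : A)) = \sum_i (beta * k i) * bg i.
  apply: cinf_ext => z; rewrite cinf_sum !cinfM cinfB cinfZ cinf1 mulr1.
  under eq_bigr do rewrite !cinfM.
  rewrite betaE; under eq_bigr do rewrite bgE.
  rewrite /ext_chart; case: asboolP => [dz|_]; last first.
    by rewrite !mul0r big1 // => i _; rewrite mulr0.
  set y := chart_map c z; rewrite mulr1.
  have [->|nz] := eqVneq (cube_bump y0 s y) 0.
    by rewrite !mul0r big1 // => i _; rewrite !mul0r.
  have ys : cball y0 s y.
    by rewrite cball_coord ?(ltW s0) // => j; apply: ltW; exact: bump_eq0 nz j.
  have cz : box_core z by split=> //; exact: sub.
  have := fE y (subs _ ys); rewrite /y chart_mapK // /y0 chart_mapK // => ->.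
  rewrite addrAC subrr add0r mulr_sumr; apply: eq_bigr => i _.
  by rewrite /k cinfB cinfZ cinf1 mulr1 box_coord_core //; ring.
have Xk i : (X (k i) : A) x = (X (box_coord b i) : A) x.
  by rewrite /k vfB vfZ vf1 scaler0 subr0.
have := congr1 (fun h : A => (X h : A) x) key.
rewrite vf_sum cinf_sum [X in X = _ -> _]/= vfM !cinfD !cinfM cinfB.
rewrite cinfZ cinf1 mulr1 subrr mulr0 add0r vfB vfZ vf1 scaler0 subr0.
under eq_bigr => i _.
  rewrite vfM cinfD !cinfM vfM cinfD !cinfM kx !mulr0 mul0r addr0 add0r Xk.
  rewrite bgE ext_chartE // -/y0 g0 -(box_field_core i f cx).
  have -> : cube_bump y0 s y0 = beta x by rewrite betaE ext_chartE // mulr1.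
  over.
move=> h; have bb0 : beta x * beta x != 0 by rewrite mulf_neq0.
apply: (mulfI bb0); rewrite h mulr_sumr; apply: eq_bigr => i _.
by ring.
Qed.

End Box.

Lemma box_around x : exists b, is_box b /\ 0 < box_bump b x.
Proof.
have [c ac dx] := atlas_cover x.
have : nbhs (chart_map c x) (chart_cod c).
  by apply: open_nbhs_nbhs; split; [exact: chart_cod_open|exists x].
move=> /nbhs_ballP[e /= e0 he].
pose b := Box c (chart_map c x) (e / 3).
have bb : is_box b.
  split=> //=; first by rewrite divr_gt0.
  move=> y /= yb; apply: he; rewrite mx_norm_ball /ball_ /= distrC.
  by move: yb; rewrite mulrC divfK.
exists b; split=> //; rewrite box_bumpE // ext_chartE //.
by apply: bump_gt0 => [|j]; rewrite ?subrr ?normr0 /= divr_gt0.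
Qed.

Lemma cinf_continuous f : continuous f.
Proof.
move=> x; have [c ac dx] := atlas_cover x.
have cx : chart_cod c (chart_map c x) by exists x.
have cf := smooth_on_continuous (smooth_repr f ac) cx.
have near_f : {near x, (fun z => f (chart_inv c (chart_map c z))) =1 f}.
  apply: filterS (open_nbhs_nbhs (conj (chart_dom_open c) dx)) => z dz.
  by rewrite chart_mapK.
apply: cvg_trans (near_eq_cvg near_f) _.
have := continuous_comp (chart_map_continuous dx) cf.
by rewrite /prop_for /continuous_at /= chart_mapK.
Qed.

Hypothesis Mcompact : compact [set: M].

(** Compactness is used in its near-covering form, along the filter of finite sequences of points
    ordered by inclusion: a sequence large enough provides every point with a positive summand. *)
Lemma positive_cover (Q : box -> Prop) (phi : box -> A) :
  (forall b, Q b -> forall x, 0 <= phi b x) ->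
  (forall x, exists b, Q b /\ 0 < phi b x) ->
  exists N (b : 'I_N -> box), (forall i, Q (b i)) /\
    forall x, 0 < (\sum_i phi (b i)) x.
Proof.
move=> phi0 around; have [B hB] := choice around.
pose P (s : seq M) (z : M) := exists2 x, x \in s & 0 < phi (B x) z.
pose F : set_system (seq M) := [set T | exists s0 : seq M,
  forall s : seq M, {subset s0 <= s} -> T s].
have FF : Filter F.
  split; first by exists [::].
    move=> T1 T2 [s1 h1] [s2 h2]; exists (s1 ++ s2) => s sub.
    by split; [apply: h1|apply: h2] => x xs; apply: sub; rewrite mem_cat xs ?orbT.
  by move=> T1 T2 sub [s1 h1]; exists s1 => s /h1 /sub.
have cov : forall x, [set: M] x -> \forall z \near x & s \near F, P s z.
  move=> x _; exists ([set z | 0 < phi (B x) z], [set s : seq M | x \in s]) => /=.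
    split; last by exists [:: x] => s; apply; rewrite mem_head.
    apply: open_nbhs_nbhs; split; last by have [] := hB x.
    apply: (@open_comp _ _ (phi (B x)) [set t | 0 < t]).
      by move=> z _; exact: cinf_continuous.
    exact: open_gt.
  by move=> [z s] /= [bz xs]; exists x.
have /(_ _ _ _ FF cov)[s hs] := (compact_near_coveringP _).1 Mcompact.
exists (size s), (fun i => B (tnth (in_tuple s) i)); split.
  by move=> i; have [] := hB (tnth (in_tuple s) i).
move=> z; have [x xs bz] := hs s (fun _ h => h) z I.
have xt : x \in in_tuple s by [].
have /tnthP[i ex] := xt; rewrite cinf_sum (bigD1 i) //= -ex.
apply: ltr_pwDl => //; apply: sumr_ge0 => j _; apply: phi0.
by have [] := hB (tnth (in_tuple s) j).
Qed.

(** On each box a field expands in coordinate fields by [vf_expansion], and the partition of unity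
    [w] is absorbed in the [e a]. The module of vector fields is thus finitely generated and
    projective. *)
Lemma dual_basis : exists (I : finType) (h : I -> A) (e : I -> V),
  forall X, X = \sum_a (X (h a) : A) *: e a.
Proof.
have [N [b [bb pos]]] := positive_cover box_bump_ge0 box_around.
have nz x : (\sum_i box_bump (b i)) x != 0 by rewrite gt_eqF.
pose w i := inverse (\sum_i box_bump (b i)) * box_bump (b i).
exists ('I_N * 'I_m)%type, (fun a => box_coord (b a.1) a.2),
  (fun a => w a.1 *: box_field (b a.1) a.2) => X.
have w1 : \sum_i w i = 1 by rewrite -mulr_sumr mulrC cinf_mulV.
apply: vfield_ext => f; apply: cinf_ext => x.
pose T (i : 'I_N) (j : 'I_m) : V :=
  (X (box_coord (b i) j) : A) *: (w i *: box_field (b i) j : V).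
have TE i j : T i j f x = (X (box_coord (b i) j) : A) x *
    (w i x * (box_field (b i) j f : A) x) by [].
rewrite vfield_sum -(pair_bigA _ (fun i j => T i j f)) -[X f in LHS](mul1r (X f : A)) -w1.
rewrite mulr_suml !cinf_sum; apply: eq_bigr => i _.
rewrite cinf_sum cinfM.
have [w0|w0] := eqVneq (w i x) 0.
  rewrite w0 mul0r big1 // => j _.
  by rewrite TE w0 mul0r mulr0.
have b0 : box_bump (b i) x != 0.
  by apply: contra_neq w0 => b0; rewrite /w cinfM b0 mulr0.
rewrite (vf_expansion (bb i) _ _ b0) mulr_sumr; apply: eq_bigr => j _.
by rewrite TE; ring.
Qed.

End Manifolds.

(** * Differential forms *)

Section Forms.
Variables (R : realType) (m : nat) (M : smoothManifold R m).
Local Notation A := (Cinf M).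
Local Notation V := (vfield M).
Local Notation cochain := (cochain M).
Implicit Types (f : A) (X Y Z : V) (s : seq V).

Definition form_pred : {pred cochain} := [pred a | `[< is_form a >]].

Lemma form_predP (a : cochain) : reflect (is_form a) (a \in form_pred).
Proof. exact: asboolP. Qed.

Fact form_submod : GRing.subsemimod_closed form_pred.
Proof.
have ZrA (c : R) (f g : A) : c *: (f * g) = f * (c *: g).
  by rewrite scaler_mulAr.
split; first split.
- apply/form_predP; split=> [s1 s2 f X Y|s1 s2 s3 X] //.
  by rewrite [LHS](_ : _ = (0 : A)) // [RHS](_ : _ = f * (0 : A) + (0 : A)) // mulr0 addr0.
- move=> a b /form_predP[al aa] /form_predP[bl ba]; apply/form_predP.
  split=> [s1 s2 f X Y|s1 s2 s3 X].
    rewrite [LHS](_ : _ = a (s1 ++ (f *: X + Y) :: s2) + b (s1 ++ (f *: X + Y) :: s2)) //.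
    by rewrite al bl addrACA -mulrDr.
  by rewrite [LHS](_ : _ = a (s1 ++ X :: s2 ++ X :: s3) + b (s1 ++ X :: s2 ++ X :: s3)) // aa ba addr0.
- move=> c a /form_predP[al aa]; apply/form_predP.
  split=> [s1 s2 f X Y|s1 s2 s3 X].
    rewrite [LHS](_ : _ = c *: a (s1 ++ (f *: X + Y) :: s2)) //.
    by rewrite al scalerDr ZrA.
  by rewrite [LHS](_ : _ = c *: a (s1 ++ X :: s2 ++ X :: s3)) // aa scaler0.
Qed.

HB.instance Definition _ :=
  GRing.isSubmodClosed.Build R cochain form_pred form_submod.

Record form := MkForm { form_val : cochain; _ : form_val \in form_pred }.

HB.instance Definition _ := [isSub for form_val].
HB.instance Definition _ := [Choice of form by <:].
HB.instance Definition _ := [SubChoice_isSubLmodule of form by <:].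

Definition form_eval (a : form) (s : seq V) : A := form_val a s.
Coercion form_eval : form >-> Funclass.

Implicit Types (a b : form).

Lemma form_ext a b : (forall s, a s = b s) -> a = b.
Proof. by move=> h; apply/val_inj/funext. Qed.

Lemma form_isP a : is_form (form_val a).
Proof. by case: a => a h; exact/form_predP. Qed.

Lemma formD a b s : (a + b) s = a s + b s. Proof. by []. Qed.
Lemma formN a s : (- a) s = - a s. Proof. by []. Qed.
Lemma formB a b s : (a - b) s = a s - b s. Proof. by []. Qed.
Lemma formZ (c : R) a s : (c *: a) s = c *: a s. Proof. by []. Qed.
Lemma form0 s : (0 : form) s = 0. Proof. by []. Qed.

Lemma form_sum (T : Type) (r : seq T) (P : pred T) (F : T -> form) s :
  (\sum_(i <- r | P i) F i) s = \sum_(i <- r | P i) F i s.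
Proof. by elim/big_rec2 : _ => // i u v _ <-. Qed.

Lemma form_lin a s1 s2 f X Y :
  a (s1 ++ (f *: X + Y) :: s2) = f * a (s1 ++ X :: s2) + a (s1 ++ Y :: s2).
Proof. by have [h _] := form_isP a; exact: h. Qed.

Lemma form_alt a s1 s2 s3 X : a (s1 ++ X :: s2 ++ X :: s3) = 0.
Proof. by have [_ h] := form_isP a; exact: h. Qed.

(* Alternation need only be checked on adjacent slots. *)
Lemma is_form_adjacent (c : cochain) :
  (forall s1 s2 f X Y,
     c (s1 ++ (f *: X + Y) :: s2) = f * c (s1 ++ X :: s2) + c (s1 ++ Y :: s2)) ->
  (forall s1 s2 X, c (s1 ++ X :: X :: s2) = 0) -> is_form c.
Proof.
move=> cl ca; split=> // s1 s2.
have cD t1 t2 X Y : c (t1 ++ (X + Y) :: t2) = c (t1 ++ X :: t2) + c (t1 ++ Y :: t2).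
  by rewrite -[X in LHS]scale1r cl mul1r.
have sw t1 t2 X Y : c (t1 ++ X :: Y :: t2) = - c (t1 ++ Y :: X :: t2).
  apply/eqP; rewrite -addr_eq0; apply/eqP.
  have := ca t1 t2 (X + Y); rewrite cD.
  have e Z : t1 ++ Z :: (X + Y) :: t2 = (t1 ++ [:: Z]) ++ (X + Y) :: t2.
    by rewrite -catA.
  by rewrite !e !cD -!catA /= !ca add0r addr0.
elim: s2 s1 => [|Y s2 IH] s1 s3 X; first exact: ca.
have := IH (s1 ++ [:: Y]) s3 X; rewrite -catA /= => h.
by rewrite sw h oppr0.
Qed.

Definition mk_form (c : cochain) (h : is_form c) : form :=
  MkForm (introT (form_predP c) h).

Fact fscale_subproof f a : is_form (fun s => f * a s : A).
Proof.
split=> [s1 s2 h X Y|s1 s2 s3 X]; last by rewrite form_alt mulr0.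
by rewrite form_lin mulrDr mulrCA.
Qed.
Definition fscale f a : form := mk_form (fscale_subproof f a).
Local Notation "f ** a" := (fscale f a) (at level 40, left associativity).

Lemma fscaleE f a s : (f ** a) s = f * a s. Proof. by []. Qed.

Lemma fscaleDr f a b : f ** (a + b) = f ** a + f ** b.
Proof. by apply: form_ext => s; rewrite formD !fscaleE formD mulrDr. Qed.

Lemma fscaleDl f f' a : (f + f') ** a = f ** a + f' ** a.
Proof. by apply: form_ext => s; rewrite formD !fscaleE mulrDl. Qed.

Lemma fscale0l a : 0 ** a = 0.
Proof. by apply: form_ext => s; rewrite fscaleE form0 mul0r. Qed.

Lemma fscale1 a : 1 ** a = a.
Proof. by apply: form_ext => s; rewrite fscaleE mul1r. Qed.

Lemma fscaleNl f a : (- f) ** a = - (f ** a).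
Proof. by apply: form_ext => s; rewrite formN !fscaleE mulNr. Qed.

Lemma fscaleNr f a : f ** (- a) = - (f ** a).
Proof. by apply: form_ext => s; rewrite formN !fscaleE formN mulrN. Qed.

Lemma fscaleA f f' a : f ** (f' ** a) = (f * f') ** a.
Proof. by apply: form_ext => s; rewrite !fscaleE mulrA. Qed.

Lemma fscale_suml (T : Type) (r : seq T) (P : pred T) (F : T -> A) a :
  (\sum_(i <- r | P i) F i) ** a = \sum_(i <- r | P i) F i ** a.
Proof.
by apply: (big_morph (fscale^~ a)) => [x y|]; rewrite ?fscaleDl ?fscale0l.
Qed.

Lemma cst_scale (c : R) a : (c *: (1 : A)) ** a = c *: a.
Proof. by apply: form_ext => s; rewrite fscaleE formZ scaler_mulAl mul1r. Qed.

Fact iota_subproof X a : is_form (fun s => a (X :: s) : A).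
Proof.
split=> [s1 s2 f Y Z|s1 s2 s3 Y]; first exact: (form_lin a (X :: s1)).
exact: (form_alt a (X :: s1)).
Qed.
Definition iota X a : form := mk_form (iota_subproof X a).

Lemma iotaE X a s : iota X a s = a (X :: s). Proof. by []. Qed.

Lemma iota_linear X : linear (iota X).
Proof. by move=> c a b; exact: form_ext. Qed.
HB.instance Definition _ X := GRing.isLinear.Build R form form *:%R (iota X) (iota_linear X).

Lemma iota_fscale X f a : iota X (f ** a) = f ** iota X a.
Proof. exact: form_ext. Qed.

Lemma iota_lin f X Y a : iota (f *: X + Y) a = f ** iota X a + iota Y a.
Proof. by apply: form_ext => s; exact: (form_lin a [::]). Qed.

Lemma iotaDl X Y a : iota (X + Y) a = iota X a + iota Y a.
Proof. by rewrite -[X in LHS]scale1r iota_lin fscale1. Qed.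

Lemma iota0l a : iota 0 a = 0.
Proof. by apply: (addrI (iota 0 a)); rewrite -iotaDl !addr0. Qed.

Lemma iotaZl f X a : iota (f *: X) a = f ** iota X a.
Proof. by have := iota_lin f X 0 a; rewrite iota0l !addr0. Qed.

Lemma iotaNl X a : iota (- X) a = - iota X a.
Proof. by apply: (addrI (iota X a)); rewrite -iotaDl !subrr iota0l. Qed.

Lemma iotaBl X Y a : iota (X - Y) a = iota X a - iota Y a.
Proof. by rewrite iotaDl iotaNl. Qed.

Lemma iotaXX X a : iota X (iota X a) = 0.
Proof. by apply: form_ext => s; exact: (form_alt a [::] [::]). Qed.

Lemma iotaC X Y a : iota X (iota Y a) = - iota Y (iota X a).
Proof.
apply/eqP; rewrite -addr_eq0; apply/eqP.
have := iotaXX (X + Y) a; rewrite !iotaDl !linearD /= !iotaXX add0r addr0.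
by rewrite addrC.
Qed.

(** A form is evaluated by contracting its arguments one after the other, so commutation with
    contractions brings [P a] down to its value on the empty list. Identities between operators
    follow by taking for [P] their difference. *)
Lemma op_ext_even (P : form -> form) : (forall a, P a [::] = 0) ->
  (forall X a, iota X (P a) = P (iota X a)) -> forall a, P a = 0.
Proof.
move=> P0 PX a; apply: form_ext => s.
elim: s a => [|X s IH] a; first by rewrite P0.
by rewrite -iotaE PX IH.
Qed.

Lemma op_ext_odd (P : form -> form) : (forall a, P a [::] = 0) ->
  (forall X a, iota X (P a) = - P (iota X a)) -> forall a, P a = 0.
Proof.
move=> P0 PX a; apply: form_ext => s.
elim: s a => [|X s IH] a; first by rewrite P0.
by rewrite -iotaE PX formN IH !form0 oppr0.
Qed.

Record oneform := OneForm { oneform_val :> V -> A;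
  oneformP : forall f X Y, oneform_val (f *: X + Y) = f * oneform_val X + oneform_val Y }.

(** The recursion is the antiderivation rule for contractions, so [iota_ext] holds by computation
    and no sum over shuffles is met. *)
Fixpoint eps_cochain (xi : V -> A) (c : cochain) s : A :=
  if s is X :: s' then xi X * c s' - eps_cochain xi (Defs.interior X c) s' else 0.

Lemma eps_cochain_lin xi f (c c' c'' : cochain) s :
  (forall s, c'' s = f * c s + c' s) ->
  eps_cochain xi c'' s = f * eps_cochain xi c s + eps_cochain xi c' s.
Proof.
elim: s c c' c'' => [|X s IH] c c' c'' h /=; first by rewrite mulr0 addr0.
rewrite h (IH (Defs.interior X c) (Defs.interior X c') (Defs.interior X c'')); last first.
  by move=> t; exact: h.
by ring.
Qed.

Lemma eps_cochain0 xi (c : cochain) s : (forall s, c s = 0) -> eps_cochain xi c s = 0.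
Proof.
elim: s c => [|X s IH] c c0 //=.
by rewrite c0 mulr0 sub0r IH ?oppr0 // => t; exact: c0.
Qed.

Fact eps_subproof (xi : oneform) a : is_form (eps_cochain xi (form_val a)).
Proof.
apply: is_form_adjacent => [s1 s2 f X Y|s1 s2 X].
  elim: s1 a => [|Z s1 IH] a /=; last first.
    have ia : Defs.interior Z (form_val a) = form_val (iota Z a) by [].
    rewrite -[form_val a]/(form_eval a) form_lin !ia IH.
    by rewrite -[form_eval a]/(form_val a); ring.
  rewrite oneformP (@eps_cochain_lin xi f (Defs.interior X (form_val a))
    (Defs.interior Y (form_val a))); last by move=> t; exact: (form_lin a [::]).
  by ring.
elim: s1 a => [|Z s1 IH] a /=.
  rewrite (@eps_cochain0 xi (Defs.interior X (Defs.interior X (form_val a)))); last first.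
    by move=> t; exact: (form_alt a [::] [::]).
  by rewrite /Defs.interior; ring.
have ia : Defs.interior Z (form_val a) = form_val (iota Z a) by [].
rewrite ia IH subr0.
have := form_alt a s1 [::] s2 X; rewrite /form_eval /= => ->.
by rewrite mulr0.
Qed.
Definition ext (xi : oneform) a : form := mk_form (eps_subproof xi a).

Lemma ext_nil xi a : ext xi a [::] = 0. Proof. by []. Qed.

Lemma iota_ext X xi a : iota X (ext xi a) = xi X ** a - ext xi (iota X a).
Proof. exact: form_ext. Qed.

Lemma ext_linear xi : linear (ext xi).
Proof.
move=> c a b; apply: form_ext => s; rewrite formD formZ.
rewrite /ext /form_eval /= (@eps_cochain_lin xi (c *: (1 : A)) (form_val a) (form_val b)).
  by rewrite scaler_mulAl mul1r.
by move=> t; rewrite scaler_mulAl mul1r.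
Qed.
HB.instance Definition _ xi := GRing.isLinear.Build R form form *:%R (ext xi) (ext_linear xi).

Lemma ext_fscale xi f a : ext xi (f ** a) = f ** ext xi a.
Proof.
apply: form_ext => s; rewrite fscaleE /ext /form_eval /=.
rewrite (@eps_cochain_lin xi f (form_val a) (fun=> 0)) //.
  by rewrite [eps_cochain xi (fun=> 0) s]eps_cochain0 // addr0.
by move=> t; rewrite addr0.
Qed.

Lemma ext_linl (xi eta zeta : oneform) f a :
  (forall X, zeta X = f * xi X + eta X) -> ext zeta a = f ** ext xi a + ext eta a.
Proof.
move=> h; apply/eqP; rewrite -subr_eq0; apply/eqP.
apply: (@op_ext_odd (fun a => ext zeta a - (f ** ext xi a + ext eta a))) => [b|X b].
  by rewrite formB formD fscaleE !ext_nil mulr0 addr0 subrr.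
rewrite !linearB linearD /= iota_fscale !iota_ext h fscaleDl fscaleDr fscaleNr fscaleA.
by apply: form_ext => s; rewrite !(formB, formN, formD, fscaleE); ring.
Qed.

Lemma extC xi eta a : ext xi (ext eta a) = - ext eta (ext xi a).
Proof.
apply/eqP; rewrite -addr_eq0; apply/eqP.
apply: (@op_ext_even (fun a => ext xi (ext eta a) + ext eta (ext xi a))) => [b|X b].
  by rewrite formD !ext_nil addr0.
rewrite !linearD /= !iota_ext !linearB /= !ext_fscale.
by apply: form_ext => s; rewrite !(formB, formN, formD, fscaleE); ring.
Qed.

Lemma extXX xi a : ext xi (ext xi a) = 0.
Proof.
apply: (@op_ext_even (fun a => ext xi (ext xi a))) => // X b.
by rewrite !iota_ext linearB /= ext_fscale opprB addrC subrK.
Qed.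

(** A Lie derivative, a covariant derivative and, with direction 0, a linear endomorphism are all of
    this kind, so [lop] extends the three to forms at once. *)
Record covd := Covd { cov_dir : V; cov_map :> V -> V;
  covP : forall f X Y, cov_map (f *: X + Y) =
    f *: (cov_map X : V) + ((cov_dir f : A) *: X : V) + (cov_map Y : V) :> V }.

Fixpoint lop_cochain (Z : V) (D : V -> V) (c : cochain) s : A :=
  if s is X :: s' then lop_cochain Z D (Defs.interior X c) s' - c (D X :: s') else Z (c [::]).

Lemma lop_cochain_lin (Z : V) (D : V -> V) f (c c' c'' : cochain) s :
  (forall s, c'' s = f * c s + c' s) -> lop_cochain Z D c'' s =
  f * lop_cochain Z D c s + (Z f : A) * c s + lop_cochain Z D c' s.
Proof.
elim: s c c' c'' => [|X s IH] c c' c'' h /=.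
  by rewrite h vfD vfM [X in X + _]addrC.
rewrite h (IH (Defs.interior X c) (Defs.interior X c') (Defs.interior X c'')); last first.
  by move=> t; exact: h.
by rewrite /Defs.interior; ring.
Qed.

Lemma lop_cochain0 (Z : V) (D : V -> V) (c : cochain) s :
  (forall s, c s = 0) -> lop_cochain Z D c s = 0.
Proof.
elim: s c => [|X s IH] c c0 /=; first by rewrite c0 vf0.
by rewrite c0 subr0 IH // => t; exact: c0.
Qed.

Lemma form_swap a s1 s2 X Y : a (s1 ++ X :: Y :: s2) = - a (s1 ++ Y :: X :: s2).
Proof.
elim: s1 a => [|Z s1 IH] a; last exact: (IH (iota Z a)).
by have := congr1 (fun b : form => b s2) (iotaC Y X a).
Qed.

Fact lop_subproof (D : covd) a : is_form (lop_cochain (cov_dir D) D (form_val a)).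
Proof.
apply: is_form_adjacent => [s1 s2 f X Y|s1 s2 X].
  elim: s1 a => [|Z s1 IH] a /=; last first.
    have ia : Defs.interior Z (form_val a) = form_val (iota Z a) by [].
    rewrite !ia IH -[form_val a]/(form_eval a) (form_lin a (D Z :: s1)) -/(form_eval a).
    by rewrite -[form_eval a]/(form_val a) /=; ring.
  rewrite (@lop_cochain_lin _ _ f (Defs.interior X (form_val a)) (Defs.interior Y (form_val a)));
    last by move=> t; exact: (form_lin a [::]).
  rewrite covP -[f *: _ + _ + _]addrA -[form_val a]/(form_eval a).
  have /= -> := form_lin a [::] s2 f (D X).
  have /= -> := form_lin a [::] s2 (cov_dir D f).
  by rewrite -[form_eval a]/(form_val a) /Defs.interior; ring.
elim: s1 a => [|Z s1 IH] a /=.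
  rewrite (@lop_cochain0 _ _ (Defs.interior X (Defs.interior X (form_val a)))); last first.
    by move=> t; exact: (form_alt a [::] [::]).
  have := form_swap a [::] s2 X (D X); rewrite /Defs.interior /form_eval /= => ->.
  by ring.
have ia : Defs.interior Z (form_val a) = form_val (iota Z a) by [].
rewrite ia IH; have := form_alt a (D Z :: s1) [::] s2 X; rewrite /form_eval /= => ->.
by rewrite subrr.
Qed.
Definition lop (D : covd) a : form := mk_form (lop_subproof D a).

Lemma lop_nil (D : covd) a : lop D a [::] = cov_dir D (a [::]). Proof. by []. Qed.

Lemma iota_lop X (D : covd) a : iota X (lop D a) = lop D (iota X a) - iota (D X) a.
Proof. exact: form_ext. Qed.

Lemma lop_fscale (D : covd) f a : lop D (f ** a) = f ** lop D a + (cov_dir D f : A) ** a.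
Proof.
apply: form_ext => s; rewrite formD !fscaleE /lop /form_eval /=.
rewrite (@lop_cochain_lin _ _ f (form_val a) (fun=> 0)); last first.
  by move=> t; rewrite addr0.
by rewrite [lop_cochain _ _ (fun=> 0) s]lop_cochain0 // addr0.
Qed.

Lemma lop_linear (D : covd) : linear (lop D).
Proof.
move=> c a b; apply: form_ext => s; rewrite formD formZ.
rewrite /lop /form_eval /= (@lop_cochain_lin _ _ (c *: (1 : A)) (form_val a) (form_val b)).
  by rewrite vfZ vf1 scaler0 mul0r addr0 scaler_mulAl mul1r.
by move=> t; rewrite scaler_mulAl mul1r.
Qed.
HB.instance Definition _ D := GRing.isLinear.Build R form form *:%R (lop D) (lop_linear D).

Lemma lop_comm (D1 D2 D3 : covd) a :
  (forall f, cov_dir D3 f = (cov_dir D1 (cov_dir D2 f) : A) - cov_dir D2 (cov_dir D1 f)) ->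
  (forall X, D3 X = D1 (D2 X) - D2 (D1 X)) ->
  lop D1 (lop D2 a) - lop D2 (lop D1 a) = lop D3 a.
Proof.
move=> hd hm; apply/eqP; rewrite -subr_eq0; apply/eqP.
apply: (@op_ext_even (fun a => lop D1 (lop D2 a) - lop D2 (lop D1 a) - lop D3 a)) => [b|X b].
  by rewrite !formB !lop_nil hd subrr.
rewrite !linearB /= !iota_lop !linearB /= ?iota_lop hm iotaBl.
apply: form_ext => s; rewrite !(formB, formN, formD).
by ring.
Qed.

Lemma lop_ext (D : covd) (xi eta : oneform) a :
  (forall X, eta X = (cov_dir D (xi X) : A) - xi (D X)) ->
  lop D (ext xi a) = ext xi (lop D a) + ext eta a.
Proof.
move=> h; apply/eqP; rewrite -subr_eq0; apply/eqP.
apply: (@op_ext_odd (fun a => lop D (ext xi a) - (ext xi (lop D a) + ext eta a))) => [b|X b].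
  by rewrite formB formD lop_nil !ext_nil vf0 addr0 subrr.
rewrite linearB linearD /= iota_lop !iota_ext linearB /= lop_fscale iota_lop !linearB /= h.
apply: form_ext => s; rewrite !(formB, formN, formD, fscaleE).
by ring.
Qed.

End Forms.

Lemma sum_tuple_cons (T : finType) (W : nmodType) n (F : n.+1.-tuple T -> W) :
  \sum_t F t = \sum_a \sum_(t : n.-tuple T) F [tuple of a :: t].
Proof.
rewrite pair_bigA /=.
rewrite (reindex (fun p : T * n.-tuple T => [tuple of p.1 :: p.2])) //=.
exists (fun t => (thead t, [tuple of behead t])) => [[a t] _|t _] /=.
  by congr (_, _); apply/val_inj.
by rewrite -tuple_eta.
Qed.

Lemma big_lift0 (W : Type) (idx : W) (op : Monoid.law idx) n (i : 'I_n) (G : nat -> W) :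
  \big[op/idx]_(k < lift ord0 i) G k = op (G 0%N) (\big[op/idx]_(k < i) G k.+1).
Proof.
by rewrite -(big_mkord xpredT G) (_ : nat_of_ord (lift ord0 i) = i.+1) //
   big_mkord big_ord_recl.
Qed.

(** A [false] put in front makes an inversion with each later [true]; a [true] in front makes
    none. *)
Lemma shuffle_inversions_cons b (t : bitseq) :
  shuffle_inversions (b :: t) = (shuffle_inversions t + ~~ b * count id t)%N.
Proof.
rewrite /shuffle_inversions /= big_ord_recl big_ord0 add0n.
rewrite [LHS](eq_bigr (fun i : 'I_(size t) => (~~ b && nth false t i : nat) +
    \sum_(k < i) (~~ nth false t k && nth false t i))%N); last first.
  move=> i _.
  exact: (big_lift0 addn i (fun k => nat_of_bool (~~ nth false (b :: t) k && nth false t i))).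
rewrite big_split /= addnC; congr (_ + _)%N.

elim: t => [|c t IH] /=; first by rewrite big_ord0 muln0.
by rewrite big_ord_recl /= IH mulnDr; case: b {IH}; case: c.
Qed.

(** * Lie derivative, exterior derivative and wedge product as operators on forms *)

Section Calculus.
Variables (R : realType) (m : nat) (M : smoothManifold R m).
Local Notation A := (Cinf M).
Local Notation V := (vfield M).
Local Notation cochain := (cochain M).
Implicit Types (f : A) (X Y Z : V) (s : seq V) (a b : form M).

Lemma vbracketZr X f Y Z :
  vbracket X (f *: Y + Z) = f *: vbracket X Y + (X f : A) *: Y + vbracket X Z.
Proof.
apply: vfield_ext => h; apply: cinf_ext => x.
rewrite [LHS](_ : _ = ((X (f * Y h + Z h) : A) - (f * Y (X h) + Z (X h))) x) //.
rewrite vfD vfM !(cinfD, cinfB, cinfM, cinfN).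
rewrite [RHS](_ : _ = f x * ((X (Y h) : A) x - (Y (X h) : A) x) +
   (X f : A) x * (Y h : A) x + ((X (Z h) : A) x - (Z (X h) : A) x)) //.
by ring.
Qed.

Definition Lie X : covd M := Covd (vbracketZr X).

Lemma vbracketC X Y : vbracket X Y = - vbracket Y X.
Proof.
apply: vfield_ext => h.
by rewrite [LHS](_ : _ = (X (Y h) : A) - Y (X h)) //
   [RHS](_ : _ = - ((Y (X h) : A) - X (Y h))) // opprB.
Qed.

Lemma jacobi X Y Z :
  vbracket (vbracket X Y) Z = vbracket X (vbracket Y Z) - vbracket Y (vbracket X Z).
Proof.
apply: vfield_ext => h.
rewrite [LHS](_ : _ = ((X (Y (Z h)) : A) - Y (X (Z h))) -
   ((Z ((X (Y h) : A) - Y (X h)) : A))) //.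
rewrite [RHS](_ : _ = ((X ((Y (Z h) : A) - Z (Y h)) : A) -
    (((Y (Z (X h)) : A) - Z (Y (X h))))) -
   ((Y ((X (Z h) : A) - Z (X h)) : A) - ((X (Z (Y h)) : A) - Z (X (Y h))))) //.
rewrite !vfB; apply: cinf_ext => x; rewrite !cinfB.
by ring.
Qed.

Lemma lop_Lie_comm X Y a :
  lop (Lie X) (lop (Lie Y) a) - lop (Lie Y) (lop (Lie X) a) = lop (Lie (vbracket X Y)) a.
Proof. by apply: lop_comm => [f|Z] //=; exact: jacobi. Qed.

Lemma set_nth_form a s i Y : (i < size s)%N ->
  a (set_nth 0 s i Y) = (-1 : R) ^+ i *: a (Y :: omit i s).
Proof.
elim: s i a => [|Z s IH] [|i] a //= lt_is.
  by rewrite expr0 scale1r /omit /= drop0.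
rewrite -[a (Z :: _)]/(iota Z a _) IH // iotaE exprS mulN1r scaleNr.
have := form_swap a [::] (omit i s) Z Y; rewrite /= => ->.
by rewrite scalerN.
Qed.

Lemma lieE X a s : lie X (form_val a) s = lop (Lie X) a s.
Proof.
elim: s a => [|Y s IH] a.
  by rewrite /lie big_ord0 subr0.
rewrite -iotaE iota_lop formB -IH /lie /= big_ord_recl /=.
rewrite opprD addrA addrAC; congr (_ - _ + _).
Qed.

Lemma dext_nil (c : cochain) : dext c [::] = 0.
Proof. by rewrite /dext !big_ord0 addr0. Qed.

(** Cartan's formula inside Koszul's: the terms that differentiate along the first argument or
    bracket with it make up the Lie derivative; in the others it stays an argument, and a shifted
    index or a transposition gives the minus sign. *)
Lemma dext_cons a X s :
  dext (form_val a) (X :: s) = lop (Lie X) a s - dext (form_val (iota X a)) s.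
Proof.
rewrite -lieE /dext /lie /= big_ord_recl /= expr0 scale1r {1}/omit /= drop0.
rewrite [X in _ + X]big_ord_recl big_ord0 add0r.
have e1 : \sum_(i < size s) (-1 : R) ^+ bump 0 i *:
      ((X :: s)`_(bump 0 i) (form_val a (omit (bump 0 i) (X :: s))) : A) =
    - \sum_(i < size s) (-1 : R) ^+ i *: (s`_i (form_val (iota X a) (omit i s)) : A).
  rewrite -sumrN; apply: eq_bigr => i _.
  by rewrite /bump leq0n add1n exprS mulN1r scaleNr.
rewrite e1 {e1}.
have e2 : \sum_(i < size s) \sum_(i0 < bump 0 i) (-1 : R) ^+ (i0 + bump 0 i) *:
      form_val a (vbracket (X :: s)`_i0 (X :: s)`_(bump 0 i)
        :: omit i0 (omit (bump 0 i) (X :: s))) =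
   - \sum_(i < size s) form_val a (set_nth 0 s i (vbracket X s`_i)) -
   \sum_(j < size s) \sum_(i < j) (-1 : R) ^+ (i + j) *:
      form_val (iota X a) (vbracket s`_i s`_j :: omit i (omit j s)).
  rewrite -!sumrN -big_split /=; apply: eq_bigr => j _.
  rewrite (big_lift0 +%R j (fun k => (-1 : R) ^+ (k + j.+1) *:
    form_val a (vbracket (X :: s)`_k s`_j :: omit k (X :: omit j s)))).
  congr (_ + _).
    rewrite add0n exprS mulN1r scaleNr.
    have := set_nth_form a (vbracket X s`_j) (ltn_ord j); rewrite /form_eval => ->.
    by rewrite {1}/omit /= drop0.
  rewrite -sumrN; apply: eq_bigr => i _.
  rewrite addSn addnS !exprS !mulN1r opprK.
  have := form_swap a [::] (omit i (omit j s)) (vbracket s`_i s`_j) X.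
  by rewrite /form_eval /= /omit /= => ->; rewrite scalerN.
rewrite e2 {e2}.
by rewrite opprD !addrA [X in X + _]addrAC.
Qed.

(** Cartan's formula and the value on the empty list determine the exterior derivative, so an
    expression through a connection can be recognised as [dext]. *)
Lemma dext_op (P : form M -> form M) : (forall a, P a [::] = 0) ->
  (forall X a, iota X (P a) = lop (Lie X) a - P (iota X a)) ->
  forall a, dext (form_val a) = form_val (P a).
Proof.
move=> P0 PX a; apply/funext => s; rewrite -[RHS]/(P a s).
elim: s a => [|X s IH] a; first by rewrite dext_nil P0.
by rewrite dext_cons IH -iotaE PX formB.
Qed.

Lemma op_lie_comm (P : form M -> form M) : (forall a, P a [::] = 0) ->
  (forall a b, P (a - b) = P a - P b) ->
  (forall X a, iota X (P a) = lop (Lie X) a - P (iota X a)) ->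
  forall X a, lop (Lie X) (P a) = P (lop (Lie X) a).
Proof.
move=> P0 PB PX X a; apply/eqP; rewrite -subr_eq0; apply/eqP.
apply: (@op_ext_odd _ _ _ (fun a => lop (Lie X) (P a) - P (lop (Lie X) a))) => [b|Y b].
  by rewrite formB lop_nil !P0 vf0 subrr.
rewrite linearB /= iota_lop !PX !iota_lop linearB PB /=.
rewrite -[lop (Lie Y) (lop (Lie X) b)](subrK (lop (Lie X) (lop (Lie Y) b))).
rewrite -[_ - lop (Lie X) (lop (Lie Y) b)]opprB lop_Lie_comm.
apply: form_ext => s; rewrite !(formB, formN, formD).
by ring.
Qed.

(** Cartan's formula used twice: contraction commutes with the square of [P], because the two Lie
    derivative terms cancel by [op_lie_comm]. *)
Lemma op_square0 (P : form M -> form M) : (forall a, P a [::] = 0) ->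
  (forall a b, P (a - b) = P a - P b) ->
  (forall X a, iota X (P a) = lop (Lie X) a - P (iota X a)) ->
  forall a, P (P a) = 0.
Proof.
move=> P0 PB PX; apply: op_ext_even => // X b.
by rewrite !PX PB opprB (op_lie_comm P0 PB PX) addrC subrK.
Qed.

Definition homogeneous (k : nat) (c : cochain) := forall s, size s != k -> c s = 0.

Lemma wedge_nil (c c' : cochain) : wedge c c' [::] = c [::] * c' [::].
Proof.
rewrite /wedge /= (bigD1 [tuple]) //= big1 ?addr0; last first.
  by move=> t /negP[]; apply/eqP; exact: tuple0.
by rewrite /shuffle_inversions big_ord0 expr0 scale1r.
Qed.

(** Since [c] has degree [k], a mask contributes only if it selects [k] arguments; leaving the head
    to the second factor then costs [k] inversions. *)
Lemma wedge_cons k (c c' : cochain) X s : homogeneous k c ->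
  wedge c c' (X :: s) = wedge (Defs.interior X c) c' s +
    (-1 : R) ^+ k *: wedge c (Defs.interior X c') s.
Proof.
move=> hc; rewrite /wedge /= sum_tuple_cons big_bool /=; congr (_ + _).
  by apply: eq_bigr => t _; rewrite shuffle_inversions_cons mul0n addn0.
rewrite scaler_sumr; apply: eq_bigr => t _ /=.
rewrite shuffle_inversions_cons mul1n.
have [e|ne] := eqVneq (size (mask t s)) k; last first.
  by rewrite hc // mul0r !scaler0.
by rewrite scalerA -exprD addnC -e size_mask ?size_tuple.
Qed.

Lemma wedge_deg0 (c c' : cochain) s : homogeneous 0 c -> wedge c c' s = c [::] * c' s.
Proof.
move=> hc; elim: s c' => [|X s IH] c'; first exact: wedge_nil.
rewrite (wedge_cons _ _ _ hc) expr0 scale1r IH.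
rewrite [wedge _ _ _](_ : _ = 0) ?add0r //.
apply: big1 => t _; rewrite /Defs.interior hc // mul0r.
by rewrite scaler0.
Qed.

Lemma wedge_deg1 (xi : oneform M) (c : cochain) a s : homogeneous 1 c ->
  (forall X, c [:: X] = xi X) -> wedge c (form_val a) s = ext xi a s.
Proof.
move=> hc cE; elim: s a => [|X s IH] a.
  by rewrite wedge_nil hc // mul0r.
rewrite (wedge_cons _ _ _ hc) expr1 scaleN1r -iotaE iota_ext formB fscaleE.
rewrite -IH wedge_deg0 /Defs.interior ?cE //.
by move=> [|Y t] // _; rewrite hc.
Qed.

End Calculus.

(** * Commutation relations *)

(* A metric with a pair of dual frames, an orthogonal skew endomorphism [stJ]
   with kernel spanned by the unit field [stT], and a metric connection for
   which both are parallel and whose torsion is [g (J X) Y] times [stT]. *)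
Record structure (R : realType) (m : nat) (M : smoothManifold R m) (n : nat) := Structure {
  stg : vfield M -> vfield M -> Cinf M;
  stgC : forall X Y, stg X Y = stg Y X;
  stg_lin : forall f X Y Z, stg (f *: X + Y) Z = f * stg X Z + stg Y Z;
  stI : finType;
  stE : stI -> vfield M;
  stF : stI -> vfield M;
  st_frame : forall X, X = \sum_a stg X (stF a) *: stE a;
  stT : vfield M;
  stTT : stg stT stT = 1;
  stJ : vfield M -> vfield M;
  stJ_lin : forall f X Y, stJ (f *: X + Y) = f *: stJ X + stJ Y;
  stJ_skew : forall X Y, stg (stJ X) Y = - stg X (stJ Y);
  stJT : stJ stT = 0;
  stJJ : forall X, stJ (stJ X) = stg stT X *: stT - X;
  st_nab : vfield M -> covd M;
  st_nab_dir : forall X, cov_dir (st_nab X) = X;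
  st_nab_lin : forall f X Y Z, st_nab (f *: X + Y) Z = f *: st_nab X Z + st_nab Y Z;
  st_nab_metric : forall X Y Z : vfield M,
    (X (stg Y Z) : Cinf M) = stg (st_nab X Y) Z + stg Y (st_nab X Z);
  st_nabT : forall X, st_nab X stT = 0;
  st_nabTE : forall X, st_nab stT X = vbracket stT X;
  st_nabJ : forall X Y, st_nab X (stJ Y) = stJ (st_nab X Y);
  st_torsion : forall X Y,
    vbracket X Y = st_nab X Y - st_nab Y X - stg (stJ X) Y *: stT;
  st_trace : \sum_a stg (stE a) (stF a) = (2 * n).+1%:R;
}.

Arguments stg {R m M n}. Arguments stE {R m M n}. Arguments stF {R m M n}.
Arguments stT {R m M n}. Arguments stJ {R m M n}. Arguments st_nab {R m M n}.

Section Operators.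
Variables (R : realType) (m : nat) (M : smoothManifold R m) (n : nat).
Variable st : structure M n.
Local Notation A := (Cinf M).
Local Notation V := (vfield M).
Local Notation form := (form M).
Local Notation g := (stg st).
Local Notation E := (stE st).
Local Notation F := (stF st).
Local Notation T := (stT st).
Local Notation J := (stJ st).
Local Notation nab := (st_nab st).
Local Notation "f ** a" := (fscale f a) (at level 40, left associativity).
Implicit Types (f : A) (X Y Z : V) (s : seq V) (a b : form).

Lemma g_linr f X Y Z : g Z (f *: X + Y) = f * g Z X + g Z Y.
Proof. by rewrite stgC stg_lin ![g _ Z]stgC. Qed.

Lemma gDl X Y Z : g (X + Y) Z = g X Z + g Y Z.
Proof. by rewrite -[X in LHS]scale1r stg_lin mul1r. Qed.
Lemma gDr X Y Z : g Z (X + Y) = g Z X + g Z Y.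
Proof. by rewrite stgC gDl ![g _ Z]stgC. Qed.
Lemma g0l Z : g 0 Z = 0.
Proof. by apply: (addrI (g 0 Z)); rewrite -gDl !addr0. Qed.
Lemma g0r Z : g Z 0 = 0. Proof. by rewrite stgC g0l. Qed.
Lemma gNl X Z : g (- X) Z = - g X Z.
Proof. by apply: (addrI (g X Z)); rewrite -gDl !subrr g0l. Qed.
Lemma gNr X Z : g Z (- X) = - g Z X.
Proof. by rewrite stgC gNl stgC. Qed.
Lemma gZl f X Z : g (f *: X) Z = f * g X Z.
Proof. by have := stg_lin st f X 0 Z; rewrite g0l !addr0. Qed.
Lemma gZr f X Z : g Z (f *: X) = f * g Z X.
Proof. by rewrite stgC gZl stgC. Qed.
Lemma g_suml (I : Type) (r : seq I) (P : pred I) (G : I -> V) Z :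
  g (\sum_(i <- r | P i) G i) Z = \sum_(i <- r | P i) g (G i) Z.
Proof. by apply: (big_morph (g^~ Z)) => [x y|]; rewrite ?gDl ?g0l. Qed.

Lemma st_frame2 X : X = \sum_a g X (E a) *: F a.
Proof.
set Y := RHS.
have gY Z : g Y Z = g X Z.
  rewrite [Z in RHS](st_frame st) (stgC st X) !g_suml; apply: eq_bigr => a _.
  by rewrite !gZl (stgC st (F a)) (stgC st (E a)) mulrC.
by rewrite (st_frame st X) (st_frame st Y); apply: eq_bigr => a _; rewrite gY.
Qed.

Section Bilinear.
Variables (W : zmodType) (sc : A -> W -> W).
Hypothesis sc1 : forall u, sc 1 u = u.

Section Linear.
Variable P : V -> W.
Hypothesis Pl : forall f X Y, P (f *: X + Y) = sc f (P X) + P Y.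

Lemma alin_sum (K : finType) (c : K -> A) (G : K -> V) :
  P (\sum_i c i *: G i) = \sum_i sc (c i) (P (G i)).
Proof.
have P0 : P 0 = 0.
  have h := Pl 1 0 0; rewrite scaler0 addr0 sc1 in h.
  by apply: (addrI (P 0)); rewrite addr0 -h.
elim: (index_enum K) => [|i r IH]; first by rewrite !big_nil.
by rewrite !big_cons Pl IH.
Qed.

Lemma frame_sum X : \sum_a sc (g X (F a)) (P (E a)) = P X.
Proof. by rewrite [in RHS](st_frame st X) alin_sum. Qed.

Lemma frame_sum2 X : \sum_a sc (g X (E a)) (P (F a)) = P X.
Proof. by rewrite [in RHS](st_frame2 X) alin_sum. Qed.

End Linear.

Variable B : V -> V -> W.
Hypothesis Bl : forall Z f X Y, B (f *: X + Y) Z = sc f (B X Z) + B Y Z.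
Hypothesis Br : forall Z f X Y, B Z (f *: X + Y) = sc f (B Z X) + B Z Y.

(** The sum of the tensors E a, F a is the inverse metric, hence symmetric. The scalar action [sc]
    is a parameter so that functions and forms are served alike. *)
Lemma frame_swap : \sum_a B (E a) (F a) = \sum_a B (F a) (E a).
Proof.
transitivity (\sum_a \sum_b sc (g (E a) (E b)) (B (F b) (F a))).
  by apply: eq_bigr => a _; rewrite (frame_sum2 (Bl (F a))).
rewrite exchange_big /=; apply: eq_bigr => b _.
rewrite -[RHS](frame_sum2 (Br (F b))); apply: eq_bigr => a _.
by rewrite stgC.
Qed.

Lemma frame_adj (D D' : V -> V) : (forall X Y, g (D X) Y = g X (D' Y)) ->
  \sum_a B (D (E a)) (F a) = \sum_a B (E a) (D' (F a)).
Proof.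
move=> adj.
transitivity (\sum_a \sum_b sc (g (D (E a)) (F b)) (B (E b) (F a))).
  by apply: eq_bigr => a _; rewrite (frame_sum (Bl (F a))).
rewrite exchange_big /=; apply: eq_bigr => b _.
rewrite -[RHS](frame_sum2 (Br (E b))); apply: eq_bigr => a _.
by rewrite adj stgC.
Qed.

(* The inverse metric [\sum_a E a (x) F a] is parallel along any metric
   derivation. *)
Lemma frame_parallel (D : covd M) :
  (forall X Y, (cov_dir D (g X Y) : A) = g (D X) Y + g X (D Y)) ->
  \sum_a B (D (E a)) (F a) + \sum_a B (E a) (D (F a)) = 0.
Proof.
move=> Dg.
have key X : \sum_a (g X (F a) *: D (E a) + g X (D (F a)) *: E a) = 0.
  have := congr1 D (st_frame st X).
  have Dsum (r : seq (stI st)) : D (\sum_(a <- r) g X (F a) *: E a) =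
     \sum_(a <- r) (g X (F a) *: D (E a) + (cov_dir D (g X (F a)) : A) *: E a).
    elim: r => [|a r IH]; last by rewrite !big_cons covP IH.
    rewrite !big_nil; apply: (addrI (D 0)).
    by have := covP D 1 0 0; rewrite !scale1r scaler0 !addr0.
  rewrite Dsum.
  under eq_bigr do rewrite Dg scalerDl addrCA.
  rewrite big_split /= -(st_frame st) => /eqP.
  by rewrite eq_sym -subr_eq0 addrAC subrr add0r => /eqP.
have BD X Y Z : B (X + Y) Z = B X Z + B Y Z by rewrite -[X in LHS]scale1r Bl sc1.
have B0 Z : B 0 Z = 0 by apply: (addrI (B 0 Z)); rewrite -BD !addr0.
rewrite -big_split /=.
transitivity (\sum_b B (\sum_a (g (E b) (F a) *: D (E a) + g (E b) (D (F a)) *: E a)) (F b)).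
  transitivity (\sum_a \sum_b (sc (g (F a) (E b)) (B (D (E a)) (F b)) +
                               sc (g (D (F a)) (E b)) (B (E a) (F b)))).
    by apply: eq_bigr => a _; rewrite big_split /= !(frame_sum2 (Br _)).
  rewrite exchange_big /=; apply: eq_bigr => b _.
  rewrite [in RHS]big_split /= BD !(alin_sum (Bl _)) -big_split /=.
  by apply: eq_bigr => a _; rewrite ![g (E b) _]stgC.
by apply: big1 => b _; rewrite key B0.
Qed.

End Bilinear.

Definition flat_subproof X f Y Z : g X (f *: Y + Z) = f * g X Y + g X Z := g_linr f Y Z X.
Definition flat X : oneform M := OneForm (flat_subproof X).
Definition eps X a := ext (flat X) a.
Lemma eps_linear X : linear (eps X). Proof. exact: ext_linear. Qed.
HB.instance Definition _ X := GRing.isLinear.Build R form form *:%R (eps X) (eps_linear X).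

Lemma eps_nil X a : eps X a [::] = 0. Proof. by []. Qed.

Lemma iota_eps X Y a : iota Y (eps X a) = g X Y ** a - eps X (iota Y a).
Proof. exact: iota_ext. Qed.

Lemma eps_linl a f X Y : eps (f *: X + Y) a = f ** eps X a + eps Y a.
Proof. by apply: ext_linl => Z; rewrite /= stg_lin. Qed.

Lemma epsDl a X Y : eps (X + Y) a = eps X a + eps Y a.
Proof. by rewrite -[X in LHS]scale1r eps_linl fscale1. Qed.

Lemma eps0l a : eps 0 a = 0.
Proof.
by apply: (addrI (eps 0 a)); rewrite -epsDl !addr0.
Qed.

Lemma epsZl a f X : eps (f *: X) a = f ** eps X a.
Proof. by rewrite -[f *: X]addr0 eps_linl eps0l addr0. Qed.

Lemma epsNl a X : eps (- X) a = - eps X a.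
Proof. by apply: (addrI (eps X a)); rewrite -epsDl !subrr eps0l. Qed.

Lemma epsC X Y a : eps X (eps Y a) = - eps Y (eps X a).
Proof. exact: extC. Qed.

Lemma epsXX X a : eps X (eps X a) = 0. Proof. exact: extXX. Qed.

Lemma eps_fscale X f a : eps X (f ** a) = f ** eps X a.
Proof. exact: ext_fscale. Qed.

Definition metric_covd (D : covd M) := forall X Y,
  (cov_dir D (g X Y) : A) = g (D X) Y + g X (D Y).

Lemma lop_eps (D : covd M) Y a : metric_covd D ->
  lop D (eps Y a) = eps Y (lop D a) + eps (D Y) a.
Proof. by move=> Dg; apply: lop_ext => Z /=; rewrite Dg addrK. Qed.

Lemma nab_metric X : metric_covd (nab X).
Proof. by move=> Y Z; rewrite st_nab_dir st_nab_metric. Qed.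

Fact J_covP f X Y : J (f *: X + Y) = f *: J X + ((0 : V) f : A) *: X + J Y.
Proof. by rewrite stJ_lin vfield0 scale0r addr0. Qed.
Definition J_cov : covd M := Covd J_covP.

Lemma J_metric : metric_covd J_cov.
Proof. by move=> X Y; rewrite vfield0 /= stJ_skew addNr. Qed.

Fact zero_covP f X Y : (0 : V) = f *: (0 : V) + ((0 : V) f : A) *: X + 0.
Proof. by rewrite scaler0 vfield0 scale0r !addr0. Qed.
Definition zero_cov : covd M := @Covd _ _ _ 0 (fun=> 0) zero_covP.

Lemma lop_zero a : lop zero_cov a = 0.
Proof.
apply: (@op_ext_even _ _ _ (lop zero_cov)) => // X b.
by rewrite iota_lop iota0l subr0.
Qed.

(** Two derivations along the same direction differ by an endomorphism, and an endomorphism acts on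
    forms by replacing one argument at a time, that is, by wedges and contractions over the dual
    frames. *)
Lemma lop_diff (D D' : covd M) (B : V -> V) a :
  (forall f, cov_dir D f = cov_dir D' f) ->
  (forall f X Y, B (f *: X + Y) = f *: B X + B Y) ->
  (forall X, D X = D' X + B X) ->
  lop D a = lop D' a - \sum_i eps (E i) (iota (B (F i)) a).
Proof.
move=> dirE Bl DE; apply/eqP; rewrite -subr_eq0; apply/eqP.
apply: (@op_ext_even _ _ _ (fun a =>
  lop D a - (lop D' a - \sum_i eps (E i) (iota (B (F i)) a)))) => [b|X b].
  rewrite !formB form_sum big1 ?subr0 => [|i _]; last exact: eps_nil.
  by rewrite !lop_nil dirE subrr.
rewrite !linearB linear_sum /= !iota_lop DE iotaDl.
under eq_bigr do rewrite iota_eps iotaC linearN /= opprK.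
rewrite big_split /=.
have -> : \sum_i g (E i) X ** iota (B (F i)) b = iota (B X) b.
  under eq_bigr do rewrite stgC.
  apply: (frame_sum2 (sc := @fscale _ _ _) _ _ (P := fun Y => iota (B Y) b)) => *.
  - exact: fscale1.
  - by rewrite Bl iota_lin.
by apply: form_ext => s; rewrite !(formB, formN, formD); ring.
Qed.

(* [lef] is the exterior product with d theta and [lam] its adjoint, [num] the
   degree, [jop] the derivation induced by J and [tder] the Lie derivative
   along the Reeb field. *)
Definition dnab a := \sum_i eps (E i) (lop (nab (F i)) a).
Definition snab a := - \sum_i iota (E i) (lop (nab (F i)) a).
Definition lef a := (2^-1 : R) *: \sum_i eps (F i) (eps (J (E i)) a).
Definition lam a := (2^-1 : R) *: \sum_i iota (J (E i)) (iota (F i) a).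
Definition num a := \sum_i eps (E i) (iota (F i) a).
Definition jop a := lop J_cov a.
Definition tder a := lop (nab T) a.

Lemma dnab_linear : linear dnab.
Proof.
move=> c a b; rewrite /dnab scaler_sumr -big_split /=.
by apply: eq_bigr => i _; rewrite !linearP.
Qed.
HB.instance Definition _ := GRing.isLinear.Build R form form *:%R dnab dnab_linear.

Lemma snab_linear : linear snab.
Proof.
move=> c a b; rewrite /snab scalerN -opprD scaler_sumr -big_split /=.
by congr (- _); apply: eq_bigr => i _; rewrite !linearP.
Qed.
HB.instance Definition _ := GRing.isLinear.Build R form form *:%R snab snab_linear.

Lemma lef_linear : linear lef.
Proof.
move=> c a b; rewrite /lef !scaler_sumr -big_split /=.
by apply: eq_bigr => i _; rewrite [eps (J _) _]linearP [eps (F _) _]linearP /= scalerDr !scalerA mulrC.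
Qed.
HB.instance Definition _ := GRing.isLinear.Build R form form *:%R lef lef_linear.

Lemma lam_linear : linear lam.
Proof.
move=> c a b; rewrite /lam !scaler_sumr -big_split /=.
by apply: eq_bigr => i _; rewrite [iota (F _) _]linearP [iota (J _) _]linearP /= scalerDr !scalerA mulrC.
Qed.
HB.instance Definition _ := GRing.isLinear.Build R form form *:%R lam lam_linear.

Lemma num_linear : linear num.
Proof.
move=> c a b; rewrite /num scaler_sumr -big_split /=.
by apply: eq_bigr => i _; rewrite !linearP.
Qed.
HB.instance Definition _ := GRing.isLinear.Build R form form *:%R num num_linear.

Lemma jop_linear : linear jop. Proof. exact: lop_linear. Qed.
HB.instance Definition _ := GRing.isLinear.Build R form form *:%R jop jop_linear.

Lemma tder_linear : linear tder. Proof. exact: lop_linear. Qed.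
HB.instance Definition _ := GRing.isLinear.Build R form form *:%R tder tder_linear.

Lemma halfK a : (2^-1 : R) *: (a + a) = a.
Proof.
have -> : a + a = (2 : R) *: a by rewrite scaler_nat mulr2n.
by rewrite scalerA mulVf ?scale1r // pnatr_eq0.
Qed.

Lemma iota_linl a f X Y : iota (f *: X + Y) a = f ** iota X a + iota Y a.
Proof. exact: iota_lin. Qed.

Lemma form_frame_sum (P : V -> form) X :
  (forall f X Y, P (f *: X + Y) = f ** P X + P Y) ->
  \sum_i g (E i) X ** P (F i) = P X.
Proof.
move=> Pl; under eq_bigr do rewrite stgC.
apply: (frame_sum2 (sc := @fscale _ _ _)) => *; [exact: fscale1|exact: Pl].
Qed.

Lemma form_frame_sum2 (P : V -> form) X :
  (forall f X Y, P (f *: X + Y) = f ** P X + P Y) ->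
  \sum_i g (F i) X ** P (E i) = P X.
Proof.
move=> Pl; under eq_bigr do rewrite stgC.
apply: (frame_sum (sc := @fscale _ _ _)) => *; [exact: fscale1|exact: Pl].
Qed.

(** Contracting dtheta with X gives g(J X, .). The two wedge factors of [lef] each contribute it, by
    skewness of [J], and the coefficient 1/2 absorbs the repetition. *)
Lemma iota_lef X a : iota X (lef a) = lef (iota X a) + eps (J X) a.
Proof.
rewrite /lef linearZ linear_sum /=.
under eq_bigr do rewrite !iota_eps linearB /= eps_fscale opprB addrCA.
rewrite !big_split /= scalerDr; congr (_ + _).
rewrite -[RHS]halfK; congr (_ *: (_ + _)).
  by apply: (form_frame_sum2 (P := fun Y => eps (J Y) a)) => f Y Z; rewrite stJ_lin eps_linl.
under eq_bigr do rewrite stJ_skew fscaleNl opprK.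
by apply: (form_frame_sum (P := fun Y => eps Y a)) => *; exact: eps_linl.
Qed.

Lemma eps_lef X a : eps X (lef a) = lef (eps X a).
Proof.
rewrite /lef linearZ linear_sum /=; congr (_ *: _); apply: eq_bigr => i _.
by rewrite epsC [eps X (eps _ a)]epsC linearN opprK.
Qed.

Lemma lef_nil a : lef a [::] = 0.
Proof. by rewrite /lef formZ form_sum big1 ?scaler0. Qed.

Lemma lop_lef (D : covd M) a : metric_covd D -> (forall X, D (J X) = J (D X)) ->
  lop D (lef a) = lef (lop D a).
Proof.
move=> Dg DJ; apply/eqP; rewrite -subr_eq0; apply/eqP.
apply: (@op_ext_even _ _ _ (fun a => lop D (lef a) - lef (lop D a))) => [b|X b].
  by rewrite formB lop_nil !lef_nil vf0 subrr.
rewrite linearB /= iota_lop !iota_lef linearD /= iota_lop linearB /= lop_eps // DJ.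
by apply: form_ext => s; rewrite !(formB, formN, formD); ring.
Qed.

Lemma nab_lef X a : lop (nab X) (lef a) = lef (lop (nab X) a).
Proof. by apply: lop_lef; [exact: nab_metric|exact: st_nabJ]. Qed.

Lemma jop_lef a : jop (lef a) = lef (jop a).
Proof. by apply: lop_lef; first exact: J_metric. Qed.

Lemma nab_jop X a : lop (nab X) (jop a) = jop (lop (nab X) a).
Proof.
apply/eqP; rewrite -subr_eq0; apply/eqP.
rewrite (@lop_comm _ _ _ (nab X) J_cov zero_cov) ?lop_zero //.
  by move=> f; rewrite st_nab_dir !vfield0 vf0 subrr.
by move=> Y /=; rewrite st_nabJ subrr.
Qed.

Lemma nabT_Lie a : tder a = lop (Lie T) a.
Proof.
rewrite /tder (@lop_diff (nab T) (Lie T) (fun=> 0)) ?big1 ?subr0 //.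
- by move=> i _; rewrite iota0l linear0.
- by move=> f; rewrite st_nab_dir.
- by move=> *; rewrite scaler0 addr0.
- by move=> X; rewrite st_nabTE addr0.
Qed.

Lemma nab_linl a f X Y :
  lop (nab (f *: X + Y)) a = f ** lop (nab X) a + lop (nab Y) a.
Proof.
apply/eqP; rewrite -subr_eq0; apply/eqP.
apply: (@op_ext_even _ _ _ (fun a =>
  lop (nab (f *: X + Y)) a - (f ** lop (nab X) a + lop (nab Y) a))) => [b|Z b].
  by rewrite formB formD fscaleE !lop_nil !st_nab_dir vfieldD vfieldZ subrr.
rewrite linearB linearD /= iota_fscale !iota_lop st_nab_lin iota_lin.
by apply: form_ext => s; rewrite !(formB, formN, formD, fscaleE); ring.
Qed.

Lemma num_iota X a : iota X (num a) = num (iota X a) + iota X a.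
Proof.
rewrite /num linear_sum /=.
under eq_bigr do rewrite iota_eps [iota X (iota _ a)]iotaC linearN opprK.
rewrite big_split /= addrC; congr (_ + _).
by apply: (form_frame_sum (P := fun Y => iota Y a)) => *; exact: iota_lin.
Qed.

Lemma num_homogeneous k a : homogeneous k (form_val a) -> num a = k%:R *: a.
Proof.
move=> ha; apply: form_ext => s.
suff -> : num a s = (size s)%:R *: a s.
  have [->|ne] := eqVneq (size s) k; first by [].
  by rewrite formZ /form_eval ha // !scaler0.
elim: s a {ha} => [|X s IH] a.
  by rewrite /num form_sum big1 ?scale0r.
by rewrite -iotaE num_iota formD IH /= -natr1 scalerDl scale1r.
Qed.

Lemma num_lam a : lam (num a) = num (lam a) + 2%:R *: lam a.
Proof.
have e X Y : iota X (iota Y (num a)) = num (iota X (iota Y a)) + 2%:R *: iota X (iota Y a).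
  by rewrite num_iota linearD /= num_iota -addrA scaler_nat mulr2n.
rewrite /lam; under eq_bigr do rewrite e.
rewrite big_split /= scalerDr [num (_ *: _)]linearZ /= [num (\sum_i _)]linear_sum.
by rewrite -scaler_sumr !scalerA mulrC.
Qed.

Lemma lam_eps X a : lam (eps X a) = eps X (lam a) + iota (J X) a.
Proof.
have -> : eps X (lam a) = (2^-1 : R) *: \sum_i eps X (iota (J (E i)) (iota (F i) a)).
  by rewrite /lam [eps X (_ *: _)]linearZ; congr (_ *: _); rewrite linear_sum.
rewrite /lam.
under eq_bigr do
  rewrite iota_eps linearB /= iota_fscale iota_eps opprB addrCA -[g X (J _)]opprK
          -stJ_skew fscaleNl opprK.
rewrite !big_split /= scalerDr; congr (_ + _).
rewrite -[RHS]halfK; congr (_ *: (_ + _)).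
  under eq_bigr do rewrite stgC.
  by apply: (form_frame_sum2 (P := fun Y => iota (J Y) a)) => *; rewrite stJ_lin iota_lin.
under eq_bigr do rewrite stgC.
by apply: (form_frame_sum (P := fun Y => iota Y a)) => *; exact: iota_lin.
Qed.

Lemma num_swap a : \sum_i eps (F i) (iota (E i) a) = num a.
Proof.
rewrite /num; apply/esym.
apply: (frame_swap (sc := @fscale _ _ _) _ (B := fun X Y => eps X (iota Y a))).
- exact: fscale1.
- by move=> *; rewrite eps_linl.
- by move=> *; rewrite iota_lin linearD /= eps_fscale.
Qed.

(** The sl2 relation, whose eigenvalue is n minus the horizontal degree: [num] counts all arguments,
    and the last term takes back the count of the Reeb direction, on which [J] vanishes. *)
Lemma lam_lef a : lam (lef a) = lef (lam a) + n%:R *: a - num a + eps T (iota T a).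
Proof.
rewrite {1}/lef [lam (_ *: _)]linearZ linear_sum /=.
have e i : lam (eps (F i) (eps (J (E i)) a)) =
    eps (F i) (eps (J (E i)) (lam a)) - eps (F i) (iota (E i) a) +
    (g (E i) T ** eps (F i) (iota T a) + g (J (E i)) (J (F i)) ** a -
     eps (J (E i)) (iota (J (F i)) a)).
  rewrite !lam_eps linearD /= stJJ iotaBl linearB /= iotaZl eps_fscale iota_eps.
  rewrite [g T (E i)]stgC.
  by apply: form_ext => s; rewrite !(formB, formN, formD); ring.
under eq_bigr do rewrite e.
rewrite !big_split /= !sumrN num_swap.
have -> : \sum_i g (E i) T ** eps (F i) (iota T a) = eps T (iota T a).
  by apply: (form_frame_sum (P := fun Y => eps Y (iota T a))) => *; exact: eps_linl.
have -> : \sum_i eps (J (E i)) (iota (J (F i)) a) = num a - eps T (iota T a).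
  rewrite (frame_adj (sc := @fscale _ _ _) _ (B := fun X Y => eps X (iota (J Y) a))
     _ _ (D := J) (D' := fun Y => - J Y)); first last.
  - by move=> X Y; rewrite stJ_skew gNr.
  - by move=> *; rewrite stJ_lin iota_lin linearD /= eps_fscale.
  - by move=> *; rewrite eps_linl.
  - exact: fscale1.
  have JN X : J (- X) = - J X.
    by apply: (addrI (J X)); rewrite subrr -[J X]scale1r -stJ_lin scale1r subrr;
       have := stJ_lin st 1 0 0; rewrite !scale1r addr0 => h;
       apply: (addrI (J 0)); rewrite -h addr0.
  under eq_bigr do rewrite JN stJJ opprB iotaBl iotaZl linearB /= eps_fscale.
  rewrite big_split /= sumrN; congr (_ - _).
  under eq_bigr do rewrite stgC.
  by apply: (form_frame_sum2 (P := fun Y => eps Y (iota T a))) => *; exact: eps_linl.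
(* The trace of the metric is 2n + 1, and [J] is an isometry off the Reeb direction, which takes
   away 1; half of 2n is the n of the relation. *)
have -> : \sum_i g (J (E i)) (J (F i)) ** a = (2 * n)%:R *: a.
  rewrite -fscale_suml.
  have -> : \sum_i g (J (E i)) (J (F i)) = (2 * n)%:R.
    have e1 i : g (J (E i)) (J (F i)) = g (E i) (F i) - g T (F i) * g (E i) T.
      by rewrite stJ_skew stJJ gDr gZr gNr opprD opprK addrC.
    under eq_bigr do rewrite e1.
    rewrite sumrB st_trace.
    have -> : \sum_i g T (F i) * g (E i) T = g T T.
      by rewrite [X in _ = g X T](st_frame st T) g_suml; apply: eq_bigr => i _; rewrite gZl.
    by rewrite stTT -natr1 addrK.
  by apply: form_ext => s; rewrite fscaleE formZ mulr_natl scaler_nat.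
rewrite natrM.
have -> : lef (lam a) = (2^-1 : R) *: \sum_i eps (F i) (eps (J (E i)) (lam a)) by [].
have -> : (2%:R * n%:R) *: a = n%:R *: a + n%:R *: a by rewrite -scalerDl mulr_natl mulr2n.
rewrite -[X in _ = _ + X - _ + _]halfK -[X in _ = _ - X + _]halfK -[X in _ = _ + X]halfK.
rewrite -!scalerDr -scalerBr -scalerDr; congr (_ *: _).
by apply: form_ext => s; rewrite !(formB, formN, formD); ring.
Qed.

(** By [jop_dnab] this is the commutator of [jop] with [dnab], the analogue of d^c. *)
Definition djop a := \sum_i eps (J (E i)) (lop (nab (F i)) a).

Lemma snab_lef a : snab (lef a) = lef (snab a) - djop a.
Proof.
rewrite /snab /djop linearN /= -opprD; congr (- _).
rewrite [lef (\sum_i _)]linear_sum -big_split /=.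
by apply: eq_bigr => i _; rewrite nab_lef iota_lef.
Qed.

Lemma jop_eps X a : jop (eps X a) = eps X (jop a) + eps (J X) a.
Proof. by apply: lop_eps; exact: J_metric. Qed.

Lemma jop_dnab a : jop (dnab a) = dnab (jop a) + djop a.
Proof.
rewrite /dnab /djop linear_sum -big_split /=; apply: eq_bigr => i _.
by rewrite jop_eps nab_jop.
Qed.

Lemma jop_djop a : jop (djop a) = djop (jop a) - dnab a + eps T (tder a).
Proof.
have -> : eps T (tder a) = \sum_i g T (E i) ** eps T (lop (nab (F i)) a).
  under eq_bigr do rewrite stgC.
  rewrite (form_frame_sum (P := fun Y => eps T (lop (nab Y) a))) // => *.
  by rewrite nab_linl linearD /= eps_fscale.
rewrite /dnab /djop linear_sum -sumrB -big_split /=; apply: eq_bigr => i _.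
rewrite jop_eps nab_jop stJJ -addrA; congr (_ + _).
by rewrite epsDl epsNl epsZl addrC.
Qed.

Lemma eps_dnab a : dnab (eps T a) = - eps T (dnab a).
Proof.
rewrite /dnab linear_sum -sumrN; apply: eq_bigr => i _ /=.
rewrite lop_eps; last exact: nab_metric.
by rewrite st_nabT eps0l addr0 epsC.
Qed.

Lemma iota_dnab a : iota T (dnab a) = tder a - dnab (iota T a).
Proof.
rewrite /dnab linear_sum /=.
under eq_bigr do rewrite iota_eps iota_lop st_nabT iota0l subr0.
rewrite sumrB; congr (_ - _).
by apply: (form_frame_sum (P := fun Y => lop (nab Y) a)) => *; exact: nab_linl.
Qed.

(** The exterior derivative written with the connection: the skew-symmetrised covariant derivative
    plus the contribution of the torsion. *)
Definition dform a := dnab a + lef (iota T a).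

Lemma dform_nil a : dform a [::] = 0.
Proof. by rewrite /dform /dnab formD form_sum lef_nil big1 ?addr0. Qed.

Lemma dformB a b : dform (a - b) = dform a - dform b.
Proof. by rewrite /dform !linearB /= opprD addrACA. Qed.

(** By the torsion formula, the Lie derivative along X and [nab X] differ by the endomorphism
    sending Y to - nab Y X - g(J X, Y) T, which [lop_diff] turns into wedges and contractions. *)
Lemma cartan X a : iota X (dform a) = lop (Lie X) a - dform (iota X a).
Proof.
have -> : lop (Lie X) a = lop (nab X) a + \sum_i eps (E i) (iota (nab (F i) X) a) +
    eps (J X) (iota T a).
  rewrite (@lop_diff (Lie X) (nab X) (fun Y => - nab Y X - g (J X) Y *: T)); last first.
  - by move=> Y /=; rewrite (st_torsion st) addrA.
  - move=> f Y Z; rewrite st_nab_lin gDr gZr scalerDl -scalerA scalerBr !scalerN !opprD.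
    by rewrite addrACA.
  - by move=> f; rewrite st_nab_dir.
  rewrite -addrA; congr (_ + _); rewrite -sumrN.
  have <- : \sum_i g (J X) (F i) ** eps (E i) (iota T a) = eps (J X) (iota T a).
    under eq_bigr do rewrite stgC.
    by apply: (form_frame_sum2 (P := fun Y => eps Y (iota T a))) => *; exact: eps_linl.
  rewrite -big_split /=; apply: eq_bigr => i _.
  by rewrite iotaBl iotaNl iotaZl linearB linearN /= eps_fscale opprB opprK addrC.
rewrite /dform linearD /= iota_lef [iota X (iota T a)]iotaC linearN.
rewrite /dnab linear_sum /=.
under eq_bigr do rewrite iota_eps iota_lop linearB /= opprB addrCA.
rewrite !big_split /= sumrN.
have -> : \sum_i g (E i) X ** lop (nab (F i)) a = lop (nab X) a.
  by apply: (form_frame_sum (P := fun Y => lop (nab Y) a)) => *; exact: nab_linl.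
by apply: form_ext => s; rewrite !(formB, formN, formD); ring.
Qed.

Lemma dext_dform a : dext (form_val a) = form_val (dform a).
Proof. exact: (dext_op dform_nil cartan). Qed.

Lemma dform_square a : dform (dform a) = 0.
Proof. exact: (op_square0 dform_nil dformB cartan). Qed.

Lemma tder_dform a : tder (dform a) = dform (tder a).
Proof. by rewrite !nabT_Lie (op_lie_comm dform_nil dformB cartan). Qed.

Lemma iota_tder a : iota T (tder a) = tder (iota T a).
Proof. by rewrite iota_lop st_nabT iota0l subr0. Qed.

Lemma eps_tder a : eps T (tder a) = tder (eps T a).
Proof. by rewrite /tder lop_eps ?st_nabT ?eps0l ?addr0 //; exact: nab_metric. Qed.

Lemma tder_lef a : tder (lef a) = lef (tder a). Proof. exact: nab_lef. Qed.

Lemma iotaT_lef a : iota T (lef a) = lef (iota T a).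
Proof. by rewrite iota_lef stJT eps0l addr0. Qed.

Lemma dnab_lef a : dnab (lef a) = lef (dnab a).
Proof.
rewrite /dnab linear_sum /=; apply: eq_bigr => i _.
by rewrite nab_lef eps_lef.
Qed.

(** No curvature is computed: the exterior derivative commutes with the Lie derivative along the
    Reeb field, and so does its torsion part. *)
Lemma tder_dnab a : tder (dnab a) = dnab (tder a).
Proof.
have := tder_dform a; rewrite /dform linearD /= tder_lef -iota_tder.
by move/addIr.
Qed.

(* [dhor] is d_b on all forms and [shor] its formal adjoint. *)

Definition dhor a := dnab a - eps T (tder a).
Definition shor a := snab a + iota T (tder a).

Lemma dhor_linear : linear dhor.
Proof.
move=> c a b; rewrite /dhor [dnab _]linearP [tder _]linearP [eps _ _]linearP /=.
by rewrite opprD addrACA -scalerBr.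
Qed.
HB.instance Definition _ := GRing.isLinear.Build R form form *:%R dhor dhor_linear.

Lemma shor_linear : linear shor.
Proof. by move=> c a b; rewrite /shor [snab _]linearP [tder _]linearP iota_linear addrACA -scalerDr. Qed.
HB.instance Definition _ := GRing.isLinear.Build R form form *:%R shor shor_linear.

Lemma iotaT_epsT a : iota T (eps T a) + eps T (iota T a) = a.
Proof. by rewrite iota_eps stTT fscale1 subrK. Qed.

Lemma dhor_iota a : dhor (iota T a) = - iota T (dhor a).
Proof.
rewrite /dhor linearB /= iota_dnab iota_eps stTT fscale1 iota_tder.
by apply: form_ext => s; rewrite !(formB, formN, formD); ring.
Qed.

Lemma dhor_eps a : dhor (eps T a) = - eps T (dhor a).
Proof. by rewrite /dhor eps_dnab -eps_tder epsXX [eps T (_ - _)]linearB /= epsXX !subr0. Qed.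

Lemma dhor_tder a : dhor (tder a) = tder (dhor a).
Proof. by rewrite /dhor linearB /= tder_dnab eps_tder. Qed.

Lemma dhor_lef a : dhor (lef a) = lef (dhor a).
Proof. by rewrite /dhor linearB /= dnab_lef tder_lef eps_lef. Qed.

(** Expand d d = 0 with d = D + theta t + L i_T. The mixed terms cancel, as D anticommutes with
    theta and i_T and commutes with L and t; there remains D D + L t (theta i_T + i_T theta), whose
    bracket is the identity. *)
Lemma dhor_square a : dhor (dhor a) = - lef (tder a).
Proof.
have dE b : dform b = dhor b + eps T (tder b) + lef (iota T b) by rewrite /dhor subrK.
have h := dform_square a; rewrite (dE (dform a)) (dE a) in h.
have := (dhor_eps (tder a), dhor_lef (iota T a), dhor_iota a, dhor_tder a).
have : forall u v, dhor (u + v) = dhor u + dhor v by exact: linearD.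
move: h; move: (dhor : form -> form) => d h dD [[[d1 d2] d3] d4].
have tD u v : tder (u + v) = tder u + tder v by exact: linearD.
have eD u v : eps T (u + v) = eps T u + eps T v by exact: linearD.
have iD u v : iota T (u + v) = iota T u + iota T v by exact: linearD.
have lD u v : lef (u + v) = lef u + lef v by exact: linearD.
rewrite !(dD, tD, eD, iD, lD) in h.
rewrite d1 d2 d3 d4 -[tder (eps T _)]eps_tder epsXX iotaT_lef iotaXX in h.
rewrite tder_lef eps_lef -iota_tder iota_eps stTT fscale1 !linear0 !linearB !linearN /= in h.
apply/eqP; rewrite -subr_eq0 opprK; apply/eqP; rewrite -[RHS]h.
by apply: form_ext => s; rewrite !(formB, formN, formD, form0); ring.
Qed.

Lemma jop_tder a : jop (tder a) = tder (jop a).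
Proof. by rewrite /tder nab_jop. Qed.

Lemma jop_epsT a : jop (eps T a) = eps T (jop a).
Proof. by rewrite jop_eps stJT eps0l addr0. Qed.

Lemma dhor_jop a : dhor (jop a) - jop (dhor a) = - djop a.
Proof.
rewrite /dhor linearB /= jop_dnab jop_epsT jop_tder.
by apply: form_ext => s; rewrite !(formB, formN, formD); ring.
Qed.

(** Both sides are minus [djop]: on the left, contracting [lef] with [E i] produces the wedge with
    [J (E i)]; on the right, [jop] acts on the factor [E i] of [dnab]. *)
Lemma shor_lef a : shor (lef a) - lef (shor a) = dhor (jop a) - jop (dhor a).
Proof.
rewrite dhor_jop /shor linearD /= snab_lef tder_lef iotaT_lef.
by apply: form_ext => s; rewrite !(formB, formN, formD); ring.
Qed.

(** The relation J J = - 1 off the Reeb direction, carried to commutators; the Reeb term of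
    [jop_djop] is the one by which [dhor] differs from [dnab]. *)
Lemma dhor_jop2 a : (dhor (jop (jop a)) - jop (dhor (jop a))) -
  jop (dhor (jop a) - jop (dhor a)) = - dhor a.
Proof.
rewrite !dhor_jop linearN /= jop_djop /dhor.
by apply: form_ext => s; rewrite !(formB, formN, formD); ring.
Qed.

End Operators.

(** * The pointwise inner product of forms *)

Section Dot.
Variables (R : realType) (m : nat) (M : smoothManifold R m) (n : nat).
Variable st : structure M n.
Local Notation A := (Cinf M).
Local Notation V := (vfield M).
Local Notation form := (form M).
Local Notation g := (stg st).
Local Notation E := (stE st).
Local Notation F := (stF st).
Local Notation T := (stT st).
Local Notation J := (stJ st).
Local Notation nab := (st_nab st).
Local Notation "f ** a" := (fscale f a) (at level 40, left associativity).
Implicit Types (f : A) (X Y Z W : V) (s : seq V) (a b : form).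

(** Full contraction of [k] arguments by the inverse metric. Ordered tuples are all counted, whence
    the division by k! in [fdot]. *)
Fixpoint dotk k a b : A :=
  if k is k'.+1 then \sum_i dotk k' (iota (E i) a) (iota (F i) b)
  else a [::] * b [::].

Lemma dotk0 a b : dotk 0 a b = a [::] * b [::]. Proof. by []. Qed.
Lemma dotkS k a b : dotk k.+1 a b = \sum_i dotk k (iota (E i) a) (iota (F i) b).
Proof. by []. Qed.

Lemma dotk_linl k f a a' b : dotk k (f ** a + a') b = f * dotk k a b + dotk k a' b.
Proof.
elim: k a a' b => [|k IH] a a' b; first by rewrite !dotk0 formD fscaleE mulrDl mulrA.
rewrite !dotkS mulr_sumr -big_split /=; apply: eq_bigr => i _.
by rewrite linearD /= iota_fscale IH.
Qed.

Lemma dotk_linr k f a b b' : dotk k a (f ** b + b') = f * dotk k a b + dotk k a b'.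
Proof.
elim: k a b b' => [|k IH] a b b'.
  by rewrite !dotk0 formD fscaleE mulrDr mulrCA.
rewrite !dotkS mulr_sumr -big_split /=; apply: eq_bigr => i _.
by rewrite linearD /= iota_fscale IH.
Qed.

Lemma dotkC k a b : dotk k a b = dotk k b a.
Proof.
elim: k a b => [|k IH] a b /=; first by rewrite mulrC.
under eq_bigr do rewrite IH.
apply/esym; apply: (frame_swap (sc := *%R) _ _ (B := fun X Y => dotk k (iota X b) (iota Y a))).
- exact: mul1r.
- by move=> *; rewrite iota_lin dotk_linl.
- by move=> *; rewrite iota_lin dotk_linr.
Qed.

Lemma dotkDl k a a' b : dotk k (a + a') b = dotk k a b + dotk k a' b.
Proof. by rewrite -[a in LHS]fscale1 dotk_linl mul1r. Qed.

Lemma dotk0l k b : dotk k 0 b = 0.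
Proof. by apply: (addrI (dotk k 0 b)); rewrite -dotkDl !addr0. Qed.

Lemma dotk_fscalel k f a b : dotk k (f ** a) b = f * dotk k a b.
Proof. by rewrite -[f ** a]addr0 dotk_linl dotk0l addr0. Qed.

Lemma dotkNl k a b : dotk k (- a) b = - dotk k a b.
Proof. by apply: (addrI (dotk k a b)); rewrite -dotkDl !subrr dotk0l. Qed.

Lemma dotkDr k a b b' : dotk k a (b + b') = dotk k a b + dotk k a b'.
Proof. by rewrite dotkC dotkDl ![dotk k _ a]dotkC. Qed.

Lemma dotkNr k a b : dotk k a (- b) = - dotk k a b.
Proof. by rewrite dotkC dotkNl dotkC. Qed.

Lemma dotk_zero k a b : (forall s, size s = k -> b s = 0) -> dotk k a b = 0.
Proof.
elim: k a b => [|k IH] a b b0 /=; first by rewrite b0 ?mulr0.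
by apply: big1 => i _; apply: IH => s sk; rewrite iotaE b0 //= sk.
Qed.

Lemma scalar_frame_sum (P : V -> A) X :
  (forall f X Y, P (f *: X + Y) = f * P X + P Y) ->
  \sum_i g X (E i) * P (F i) = P X.
Proof.
by move=> Pl; exact: (frame_sum2 st (@mul1r A) Pl).
Qed.

(** By alternation, each of the [k.+1] slots in which the wedged factor can stand gives the same
    contraction. *)
Lemma dotk_eps k X a b : dotk k.+1 (eps st X a) b = dotk k a (iota X b) *+ k.+1.
Proof.
elim: k a b => [|k IH] a b.
  rewrite /= mulr1n.
  transitivity (\sum_i g X (E i) * (a [::] * b [:: F i])).
    by apply: eq_bigr => i _; rewrite subr0 mulrA.
  apply: (scalar_frame_sum (P := fun Y => a [::] * b [:: Y])) => f Y Z.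
  by rewrite (form_lin b [::] [::]) mulrDr mulrCA.
rewrite [LHS]dotkS.
transitivity (\sum_i (g X (E i) * dotk k.+1 a (iota (F i) b) +
                      dotk k (iota (E i) a) (iota (F i) (iota X b)) *+ k.+1)).
  apply: eq_bigr => i _.
  rewrite iota_eps dotkDl dotk_fscalel dotkNl IH [iota X (iota _ b)]iotaC dotkNr mulNrn opprK.
  by [].
rewrite big_split /= -sumrMnl (scalar_frame_sum (P := fun Y => dotk k.+1 a (iota Y b))).
  by rewrite !sumrMnl [RHS]mulrS.
by move=> *; rewrite iota_lin dotk_linr.
Qed.

Lemma dotk_lop (D : covd M) k a b : metric_covd st D ->
  (cov_dir D (dotk k a b) : A) = dotk k (lop D a) b + dotk k a (lop D b).
Proof.
move=> Dg; elim: k a b => [|k IH] a b.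
  by rewrite /= vfM.
rewrite [dotk k.+1 a b]/= [RHS]/= vf_sum -big_split /=.
have e X Y : (cov_dir D (dotk k (iota X a) (iota Y b)) : A) =
   (dotk k (iota X (lop D a)) (iota Y b) + dotk k (iota X a) (iota Y (lop D b))) +
   (dotk k (iota (D X) a) (iota Y b) + dotk k (iota X a) (iota (D Y) b)).
  by rewrite IH !iota_lop !(dotkDl, dotkDr, dotkNl, dotkNr); ring.
under eq_bigr do rewrite e.
rewrite big_split /= [X in _ + X]big_split /=.
rewrite (frame_parallel (sc := *%R) _ _ (B := fun X Y => dotk k (iota X a) (iota Y b))).
- by rewrite addr0.
- exact: mul1r.
- by move=> *; rewrite iota_lin dotk_linl.
- by move=> *; rewrite iota_lin dotk_linr.
- exact: Dg.
Qed.

Definition fdot a b : A := \sum_(k < m.+1) ((k`!)%:R^-1 : R) *: dotk k a b.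

Lemma fdotC a b : fdot a b = fdot b a.
Proof. by apply: eq_bigr => k _; rewrite dotkC. Qed.

Lemma fdot_linl f a a' b : fdot (f ** a + a') b = f * fdot a b + fdot a' b.
Proof.
rewrite /fdot mulr_sumr -big_split /=; apply: eq_bigr => k _.
by rewrite dotk_linl scalerDr scaler_mulAr.
Qed.

Lemma fdot_linr f a b b' : fdot a (f ** b + b') = f * fdot a b + fdot a b'.
Proof. by rewrite fdotC fdot_linl ![fdot _ a]fdotC. Qed.

Lemma fdotDl a a' b : fdot (a + a') b = fdot a b + fdot a' b.
Proof. by rewrite -[a in LHS]fscale1 fdot_linl mul1r. Qed.

Lemma fdot0l b : fdot 0 b = 0.
Proof. by apply: (addrI (fdot 0 b)); rewrite -fdotDl !addr0. Qed.

Lemma fdotNl a b : fdot (- a) b = - fdot a b.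
Proof. by apply: (addrI (fdot a b)); rewrite -fdotDl !subrr fdot0l. Qed.

Lemma fdotZl (c : R) a b : fdot (c *: a) b = c *: fdot a b.
Proof.
rewrite -cst_scale -[_ ** a]addr0 fdot_linl fdot0l addr0.
by rewrite scaler_mulAl mul1r.
Qed.

Lemma fdotDr a b b' : fdot a (b + b') = fdot a b + fdot a b'.
Proof. by rewrite fdotC fdotDl ![fdot _ a]fdotC. Qed.
Lemma fdotNr a b : fdot a (- b) = - fdot a b.
Proof. by rewrite fdotC fdotNl fdotC. Qed.
Lemma fdotZr (c : R) a b : fdot a (c *: b) = c *: fdot a b.
Proof. by rewrite fdotC fdotZl fdotC. Qed.

Lemma fdot_suml (I : Type) (r : seq I) (P : pred I) (G : I -> form) b :
  fdot (\sum_(i <- r | P i) G i) b = \sum_(i <- r | P i) fdot (G i) b.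
Proof. by apply: (big_morph (fdot^~ b)) => [x y|]; rewrite ?fdotDl ?fdot0l. Qed.

Lemma fdot_sumr (I : Type) (r : seq I) (P : pred I) (G : I -> form) a :
  fdot a (\sum_(i <- r | P i) G i) = \sum_(i <- r | P i) fdot a (G i).
Proof. by rewrite fdotC fdot_suml; apply: eq_bigr => i _; rewrite fdotC. Qed.

Lemma fdot_lop (D : covd M) a b : metric_covd st D ->
  (cov_dir D (fdot a b) : A) = fdot (lop D a) b + fdot a (lop D b).
Proof.
move=> Dg; rewrite /fdot vf_sum -big_split /=; apply: eq_bigr => k _.
by rewrite vfZ dotk_lop // scalerDr.
Qed.

Hypothesis form_top : forall a s, (m < size s)%N -> a s = 0.

(** The factor [k.+1] of [dotk_eps] turns 1/(k+1)! into 1/k!. Two terms are left over: degree 0,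
    where a wedge has no value on the empty list, and degree [m], where [b] would have [m.+1]
    arguments. *)
Lemma fdot_eps X a b : fdot (eps st X a) b = fdot a (iota X b).
Proof.
rewrite /fdot big_ord_recl [RHS]big_ord_recr [RHS]/= [X in X + _ = _]/=.
rewrite (@dotk_zero m) => [|s sm]; last by rewrite iotaE form_top //= sm.
rewrite mul0r !scaler0 add0r addr0.
apply: eq_bigr => k _; rewrite [nat_of_ord (lift ord0 k)]lift0 dotk_eps.
rewrite -scalerMnr scalerMnl -mulr_natr factS natrM invfM mulrAC mulVf ?mul1r // pnatr_eq0.
Qed.

Lemma fdot_iota X a b : fdot (iota X a) b = fdot a (eps st X b).
Proof. by rewrite fdotC -fdot_eps fdotC. Qed.

Lemma fdot_lef a b : fdot (lef st a) b = fdot a (lam st b).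
Proof.
rewrite /lef /lam fdotZl fdotZr fdot_suml fdot_sumr; congr (_ *: _).
by apply: eq_bigr => i _; rewrite !fdot_eps.
Qed.

Lemma fdot_num a b : fdot (num st a) b = fdot a (num st b).
Proof.
rewrite -[in RHS]num_swap /num fdot_suml fdot_sumr.
by apply: eq_bigr => i _; rewrite fdot_eps fdot_iota.
Qed.

Lemma fdot_jop a b : fdot (jop st a) b = - fdot a (jop st b).
Proof.
apply/eqP; rewrite -addr_eq0; apply/eqP.
by rewrite -(fdot_lop _ _ (@J_metric _ _ _ _ st)) vfield0.
Qed.

(** The trace is taken with the connection at hand; its torsion is traceless, so this is the
    Riemannian divergence, as [div_local_frame] makes explicit. *)
Definition div W : A := \sum_i g (nab (F i) W) (E i).

Lemma nab_cov X f Y Z : nab X (f *: Y + Z) = f *: nab X Y + (X f : A) *: Y + nab X Z.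
Proof. by rewrite covP st_nab_dir. Qed.

Lemma nabD X Y Z : nab X (Y + Z) = nab X Y + nab X Z.
Proof. by rewrite -[Y in LHS]scale1r nab_cov vf1 scale0r addr0 scale1r. Qed.

Lemma nab0 X : nab X 0 = 0.
Proof. by apply: (addrI (nab X 0)); rewrite -nabD !addr0. Qed.

Lemma divD W W' : div (W + W') = div W + div W'.
Proof. by rewrite /div -big_split /=; apply: eq_bigr => i _; rewrite nabD gDl. Qed.

Lemma div0 : div 0 = 0.
Proof. by apply: (addrI (div 0)); rewrite -divD !addr0. Qed.

Lemma divN W : div (- W) = - div W.
Proof. by apply: (addrI (div W)); rewrite -divD !subrr div0. Qed.

Lemma div_sum (I : Type) (r : seq I) (P : pred I) (G : I -> V) :
  div (\sum_(i <- r | P i) G i) = \sum_(i <- r | P i) div (G i).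
Proof. by apply: (big_morph div) => [x y|]; rewrite ?divD ?div0. Qed.

Lemma divZ f W : div (f *: W) = f * div W + W f.
Proof.
rewrite /div mulr_sumr.
transitivity (\sum_i (f * g (nab (F i) W) (E i) + g W (E i) * (F i f : A))).
  apply: eq_bigr => i _.
  by rewrite -[f *: W]addr0 nab_cov nab0 addr0 gDl !gZl [X in _ + X]mulrC.
rewrite big_split /=; congr (_ + _).
exact: (scalar_frame_sum (P := fun Y => Y f : A)).
Qed.

Lemma fdot_tder a b : fdot (tder st a) b + fdot a (tder st b) = div (fdot a b *: T).
Proof.
rewrite -(fdot_lop _ _ (@nab_metric _ _ _ _ st T)) divZ st_nab_dir.
by rewrite /div big1 ?mulr0 ?add0r // => i _; rewrite st_nabT g0l.
Qed.

(** [W] is the field metrically dual to the linear form sending X to <a, i_X b>; the product rule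
    for a metric connection leaves exactly its divergence. *)
Lemma fdot_dnab a b : exists W, fdot (dnab st a) b = fdot a (snab st b) + div W.
Proof.
pose w X := fdot a (iota X b).
have wl f X Y : w (f *: X + Y) = f * w X + w Y by rewrite /w iota_lin fdot_linr.
exists (\sum_i w (E i) *: F i); set W := \sum_i _.
have gW X : g W X = w X.
  rewrite /W g_suml -[RHS](frame_sum st (sc := *%R) (@mul1r A) wl).
  by apply: eq_bigr => i _; rewrite gZl mulrC stgC.
rewrite /dnab /snab fdot_suml fdotNr fdot_sumr -sumrN /div -big_split /=.
apply: eq_bigr => i _; rewrite fdot_eps.
have := fdot_lop a (iota (E i) b) (@nab_metric _ _ _ _ st (F i)).
rewrite st_nab_dir -[fdot a (iota (E i) b)]/(w (E i)) -gW st_nab_metric gW.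
have -> : lop (nab (F i)) (iota (E i) b) = iota (E i) (lop (nab (F i)) b) + iota (nab (F i) (E i)) b.
  by rewrite iota_lop subrK.
rewrite fdotDr -[fdot a (iota (nab _ _) b)]/(w _) addrA => /addIr.
by move=> ->; rewrite addrC addrK.
Qed.

Lemma fdot_dhor a b : exists W, fdot (dhor st a) b = fdot a (shor st b) + div W.
Proof.
have [W hW] := fdot_dnab a b.
exists (W - fdot a (iota T b) *: T); rewrite divD divN -fdot_tder.
rewrite /dhor /shor fdotDl fdotNl hW fdot_eps fdotDr -iota_tder.
by ring.
Qed.

End Dot.

Lemma nonuniq_split (T : eqType) (s : seq T) : ~~ uniq s ->
  exists a s1 s2 s3, s = s1 ++ a :: s2 ++ a :: s3.
Proof.
elim: s => [|x s IH] //=; case: (boolP (x \in s)) => [/splitPr[p1 p2] _|_ /IH].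
  by exists x, [::], p1, p2.
by move=> [a [s1 [s2 [s3 ->]]]]; exists a, (x :: s1), s2, s3.
Qed.

(** * Values at a point, global dual frames and pointwise orthonormal frames *)

Section Points.
Variables (R : realType) (m : nat) (M : smoothManifold R m).
Local Notation A := (Cinf M).
Local Notation V := (vfield M).
Implicit Types (f : A) (X Y Z : V) (x : M).
Hypothesis Mcompact : compact [set: M].

Lemma cinf_prod (I : Type) (r : seq I) (P : pred I) (F : I -> A) x :
  (\prod_(i <- r | P i) F i) x = \prod_(i <- r | P i) F i x.
Proof.
elim: r => [|i r IH]; first by rewrite !big_nil cinf1.
by rewrite !big_cons; case: (P i) => //; rewrite cinfM IH.
Qed.

Lemma cinf_sign (b : bool) x : ((-1 : A) ^+ b) x = (-1 : R) ^+ b.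
Proof. by case: b; rewrite (expr0, expr1) ?[LHS]cinfN cinf1. Qed.

Lemma cinf_det N (H : 'M[A]_N) x : (\det H) x = \det (map_mx (fun f : A => f x) H).
Proof.
rewrite /determinant cinf_sum; apply: eq_bigr => s _.
rewrite [LHS]cinfM; congr (_ * _); first exact: cinf_sign.
by rewrite cinf_prod; apply: eq_bigr => i _; rewrite mxE.
Qed.

Definition alinear (P : V -> A) := forall f X Y, P (f *: X + Y) = f * P X + P Y.

Lemma alinear_sum (P : V -> A) (K : finType) (c : K -> A) (G : K -> V) :
  alinear P -> P (\sum_i c i *: G i) = \sum_i c i * P (G i).
Proof. by move=> Pl; exact: (alin_sum (@mul1r A) Pl). Qed.

Lemma alinear0 (P : V -> A) : alinear P -> P 0 = 0.
Proof.
move=> Pl; have h := Pl 1 0 0; rewrite scaler0 addr0 mul1r in h.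
by apply: (addrI (P 0)); rewrite addr0 -h.
Qed.

Lemma alinearZ (P : V -> A) f X : alinear P -> P (f *: X) = f * P X.
Proof. by move=> Pl; rewrite -[f *: X]addr0 Pl alinear0 // addr0. Qed.

(** In an expansion over the finite dual basis the argument enters only through the numbers X (h a)
    at [x]. *)
Lemma tensorial (P : V -> A) X Y x : alinear P ->
  (forall f, (X f : A) x = (Y f : A) x) -> P X x = P Y x.
Proof.
move=> Pl XY; have [I [h [e he]]] := dual_basis Mcompact.
rewrite (he X) (he Y) !alinear_sum // !cinf_sum; apply: eq_bigr => a _.
by rewrite !cinfM XY.
Qed.

Section LocalBasis.
Variables (b : box M) (x : M).
Hypotheses (bb : is_box b) (bx : box_bump b x != 0).
Local Notation E := (box_field b).
Local Notation h := (box_coord b).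

Lemma local_expansion (P : V -> A) X : alinear P ->
  P X x = \sum_i (X (h i) : A) x * P (E i) x.
Proof.
move=> Pl; rewrite (@tensorial P X (\sum_i (X (h i) : A) *: E i : V)) //.
  by rewrite alinear_sum // cinf_sum.
by move=> f; rewrite vfield_sum cinf_sum; exact: vf_expansion.
Qed.

Lemma box_field_coord i j : (E i (h j) : A) x = (i == j)%:R.
Proof.
have r0 : 0 < bradius b := box_radius_gt0 bb.
rewrite box_field_core //; last exact: box_bump_core.
have [dx hx] := box_bump_supp bb bx.
have cx : oball (bcenter b) (bradius b) (chart_map (bchart b) x).
  exact: row_dist_lt.
have near y : oball (bcenter b) (bradius b) y -> h j (chart_inv (bchart b) y) = y 0 j.
  move=> hy; have cy : cball (bcenter b) (bradius b) y by exact: ltW.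
  have [] := chart_invK (box_sub bb _ cy); first by rewrite ltr_pMl // ltr1n.
  by move=> dy ey; rewrite box_coord_core // ?ey //; split; rewrite ?ey.
rewrite (eq_derivable _ (@oball_open _ _ _ _) cx near).2.
have [_ ->] := is_derive_coord (chart_map (bchart b) x) (delta_mx 0 i) j.
by rewrite !mxE eqxx /= eq_sym.
Qed.

End LocalBasis.

(** At [x] every argument expands in the [m] coordinate fields of a box; among more than [m] of them
    one repeats, and alternation applies. *)
Lemma form_top (a : form M) s : (m < size s)%N -> a s = 0.
Proof.
move=> ms; apply: cinf_ext => x.
have [b [bb /lt0r_neq0 bx]] := box_around x.
suff key : forall s (t : seq 'I_m), (m < size t + size s)%N ->
    a (map (box_field b) t ++ s) x = 0 by exact: (key s [::]).
elim=> [|X s' IH] t st.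
  have /nonuniq_split[i [t1 [t2 [t3 ->]]]] : ~~ uniq t.
    apply/negP => /card_uniqP ct; have := max_card (mem t).
    by rewrite ct card_ord leqNgt; rewrite addn0 in st; rewrite st.
  by rewrite !(map_cat, map_cons) -catA cats0 form_alt.
pose P X := a (map (box_field b) t ++ X :: s').
have Pl : alinear P by move=> f Y Z; rewrite /P form_lin.
rewrite -[a _]/(P X) (local_expansion bb bx) // big1 // => i _.
rewrite [P _ _](_ : _ = 0) ?mulr0 // /P -cat_rcons -map_rcons.
by apply: IH; rewrite size_rcons addSnnS.
Qed.

Section Metric.
Variable g : V -> V -> A.
Hypothesis gC : forall X Y, g X Y = g Y X.
Hypothesis gl : forall f X Y Z, g (f *: X + Y) Z = f * g X Z + g Y Z.
Hypothesis gpos : forall X x, (exists f, (X f : A) x != 0) -> 0 < g X X x.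

Lemma metric_alinearl Z : alinear (g^~ Z). Proof. by move=> f X Y; exact: gl. Qed.
Lemma metric_alinearr Z : alinear (g Z).
Proof. by move=> f X Y; rewrite gC gl ![g _ Z]gC. Qed.

Lemma metric_ge0 X x : 0 <= g X X x.
Proof.
have [/gpos/ltW//|nX] := pselect (exists f, (X f : A) x != 0).
rewrite (@tensorial (g X) X 0) ?alinear0 //; try exact: metric_alinearr.
move=> f; apply/eqP/negPn/negP => Xf; apply: nX; exists f.
by move: Xf; rewrite vfield0 cinf0.
Qed.

(** The [e i] generate without being independent, so their Gram matrix [G] may be singular. [P] is
    the idempotent of the generating family; adding the square of the complementary part makes [H]
    invertible while [P *m H = G], and [G *m K = P] says that g(X, F a) is the coefficient X (h
    a). *)
Lemma dual_frame : exists (I : finType) (E F : I -> V), forall X, X = \sum_a g X (F a) *: E a.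
Proof.
have [I [h0 [e0 he0]]] := dual_basis Mcompact.
set N := #|I|.
pose h (i : 'I_N) := h0 (enum_val i); pose e (i : 'I_N) := e0 (enum_val i).
have he X : X = \sum_i (X (h i) : A) *: e i.
  rewrite [LHS]he0 (reindex (@enum_val I predT)) //.
  exact: onW_bij (@enum_val_bij I).
pose G : 'M[A]_N := \matrix_(i, j) g (e i) (e j).
pose P : 'M[A]_N := \matrix_(i, j) (e i (h j) : A).
have PG : P *m G = G.
  apply/matrixP => i k; rewrite !mxE [in RHS](he (e i)).
  rewrite (alinear_sum _ _ (metric_alinearl _)).
  by apply: eq_bigr => j _; rewrite !mxE.
have PP : P *m P = P.
  apply/matrixP => i k; rewrite !mxE [RHS](congr1 (fun X : V => X (h k) : A) (he (e i))) vfield_sum.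
  by apply: eq_bigr => j _; rewrite !mxE.
pose Q := 1%:M - P.
pose H := G + Q *m Q^T.
have PH : P *m H = G.
  rewrite mulmxDr PG mulmxA /Q mulmxBr mulmx1 PP subrr mul0mx addr0 //.
(* A kernel vector v at [x] gives g(X, X) + |v Q|^2 = 0 for X the sum of the v i e i. So v Q = 0,
   while the vanishing of X at [x] gives v P = 0, that is v Q = v. *)
have detH x : (\det H) x != 0.
  pose ev (f : A) : R := f x.
  rewrite cinf_det -/ev.
  apply/det0P => -[v vn0 vH].
  pose X : V := \sum_i (v 0 i *: (1 : A)) *: e i.
  have Xf f : (X f : A) x = \sum_i v 0 i * (e i f : A) x.
    rewrite vfield_sum cinf_sum; apply: eq_bigr => i _.
    by rewrite vfieldZ cinfM cinfZ cinf1 mulr1.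
  pose Qx := map_mx ev Q.
  have HE : map_mx ev H = map_mx ev G + Qx *m Qx^T.
    apply/matrixP => i j; rewrite [LHS]mxE [H i j]mxE [RHS]mxE /ev cinfD [X in _ = X + _]mxE; congr (_ + _).
    rewrite [in LHS]mxE cinf_sum mxE; apply: eq_bigr => k _.
    by rewrite cinfM [Qx i k]mxE [Qx^T k j]mxE [Qx j k]mxE [Q^T k j]mxE.
  have e1 : v *m map_mx ev G *m v^T + (v *m Qx) *m (v *m Qx)^T = 0.
    by rewrite trmx_mul !mulmxA -mulmxDl -mulmxA -mulmxDr -HE vH mul0mx.
  have gX : (v *m map_mx ev G *m v^T) 0 0 = g X X x.
    rewrite /X (alinear_sum _ _ (metric_alinearr _)) cinf_sum mxE; apply: eq_bigr => j _.
    rewrite (alinear_sum _ _ (metric_alinearl _)) mxE [v^T _ _]mxE mulrC cinfM cinfZ cinf1 mulr1.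
    congr (_ * _); rewrite cinf_sum; apply: eq_bigr => i _.
    by rewrite cinfM cinfZ cinf1 mulr1 !mxE.
  have gQ : ((v *m Qx) *m (v *m Qx)^T) 0 0 = \sum_j (v *m Qx) 0 j ^+ 2.
    by rewrite mxE; apply: eq_bigr => j _; rewrite [_^T _ _]mxE expr2.
  have /matrixP/(_ 0 0) := e1; rewrite [LHS]mxE [RHS]mxE gX gQ => /eqP.
  have sq0 : 0 <= \sum_j (v *m Qx) 0 j ^+ 2 by apply: sumr_ge0 => j _; exact: sqr_ge0.
  rewrite paddr_eq0 ?metric_ge0 // => /andP[/eqP gX0 vQ0].
  have X0 f : (X f : A) x = 0.
    apply/eqP/negPn/negP => nX; have := gpos (ex_intro _ f nX).
    by rewrite gX0 ltxx.
  have vQ : v *m Qx = v.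
    apply/rowP => j; rewrite mxE.
    transitivity (v 0 j - (X (h j) : A) x); last by rewrite X0 subr0.
    rewrite Xf -sumrN (bigD1 j) //= [in RHS](bigD1 j) //= addrA.
    have QE i k : Qx i k = (i == k)%:R - (e i (h k) : A) x.
      have QA : Q i k = (i == k)%:R - (e i (h k) : A) by rewrite !mxE.
      by rewrite mxE QA /ev cinfB; case: (i == k); rewrite (mulr1n, mulr0n).
    rewrite QE eqxx mulrBr mulr1; congr (_ + _).
    by apply: eq_bigr => i ij; rewrite QE (negbTE ij) sub0r mulrN.
  move: vQ0; rewrite vQ psumr_eq0 => [/allP v0|j _]; last exact: sqr_ge0.
  case/negP: vn0; apply/eqP/rowP => j; have := v0 j (mem_index_enum _).
  by rewrite sqrf_eq0 mxE => /eqP.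
pose K := inverse (\det H) *: \adj H.
have HK : H *m K = 1%:M.
  by rewrite /K -scalemxAr mul_mx_adj scale_scalar_mx mulrC cinf_mulV.
have GK : G *m K = P by rewrite -PH -mulmxA HK mulmx1.
exists 'I_N, e, (fun a => \sum_b K b a *: e b) => X.
have gF a : g X (\sum_b K b a *: e b) = X (h a).
  rewrite (alinear_sum _ _ (metric_alinearr _)) [X in g X](he X).
  transitivity (\sum_i (X (h i) : A) * (G *m K) i a).
    under eq_bigr do rewrite (alinear_sum _ _ (metric_alinearl _)) mulr_sumr.
    rewrite exchange_big; apply: eq_bigr => i _; rewrite mxE mulr_sumr.
    by apply: eq_bigr => b _; rewrite !mxE; ring.
  rewrite GK [RHS](congr1 (fun X : V => X (h a) : A) (he X)) vfield_sum; apply: eq_bigr => i _.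
  by rewrite mxE.
by rewrite [LHS]he; apply: eq_bigr => a _; rewrite gF.
Qed.

Section AtPoint.
Variable x : M.

Definition orthonormal (K : finType) (o : K -> V) := forall i j, g (o i) (o j) x = (i == j)%:R.

Lemma cst_field (c : R) X f y : (((c *: (1 : A)) *: X : V) f : A) y = c * (X f : A) y.
Proof. by rewrite vfieldZ cinfM cinfZ cinf1 mulr1. Qed.

Lemma metric_cstl (c : R) X Y y : g ((c *: (1 : A)) *: X) Y y = c * g X Y y.
Proof. by rewrite (alinearZ _ _ (metric_alinearl Y)) cinfM cinfZ cinf1 mulr1. Qed.

(** Orthogonality to [k < m] fields puts [k] linear conditions on [m] constant coefficients; a
    nonzero solution gives a field that is nonzero at [x] and can be normalised. *)
Lemma orthonormal_exists : exists o : 'I_m -> V, orthonormal o.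
Proof.
have [b [bb /lt0r_neq0 bx]] := box_around x.
suff : forall k, (k <= m)%N -> exists o : 'I_k -> V, orthonormal o by apply.
elim=> [|k IH] km; first by exists (fun=> 0) => -[].
have [ o ho] := IH (ltnW km).
pose B : 'M[R]_(m, k) := \matrix_(i, j) g (box_field b i) (o j) x.
have /rowV0Pn[c /sub_kermxP cB c0] : kermx B != 0.
  by rewrite kermx_eq0 /row_free neq_ltn (leq_ltn_trans (rank_leq_col B)).
pose Z : V := \sum_i (c 0 i *: (1 : A)) *: box_field b i.
have gZ Y : g Z Y x = \sum_i c 0 i * g (box_field b i) Y x.
  rewrite (alinear_sum _ _ (metric_alinearl Y)) cinf_sum; apply: eq_bigr => i _.
  by rewrite cinfM cinfZ cinf1 mulr1.
have gZo j : g Z (o j) x = 0.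
  have /rowP/(_ j) := cB; rewrite gZ !mxE => e; rewrite -[RHS]e.
  by apply: eq_bigr => i _; rewrite mxE.
have Z0 : 0 < g Z Z x.
  apply: gpos; move/rV0Pn: c0 => [j cj]; exists (box_coord b j).
  have -> : (Z (box_coord b j) : A) x = \sum_i c 0 i * (box_field b i (box_coord b j) : A) x.
    by rewrite vfield_sum cinf_sum; apply: eq_bigr => i _; rewrite cst_field.
  rewrite (bigD1 j) //= big1 => [|i ij]; rewrite box_field_coord //.
    by rewrite eqxx mulr1 addr0.
  by rewrite (negbTE ij) mulr0.
pose u : V := ((Num.sqrt (g Z Z x))^-1 *: (1 : A)) *: Z.
have gu Y : g u Y x = (Num.sqrt (g Z Z x))^-1 * g Z Y x by exact: metric_cstl.
have guu : g u u x = 1.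
  rewrite gu gC gu mulrA -invfM -expr2 sqr_sqrtr ?ltW // mulVf //.
  by rewrite gt_eqF.
exists (fun i => if unlift ord_max i is Some j then o j else u) => i j.
case: (unliftP ord_max i) => [i' ->|->]; case: (unliftP ord_max j) => [j' ->|->].
- by rewrite ho (inj_eq lift_inj).
- by rewrite gC gu gZo mulr0 eq_sym (negbTE (neq_lift _ _)).
- by rewrite gu gZo mulr0 (negbTE (neq_lift _ _)).
- by rewrite guu eqxx.
Qed.

(** Orthonormality reads [B *m C = 1%:M] in the coordinates of a box; the matrices being square,
    [C *m B = 1%:M] follows, which is completeness. *)
Lemma parseval (o : 'I_m -> V) (P : V -> A) X : orthonormal o -> alinear P ->
  P X x = \sum_i g X (o i) x * P (o i) x.
Proof.
move=> ho Pl; have [b [bb /lt0r_neq0 bx]] := box_around x.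
pose E := box_field b; pose h := box_coord b.
pose B : 'M[R]_m := \matrix_(i, j) (o i (h j) : A) x.
pose C : 'M[R]_m := \matrix_(i, j) g (E i) (o j) x.
have BC : B *m C = 1%:M.
  apply/matrixP => i j; rewrite !mxE -ho (local_expansion bb bx _ (metric_alinearl (o j))).
  by apply: eq_bigr => k _; rewrite !mxE.
have CB := mulmx1C BC.
rewrite (local_expansion bb bx X Pl).
under [RHS]eq_bigr do rewrite (local_expansion bb bx X (metric_alinearl _)) mulr_suml.
rewrite exchange_big /=; apply: eq_bigr => k _.
under [RHS]eq_bigr do rewrite -mulrA.
rewrite -mulr_sumr; congr (_ * _).
under [RHS]eq_bigr do rewrite (local_expansion bb bx (o _) Pl) mulr_sumr.
rewrite exchange_big /= (bigD1 k) //= [X in _ = _ + X]big1 => [|l lk].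
  have /matrixP/(_ k k) := CB; rewrite !mxE eqxx addr0 => e.
  rewrite -[LHS]mul1r -[1]e mulr_suml; apply: eq_bigr => i _.
  by rewrite !mxE mulrA.
have /matrixP/(_ k l) := CB; rewrite !mxE eq_sym (negbTE lk) => e.
rewrite -[RHS](mul0r (P (E l) x)) -[X in X * _]e mulr_suml; apply: eq_bigr => i _.
by rewrite !mxE mulrA.
Qed.

Variables (I : finType) (E F : I -> V).
Hypothesis frame : forall X, X = \sum_a g X (F a) *: E a.

Lemma frame_flip Z : Z = \sum_a g Z (E a) *: F a.
Proof.
set Y := RHS.
have gY W : g Y W = g Z W.
  rewrite [in RHS](frame W) [in RHS]gC !(alinear_sum _ _ (metric_alinearl _)).
  by apply: eq_bigr => a _; rewrite (gC (F a)) (gC (E a)) mulrC.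
by rewrite (frame Z) (frame Y); apply: eq_bigr => a _; rewrite gY.
Qed.

Lemma trace_orthonormal (o : 'I_m -> V) (B : V -> V -> A) : orthonormal o ->
  (forall Z, alinear (B^~ Z)) -> (forall Z, alinear (B Z)) ->
  (\sum_a B (E a) (F a)) x = \sum_i B (o i) (o i) x.
Proof.
move=> ho Bl Br; rewrite cinf_sum.
under eq_bigr do rewrite (parseval _ ho (Bl _)).
rewrite exchange_big; apply: eq_bigr => i _ /=.
rewrite [X in _ = B _ X x]frame_flip (alinear_sum _ _ (Br _)) cinf_sum.
by apply: eq_bigr => a _; rewrite cinfM gC.
Qed.

End AtPoint.
End Metric.
End Points.

(** * The Tanaka-Webster connection *)

Section TanakaWebster.
Variables (R : realType) (m : nat) (M : smoothManifold R m).
Local Notation A := (Cinf M).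
Local Notation V := (vfield M).
Implicit Types (f : A) (X Y Z : V).

Lemma vbracketZl X f Y Z :
  vbracket (f *: Y + Z) X = f *: vbracket Y X - (X f : A) *: Y + vbracket Z X.
Proof.
rewrite vbracketC vbracketZr !opprD -scalerN -!vbracketC; congr (_ + _).
Qed.

Variables (theta : V -> A) (om g : V -> V -> A) (J : V -> V) (T : V).
Hypothesis metricC : forall X Y, g X Y = g Y X.
Hypothesis metric_lin : forall f X Y Z, g (f *: X + Y) Z = f * g X Z + g Y Z.
Hypothesis metric_nondeg : forall X Y, (forall Z, g X Z = g Y Z) -> X = Y.
Hypothesis theta_lin : alinear theta.
Hypothesis omE : forall X Y, om X Y = (X (theta Y) : A) - Y (theta X) - theta (vbracket X Y).
Hypothesis omC : forall X Y, om X Y = - om Y X.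
Hypothesis om_linl : forall Z, alinear (om^~ Z).
Hypothesis om_closed : forall X Y Z, (X (om Y Z) : A) + Y (om Z X) + Z (om X Y) =
  om (vbracket X Y) Z + om (vbracket Y Z) X + om (vbracket Z X) Y.
Hypothesis omTl : forall X, om T X = 0.
Hypothesis thetaT : theta T = 1.
Hypothesis acs_lin : forall f X Y, J (f *: X + Y) = f *: J X + J Y.
Hypothesis acsT : J T = 0.
Hypothesis acs_acs : forall X, J (J X) = theta X *: T - X.
Hypothesis theta_acs : forall X, theta (J X) = 0.
Hypothesis metric_acs : forall X Y, g (J X) Y = om X Y.
Hypothesis metricT : forall X, g T X = theta X.
Hypothesis metric_reeb : forall X Y,
  (T (g X Y) : A) = g (vbracket T X) Y + g X (vbracket T Y).
Hypothesis reeb_acs : forall X, vbracket T (J X) = J (vbracket T X).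
Hypothesis nijenhuis : forall X Y, theta X = 0 -> theta Y = 0 ->
  J (vbracket X Y - vbracket (J X) (J Y)) = vbracket X (J Y) + vbracket (J X) Y.

Let om_linr Z : alinear (om Z).
Proof. by move=> f X Y; rewrite omC om_linl ![om _ Z]omC; ring. Qed.
Let omDl X Y Z : om (X + Y) Z = om X Z + om Y Z.
Proof. by rewrite -[X in LHS]scale1r om_linl mul1r. Qed.
Let omZl f X Z : om (f *: X) Z = f * om X Z. Proof. exact: (alinearZ _ _ (om_linl Z)). Qed.
Let omNl X Z : om (- X) Z = - om X Z. Proof. by rewrite -scaleN1r omZl mulN1r. Qed.
Let omTr X : om X T = 0. Proof. by rewrite omC omTl oppr0. Qed.
Let metric_acs_skew X Y : g (J X) Y = - g X (J Y).
Proof. by rewrite (metricC X) !metric_acs -omC. Qed.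
Lemma metric_acs_r X Y : g X (J Y) = - g (J X) Y.
Proof. by rewrite metric_acs_skew opprK. Qed.
Let acsD X Y : J (X + Y) = J X + J Y.
Proof. by rewrite -[X in LHS]scale1r acs_lin scale1r. Qed.
Let acs0 : J 0 = 0. Proof. by apply: (addrI (J 0)); rewrite -acsD !addr0. Qed.
Let acsN X : J (- X) = - J X.
Proof. by apply: (addrI (J X)); rewrite -acsD !subrr acs0. Qed.
Let acsZ f X : J (f *: X) = f *: J X.
Proof. by rewrite -[f *: X]addr0 acs_lin acs0 addr0. Qed.

Lemma metricDl X Y Z : g (X + Y) Z = g X Z + g Y Z.
Proof. by rewrite -[X in LHS]scale1r metric_lin mul1r. Qed.
Lemma metric0l Z : g 0 Z = 0.
Proof. by apply: (addrI (g 0 Z)); rewrite -metricDl !addr0. Qed.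
Lemma metricNl X Z : g (- X) Z = - g X Z.
Proof. by apply: (addrI (g X Z)); rewrite -metricDl !subrr metric0l. Qed.
Lemma metricZl f X Z : g (f *: X) Z = f * g X Z.
Proof. by rewrite -[f *: X]addr0 metric_lin metric0l addr0. Qed.
Variable hf : A.
Hypothesis hf2 : hf + hf = 1.

(** For identities that hold only because [hf] is one half: [w] is the cofactor of [hf + hf - 1],
    after which [ring] concludes. *)
Lemma by_half (u v w : A) : u - v = (hf + hf - 1) * w -> u = v.
Proof. by rewrite hf2 subrr mul0r => /subr0_eq. Qed.

Lemma two_eq0 (u : A) : u + u = 0 -> u = 0.
Proof.
move=> h; rewrite -[u]mul1r -hf2; have -> : (hf + hf) * u = hf * (u + u) by ring.
by rewrite h mulr0.
Qed.

(** Koszul's expression for twice the Levi-Civita derivative paired with Z. *)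
Definition koszul X Y Z : A := (X (g Y Z) : A) + Y (g X Z) - Z (g X Y) +
  g (vbracket X Y) Z - g (vbracket X Z) Y - g (vbracket Y Z) X.

Lemma koszul_lin X Y : alinear (koszul X Y).
Proof.
move=> f Z Z'; rewrite /koszul !vbracketZr ![g _ (f *: Z + Z')]metricC !metric_lin !metricDl.
rewrite !metricZl !vfD !vfM vfieldD vfieldZ ![g Z _]metricC ![g Z' _]metricC.
by ring.
Qed.

Variable tw : V -> V -> V.
Hypothesis metric_tw : forall X Y Z, g (tw X Y) Z = hf * (koszul X Y Z - theta X * om Y Z -
  theta Y * om X Z + om X Y * theta Z).

Lemma tw_covP X f Y Z : tw X (f *: Y + Z) = f *: tw X Y + (X f : A) *: Y + tw X Z.
Proof.
apply: metric_nondeg => W; rewrite !metricDl !metricZl !metric_tw.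
apply: (@by_half _ _ ((X f : A) * g Y W)).
rewrite /koszul !vbracketZr !vbracketZl !theta_lin !om_linl !om_linr !metricDl !metricNl !metricZl.
rewrite ![g _ (f *: Y + Z)]metricC !metric_lin !vfD !vfM vfieldD vfieldZ.
by rewrite ![g Y _]metricC ![g Z _]metricC; ring.
Qed.

Lemma tw_lin f X Y Z : tw (f *: X + Y) Z = f *: tw X Z + tw Y Z.
Proof.
apply: metric_nondeg => W; rewrite !metricDl !metricZl !metric_tw.
rewrite /koszul !vbracketZl !theta_lin !om_linl !metricDl !metricNl !metricZl.
rewrite ![g _ (f *: X + Y)]metricC !metric_lin !vfD !vfM !vfieldD !vfieldZ.
by rewrite ![g X _]metricC ![g Y _]metricC; ring.
Qed.

(** The correction terms, taken together, are skew in [Y] and [Z], so metric compatibility is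
    inherited from Koszul's formula. *)
Lemma tw_metric X Y Z : (X (g Y Z) : A) = g (tw X Y) Z + g Y (tw X Z).
Proof.
rewrite [g Y (tw X Z)]metricC !metric_tw; apply: (@by_half _ _ (- (X (g Y Z) : A))).
rewrite /koszul (vbracketC Z Y) metricNl (omC Z Y) (metricC Z Y); ring.
Qed.

(** The corrections with a factor [theta X] or [theta Y] are jointly symmetric in [X] and [Y]; only
    [om X Y * theta Z] is skew, and it becomes the torsion. *)
Lemma tw_torsion X Y : vbracket X Y = tw X Y - tw Y X - om X Y *: T.
Proof.
apply: metric_nondeg => Z; rewrite !metricDl !metricNl !metricZl !metric_tw metricT.
apply: (@by_half _ _ (- (g (vbracket X Y) Z + om X Y * theta Z))).
by rewrite /koszul (vbracketC Y X) metricNl (omC Y X) (metricC Y X); ring.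
Qed.

(** For [Y = T] Koszul's expression reduces to [om X Z] because the Reeb field is Killing, and the
    correction term cancels it. *)
Lemma twT X : tw X T = 0.
Proof.
apply: metric_nondeg => Z; rewrite metric_tw metric0l /koszul omTl omTr thetaT.
rewrite ![g _ T]metricC !metricT metric_reeb (vbracketC X T) metricNl (metricC X (vbracket T Z)).
by rewrite omE; ring.
Qed.

Lemma tw_reeb X : tw T X = vbracket T X.
Proof. by rewrite tw_torsion twT omTl scale0r !subr0. Qed.

Lemma tw_theta X Y : theta (tw X Y) = X (theta Y).
Proof.
by have := tw_metric X T Y; rewrite twT metric0l add0r !metricT.
Qed.

Lemma twD X Y Z : tw X (Y + Z) = tw X Y + tw X Z.
Proof. by rewrite -[Y in LHS]scale1r tw_covP vf1 scale0r addr0 scale1r. Qed.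
Lemma tw0 X : tw X 0 = 0. Proof. by apply: (addrI (tw X 0)); rewrite -twD !addr0. Qed.
Lemma twN X Y : tw X (- Y) = - tw X Y.
Proof. by apply: (addrI (tw X Y)); rewrite -twD !subrr tw0. Qed.

(** The covariant derivative of [J] along [X], applied to [Y] and paired with [Z]. *)
Let Psi X Y Z := g (tw X (J Y)) Z - g (J (tw X Y)) Z.

Let Psi_lin1 Y Z : alinear (fun X => Psi X Y Z).
Proof.
by move=> f X X'; rewrite /Psi !tw_lin acs_lin !metric_lin; ring.
Qed.
Let Psi_lin2 X Z : alinear (fun Y => Psi X Y Z).
Proof.
move=> f Y Y'; rewrite /Psi acs_lin !tw_covP !acsD !acsZ !metricDl !metricZl.
by ring.
Qed.
Let Psi_lin3 X Y : alinear (Psi X Y).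
Proof.
by move=> f Z Z'; rewrite /Psi ![g _ (f *: Z + Z')]metricC !metric_lin ![g Z _]metricC ![g Z' _]metricC; ring.
Qed.

Let Psi_skew X Y Z : Psi X Y Z = - Psi X Z Y.
Proof.
have e : X (g (J Y) Z + g Y (J Z)) = 0 :> A by rewrite metric_acs_skew addNr vf0.
rewrite vfD !tw_metric in e.
rewrite /Psi !metric_acs_skew.
apply/eqP; rewrite -subr_eq0 -[X in _ == X]e; apply/eqP.
by rewrite [g (J Y) (tw X Z)]metricC [g Y (tw X (J Z))]metricC; ring.
Qed.

Let Psi_acs X Y Z : theta Y = 0 -> Psi X (J Y) Z = Psi X Y (J Z).
Proof.
move=> hY; rewrite /Psi acs_acs hY scale0r sub0r twN metricNl.
rewrite ![g _ (J Z)]metric_acs_r acs_acs tw_theta hY vf0 scale0r sub0r metricNl.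
by ring.
Qed.

Let PsiE X Y Z : Psi X Y Z = (X (om Y Z) : A) + om (tw X Z) Y - om (tw X Y) Z.
Proof.
by rewrite /Psi -(metric_acs Y) tw_metric !metric_acs (omC (tw X Z)); ring.
Qed.

(** Closedness of [om]: replacing brackets by covariant derivatives costs only torsion terms along
    [T], which [om] kills. *)
Let Psi_cyclic X Y Z : Psi X Y Z + Psi Y Z X + Psi Z X Y = 0.
Proof.
have om_br U W Q : om (vbracket U W) Q = om (tw U W) Q - om (tw W U) Q.
  by rewrite [in LHS]tw_torsion !omDl !omNl omZl omTl; ring.
have := om_closed X Y Z; rewrite !om_br !PsiE => h.
move/eqP: h; rewrite -subr_eq0 => /eqP h.
by rewrite -[RHS]h; ring.
Qed.

Let Psi_nijenhuis X Y Z : theta X = 0 -> theta Y = 0 -> theta Z = 0 ->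
  Psi X Y Z - Psi Y X Z - Psi (J X) Y (J Z) + Psi (J Y) X (J Z) = 0.
Proof.
move=> hX hY hZ.
have e := nijenhuis hX hY.
have := congr1 (fun W => g W Z) e.
rewrite !tw_torsion !(acsD, acsN, acsZ) acsT !scaler0 !subr0.
rewrite !(metricDl, metricNl, metricZl) !metricT hZ !mulr0 => h.
have rot U W : theta W = 0 -> Psi U W (J Z) = - g (J (tw U (J W))) Z - g (tw U W) Z.
  move=> hW; rewrite /Psi ![g _ (J Z)]metric_acs_r acs_acs tw_theta hW vf0 scale0r sub0r.
  by rewrite metricNl; ring.
rewrite !rot // /Psi.
move/eqP: h; rewrite -subr_eq0 => /eqP h.
rewrite -[RHS]oppr0 -[in RHS]h; ring.
Qed.

(** [Psi] vanishes as soon as one argument is [T], so horizontal ones suffice. There integrability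
    at (W, Z, U) and the cyclic identity at (U, W, Z) and at (U, J W, J Z) add up to 2 Psi U W Z =
    0: closed and integrable implies parallel. *)
Lemma tw_acs X Y : tw X (J Y) = J (tw X Y).
Proof.
suff Psi0 Z : Psi X Y Z = 0 by apply: metric_nondeg => Z; apply: subr0_eq; exact: Psi0.
have PsiT1 U W : Psi T U W = 0 by rewrite /Psi !tw_reeb reeb_acs subrr.
have PsiT2 U W : Psi U T W = 0 by rewrite /Psi acsT twT tw0 acs0 subrr.
have PsiT3 U W : Psi U W T = 0.
  by rewrite Psi_skew PsiT2 oppr0.
pose hproj U : V := U - theta U *: T.
have hor U : theta (hproj U) = 0.
  by rewrite /hproj addrC -scaleNr theta_lin thetaT mulr1 addNr.
have hproj_eq (P : V -> A) U : alinear P -> P T = 0 -> P U = P (hproj U).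
  move=> Pl PT; rewrite /hproj addrC -scaleNr Pl PT mulr0 add0r //.
rewrite (hproj_eq _ _ (Psi_lin1 Y Z)) // (hproj_eq _ _ (Psi_lin2 _ Z)) //.
rewrite (hproj_eq _ _ (Psi_lin3 _ _)) //.
move: (hproj X) (hproj Y) (hproj Z) (hor X) (hor Y) (hor Z) => {X Y}U W {}Z hU hW hZ.
apply: two_eq0.
have := Psi_nijenhuis hW hZ hU.
rewrite -(Psi_acs (J W) _ hZ) -(Psi_acs (J Z) _ hW) (Psi_skew Z W U) (Psi_skew (J Z) (J W) U).
have e1 := Psi_cyclic U W Z; have e2 := Psi_cyclic U (J W) (J Z).
have e3 : Psi U (J W) (J Z) = - Psi U W Z.
  rewrite -(Psi_acs U _ (theta_acs W)) acs_acs hW scale0r sub0r.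
  by rewrite -scaleN1r (alinearZ _ _ (Psi_lin2 U Z)) mulN1r.
rewrite e3 in e2 => e.
have -> : Psi U W Z + Psi U W Z = 0 - 0 - 0 :> A; last by rewrite !subr0.
by rewrite -[X in X - _ - _]e1 -[X in _ - X - _]e2 -[X in _ - X]e; ring.
Qed.

End TanakaWebster.

(** * The metric and connection of a Sasakian manifold *)

Section Geometry.
Variables (R : realType) (n : nat) (M : smoothManifold R (2 * n).+1).
Variable S : sasakian M.
Hypothesis Mcompact : compact [set: M].
Local Notation A := (Cinf M).
Local Notation V := (vfield M).
Local Notation T := (reeb S).
Local Notation J := (acs S).
Implicit Types (f : A) (X Y Z : V) (x : M).

Definition contact_oform : form M := mk_form (contact_formP S).1.1.
Definition theta X : A := contact_form S [:: X].
Definition om X Y : A := dext (contact_form S) [:: X; Y].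
Local Notation g := (metric S).

Lemma theta_lin : alinear theta.
Proof. by move=> f X Y; exact: (form_lin contact_oform [::] [::]). Qed.
Lemma thetaD X Y : theta (X + Y) = theta X + theta Y.
Proof. by rewrite -[X in LHS]scale1r theta_lin mul1r. Qed.
Lemma theta0 : theta 0 = 0. Proof. exact: alinear0 theta_lin. Qed.
Lemma thetaZ f X : theta (f *: X) = f * theta X. Proof. exact: alinearZ theta_lin. Qed.
Lemma thetaN X : theta (- X) = - theta X.
Proof. by apply: (addrI (theta X)); rewrite -thetaD !subrr theta0. Qed.
Lemma thetaB X Y : theta (X - Y) = theta X - theta Y.
Proof. by rewrite thetaD thetaN. Qed.

Lemma omE X Y : om X Y = (X (theta Y) : A) - Y (theta X) - theta (vbracket X Y).
Proof.
rewrite /om (dext_cons contact_oform) (dext_cons (iota X contact_oform)) dext_nil subr0.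
rewrite -[X in _ - X]/((Y (theta X) : A)) -[X in X - _]iotaE iota_lop !formB.
by rewrite lop_nil iotaE -/(theta _) addrAC.
Qed.

Lemma omC X Y : om X Y = - om Y X.
Proof. by rewrite !omE vbracketC thetaN; ring. Qed.

Lemma om_linr Z : alinear (om Z).
Proof.
move=> f X Y; rewrite !omE vbracketZr !theta_lin !thetaD !thetaZ vfD vfM.
by rewrite vfieldD vfieldZ; ring.
Qed.
Lemma om_linl Z : alinear (om^~ Z).
Proof. by move=> f X Y; rewrite omC om_linr ![om _ Z]omC; ring. Qed.
Lemma omDl X Y Z : om (X + Y) Z = om X Z + om Y Z.
Proof. by rewrite -[X in LHS]scale1r om_linl mul1r. Qed.
Lemma omDr X Y Z : om Z (X + Y) = om Z X + om Z Y.
Proof. by rewrite -[X in LHS]scale1r om_linr mul1r. Qed.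
Lemma omNr X Z : om Z (- X) = - om Z X.
Proof.
apply: (addrI (om Z X)); rewrite -omDr !subrr; exact: (alinear0 (om_linr Z)).
Qed.
Lemma omNl X Z : om (- X) Z = - om X Z. Proof. by rewrite omC omNr -omC. Qed.
Lemma omZr f X Z : om Z (f *: X) = f * om Z X. Proof. exact: alinearZ (om_linr Z). Qed.
Lemma omZl f X Z : om (f *: X) Z = f * om X Z. Proof. exact: (alinearZ _ _ (om_linl Z)). Qed.

Lemma thetaT : theta T = 1. Proof. by case: (reebP S). Qed.
Lemma omTl X : om T X = 0.
Proof. by have [_ /(congr1 (fun c => c [:: X]))] := reebP S. Qed.
Lemma omTr X : om X T = 0. Proof. by rewrite omC omTl oppr0. Qed.

Lemma om_closed X Y Z : (X (om Y Z) : A) + Y (om Z X) + Z (om X Y) =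
  om (vbracket X Y) Z + om (vbracket Y Z) X + om (vbracket Z X) Y.
Proof.
have e X' Y' : theta (vbracket X' Y') = (X' (theta Y') : A) - Y' (theta X') - om X' Y'.
  by rewrite omE; ring.
have jac : theta (vbracket (vbracket X Y) Z) + theta (vbracket (vbracket Y Z) X) +
    theta (vbracket (vbracket Z X) Y) = 0.
  rewrite -!thetaD (_ : _ + _ = 0) ?theta0 //.
  apply: vfield_ext => f; rewrite !vfieldD !vbracketE !vfB vfield0.
  by ring.
rewrite !e !vbracketE !vfB in jac.
apply/eqP; rewrite -subr_eq0 -[X in _ == X]jac; apply/eqP.
by ring.
Qed.

Lemma theta_reeb X : theta (vbracket T X) = T (theta X).
Proof. by have := omE T X; rewrite omTl thetaT vf1 subr0 => /esym/subr0_eq. Qed.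

Lemma om_reeb X Y : (T (om X Y) : A) = om (vbracket T X) Y + om X (vbracket T Y).
Proof.
have := om_closed T X Y; rewrite !(omTl, omTr) !vf0 !addr0 => ->.
by rewrite [om (vbracket Y T) X]omC [vbracket Y T]vbracketC omNr opprK.
Qed.

Definition hproj X : V := X - theta X *: T.

Lemma hproj_hor X : horizontal (contact_form S) (hproj X).
Proof. by rewrite /horizontal /= -/(theta _) thetaB thetaZ thetaT mulr1 subrr. Qed.

Lemma acs_lin f X Y : J (f *: X + Y) = f *: J X + J Y.
Proof. by case: (acsP S). Qed.
Lemma acsD X Y : J (X + Y) = J X + J Y.
Proof. by rewrite -[X in LHS]scale1r acs_lin scale1r. Qed.
Lemma acs0 : J 0 = 0. Proof. by apply: (addrI (J 0)); rewrite -acsD !addr0. Qed.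
Lemma acsN X : J (- X) = - J X.
Proof. by apply: (addrI (J X)); rewrite -acsD !subrr acs0. Qed.
Lemma acsZ f X : J (f *: X) = f *: J X.
Proof. by rewrite -[f *: X]addr0 acs_lin acs0 addr0. Qed.
Lemma acsT : J T = 0. Proof. by case: (acsP S). Qed.
Lemma acs_hproj X : J (hproj X) = J X.
Proof. by rewrite /hproj acsD acsN acsZ acsT scaler0 subr0. Qed.
Lemma theta_acs X : theta (J X) = 0.
Proof. by rewrite -acs_hproj; have [_ h _ _ _] := acsP S; have [] := h _ (hproj_hor X). Qed.
Lemma acs_acs X : J (J X) = theta X *: T - X.
Proof.
have [_ h _ _ _] := acsP S; have [_] := h _ (hproj_hor X).
by rewrite acs_hproj /hproj opprB.
Qed.
Lemma om_hprojl X Y : om (hproj X) Y = om X Y.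
Proof. by rewrite /hproj omDl omNl omZl omTl mulr0 subr0. Qed.
Lemma metricE X Y : g X Y = om X (J Y) + theta X * theta Y. Proof. by []. Qed.

(** Compatibility of [J] is given on horizontal fields; projecting to them changes nothing, since
    [om] and [J] both kill the Reeb field. *)
Lemma om_acs_sym X Y : om X (J Y) = om Y (J X).
Proof.
rewrite -om_hprojl -(acs_hproj Y) -[RHS]om_hprojl -(acs_hproj X).
by have [_ _ _ h _] := acsP S; apply: h; exact: hproj_hor.
Qed.

Lemma metricC X Y : g X Y = g Y X.
Proof. by rewrite !metricE om_acs_sym mulrC. Qed.

Lemma metric_lin f X Y Z : g (f *: X + Y) Z = f * g X Z + g Y Z.
Proof. by rewrite !metricE om_linl theta_lin; ring. Qed.

Lemma metric_acs X Y : g (J X) Y = om X Y.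
Proof.
rewrite metricE theta_acs mul0r addr0 om_acs_sym acs_acs omDr omNr omZr omTr mulr0 add0r.
by rewrite -omC.
Qed.

Lemma metricT X : g T X = theta X.
Proof. by rewrite metricE omTl thetaT mul1r add0r. Qed.

(** Positivity is assumed where the horizontal part is nonzero at [x]; where it vanishes at [x],
    tensoriality gives the value 0. *)
Lemma om_acs_ge0 X x : 0 <= om X (J X) x.
Proof.
rewrite -om_hprojl -(acs_hproj X).
have [ex|nex] := pselect (exists f, (hproj X f : A) x != 0).
  by apply/ltW; have [_ _ _ _ h] := acsP S; apply: h => //; exact: hproj_hor.
rewrite (@tensorial _ _ _ Mcompact (om^~ (J (hproj X))) (hproj X) 0) //.
- by rewrite (alinear0 (om_linl _)).
- exact: om_linl.
- move=> f; apply/eqP/negPn/negP => Xf; apply: nex; exists f.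
  by move: Xf; rewrite vfield0 cinf0.
Qed.

Lemma metric_pos X x : (exists f, (X f : A) x != 0) -> 0 < g X X x.
Proof.
move=> [f Xf]; rewrite metricE cinfD cinfM -expr2.
have [th|th] := eqVneq (theta X x) 0; last first.
  by rewrite ltr_wpDl ?om_acs_ge0 // lt_def sqr_ge0 sqrf_eq0 th.
rewrite th expr0n addr0 -om_hprojl -(acs_hproj X).
have [_ _ _ _ h] := acsP S; apply: h; first exact: hproj_hor.
exists f; rewrite /hproj vfieldD vfieldN vfieldZ cinfD cinfN cinfM th mul0r subr0.
exact: Xf.
Qed.

(** The Reeb field is Killing, since its Lie derivative annihilates [theta], [om] and, by
    [reeb_acs], [J]. *)
Lemma metric_reeb X Y : (T (g X Y) : A) = g (vbracket T X) Y + g X (vbracket T Y).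
Proof. by rewrite !metricE vfD vfM om_reeb reeb_acs !theta_reeb; ring. Qed.

Lemma metric_nondeg X Y : (forall Z, g X Z = g Y Z) -> X = Y.
Proof.
move=> h; have [I [E [F fr]]] := dual_frame Mcompact metricC metric_lin metric_pos.
by rewrite (fr X) (fr Y); apply: eq_bigr => a _; rewrite h.
Qed.

Lemma metric_alinear Z : alinear (g^~ Z). Proof. by move=> f X Y; exact: metric_lin. Qed.

(** The pair [(W, - J W)] stands for W - sqrt(-1) J W, twice the (1,0) part of W; [H10_involutive]
    for two such fields, read in its first component, is the relation. *)
Lemma acs_nijenhuis X Y : theta X = 0 -> theta Y = 0 ->
  J (vbracket X Y - vbracket (J X) (J Y)) = vbracket X (J Y) + vbracket (J X) Y.
Proof.
move=> hX hY.
have H10E W : theta W = 0 -> H10 (contact_form S) J (W, - J W).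
  move=> hW; split; first exact: hW.
    by rewrite /horizontal /= -/(theta _) thetaN theta_acs oppr0.
  by rewrite [J (- _)]acsN acs_acs hW scale0r sub0r !opprK.
have [_ _ [e _]] := H10_involutive (H10E _ hX) (H10E _ hY).
have brN U W : vbracket U (- W : V) = - vbracket U W.
  by apply: vfield_ext => f; rewrite vfieldN !vbracketE !vfieldN vfN; ring.
have brNl U W : vbracket (- U : V) W = - vbracket U W.
  by rewrite vbracketC brN -vbracketC.
by move: e; rewrite /= !(brN, brNl) opprK opprD !opprK.
Qed.

Definition half : A := (2^-1 : R) *: (1 : A).

Lemma half2 : half + half = 1.
Proof. by apply: cinf_ext => x; rewrite cinfD cinfZ cinf1 mulr1; lra. Qed.

Section Connection.
Variables (I : finType) (E F : I -> V).
Hypothesis frame : forall X, X = \sum_a g X (F a) *: E a.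

(* The Levi-Civita derivative of [Y] along [X], corrected so as to make [T] and
   [J] parallel: the Tanaka-Webster connection. *)
Definition tw X Y : V := \sum_a (half * koszul g X Y (F a)) *: E a
  - (half * theta X) *: J Y - (half * theta Y) *: J X + (half * om X Y) *: T.

Lemma metric_twE X Y Z : g (tw X Y) Z = half * (koszul g X Y Z - theta X * om Y Z -
  theta Y * om X Z + om X Y * theta Z).
Proof.
have gD U W : g (U + W) Z = g U Z + g W Z by rewrite -[U in LHS]scale1r metric_lin mul1r.
have gZ f U : g (f *: U) Z = f * g U Z by exact: (alinearZ _ _ (metric_alinear Z)).
have gN U : g (- U) Z = - g U Z by rewrite -scaleN1r gZ mulN1r.
rewrite /tw gD gD gD !gN !gZ !metric_acs metricT.
rewrite (alinear_sum _ _ (metric_alinear Z)).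
have -> : \sum_i half * koszul g X Y (F i) * g (E i) Z = half * koszul g X Y Z.
  have kl := koszul_lin metricC metric_lin X Y.
  rewrite [in RHS](frame_flip metricC metric_lin frame Z) (alinear_sum _ _ kl) mulr_sumr.
  by apply: eq_bigr => a _; rewrite (metricC Z); ring.
by ring.
Qed.

Lemma contact_tw_covP X f Y Z : tw X (f *: Y + Z) = f *: tw X Y + (X f : A) *: Y + tw X Z.
Proof. exact: (tw_covP metricC metric_lin metric_nondeg theta_lin omC om_linl half2 metric_twE). Qed.

Definition tw_cov X : covd M := Covd (contact_tw_covP X).

Lemma sasakian_trace : \sum_a g (E a) (F a) = (2 * n).+1%:R.
Proof.
apply: cinf_ext => x.
have [ o ho] := orthonormal_exists metricC metric_lin metric_pos x.
have gl Z : alinear (g^~ Z) by move=> f U W; exact: metric_lin.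
have gr Z : alinear (g Z) by move=> f U W; rewrite metricC metric_lin ![g _ Z]metricC.
rewrite (trace_orthonormal Mcompact metricC metric_lin frame ho gl gr).
under eq_bigr do rewrite ho eqxx.
rewrite sumr_const card_ord.
suff nat k : (k%:R : A) x = k%:R by rewrite nat.
by elim: k => [|k IH]; rewrite ?mulr0n // !mulrS cinfD cinf1 IH.
Qed.

Lemma metric_reeb_acs_acs X : J (J X) = g T X *: T - X.
Proof. by rewrite metricT acs_acs. Qed.

Lemma tw_torsion_metric X Y : vbracket X Y = tw X Y - tw Y X - g (J X) Y *: T.
Proof.
rewrite metric_acs.
exact: (tw_torsion metricC metric_lin metric_nondeg omC metricT half2 metric_twE).
Qed.

Lemma metricTT : g T T = 1. Proof. by rewrite metricT thetaT. Qed.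

Lemma metric_acs_skew X Y : g (J X) Y = - g X (J Y).
Proof. by rewrite (metricC X) !metric_acs -omC. Qed.

Definition sasakian_structure : structure M n :=
  @Structure R (2 * n).+1 M n g metricC metric_lin I E F frame T metricTT J acs_lin
    metric_acs_skew acsT metric_reeb_acs_acs tw_cov (fun X => erefl)
    (tw_lin metricC metric_lin metric_nondeg theta_lin om_linl metric_twE)
    (tw_metric metricC metric_lin omC half2 metric_twE)
    (twT metricC metric_lin metric_nondeg omE omC omTl thetaT metricT metric_reeb metric_twE)
    (tw_reeb metricC metric_lin metric_nondeg omE omC omTl thetaT metricT metric_reeb half2 metric_twE)
    (tw_acs metricC metric_lin metric_nondeg theta_lin omE omC om_linl om_closed omTl
       thetaT acs_lin acsT acs_acs theta_acs metric_acs metricT metric_reeb (@reeb_acs _ _ _ S)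
       acs_nijenhuis half2 metric_twE)
    tw_torsion_metric sasakian_trace.

End Connection.
End Geometry.

(** * Integration and the divergence theorem *)

Section OneDim.
Variable R : realType.
Local Notation mu := (@lebesgue_measure R).
Implicit Types (f g : R -> R) (B C : R).

Definition csupp1 B f := continuous f /\ forall x, B < `|x| -> f x = 0.

Definition int1 f : R := \int[mu]_(x in setT) f x.

Lemma csupp1_restrict B f : csupp1 B f -> f \_ `[- B, B] = f.
Proof.
move=> [_ f0]; apply/funext => x; rewrite patchE; case: ifPn => // /negP xB.
rewrite f0 // ltNge; apply/negP => h; apply: xB; apply/mem_set.
by rewrite /= in_itv /= -ler_norml.
Qed.

Lemma csupp1_integrable B f a b : csupp1 B f -> mu.-integrable `[a, b] (EFin \o f).
Proof.
move=> [cf _]; apply: continuous_compact_integrable; first exact: segment_compact.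
exact: continuous_subspaceT.
Qed.

Lemma csupp1_integrableT B f : csupp1 B f -> mu.-integrable setT (EFin \o f).
Proof.
move=> cf; rewrite -(csupp1_restrict cf) -restrict_EFin.
have mD : measurable (`[- B, B]%classic : set R) by exact: measurable_itv.
by apply/(@integrable_mkcond _ _ _ mu _ _ mD); exact: csupp1_integrable cf.
Qed.

Lemma mu_itv (a b : R) : a < b -> fine (mu (`[a, b] : set R)) = b - a.
Proof. by move=> ab; rewrite lebesgue_measure_itv /= lte_fin ab -EFinD. Qed.

Lemma int1E B f : csupp1 B f -> int1 f = \int[mu]_(x in `[- B, B]) f x.
Proof. by move=> cf; rewrite Rintegral_mkcond (csupp1_restrict cf). Qed.

Lemma int1_lin B c f g : csupp1 B f -> csupp1 B g ->
  int1 (fun x => f x + c * g x) = int1 f + c * int1 g.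
Proof.
move=> cf cg; have If := csupp1_integrableT cf; have Ig := csupp1_integrableT cg.
rewrite /int1 RintegralD //; last exact: (integrableZl _ c Ig).
by rewrite RintegralZl.
Qed.

Lemma int1_bound B C f : 0 < B -> csupp1 B f -> (forall x, `|f x| <= C) ->
  `|int1 f| <= C * (2 * B).
Proof.
move=> B0 cf hC; rewrite (int1E cf).
have i1 := csupp1_integrable (- B) B cf.
apply: (le_trans (le_normr_Rintegral _ i1)) => //.
have -> : C * (2 * B) = \int[mu]_(x in `[- B, B]) (fun=> C) x.
  rewrite Rintegral_cst // mu_itv ?gtrN //.
  by rewrite opprK; ring.
apply: le_Rintegral => //.
- apply: continuous_compact_integrable; first exact: segment_compact.
  apply: continuous_subspaceT => x; apply: (@continuous_comp _ _ _ f (fun s => `|s|)).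
    by case: cf => + _; exact.
  exact: norm_continuous.
- apply: continuous_compact_integrable; first exact: segment_compact.
  by apply: continuous_subspaceT => x; exact: cst_continuous.
Qed.

Lemma int1_ge0 f : (forall x, 0 <= f x) -> 0 <= int1 f.
Proof. by move=> f0; apply: Rintegral_ge0. Qed.

Lemma int1_eq0 B f : csupp1 B f -> (forall x, 0 <= f x) -> int1 f = 0 -> forall x, f x = 0.
Proof.
move=> cf f0 If x0; apply/eqP/negPn/negP => fx0.
have fx : 0 < f x0 by rewrite lt_def fx0 f0.
have f2 : 0 < f x0 / 2 by rewrite divr_gt0.
have [cont _] := cf.
have /cvgrPdist_lt/(_ _ f2)/nbhs_ballP[d /= d0 hd] := cont x0.
pose a := x0 - d / 2; pose b := x0 + d / 2.
have ab : a < b by rewrite /a /b; lra.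
have fge y : y \in `[a, b] -> f x0 / 2 <= f y.
  rewrite in_itv /= => /andP[ay yb]; have /hd : ball x0 d y.
    by rewrite /ball /= ltr_norml; apply/andP; rewrite /a /b in ay yb; split; lra.
  by rewrite ltr_norml => /andP[_]; lra.
have iD := csupp1_integrable a b cf.
have h1 : \int[mu]_(x in `[a, b]) f x <= int1 f.
  rewrite Rintegral_mkcond; apply: le_Rintegral => //.
  - have mD : measurable (`[a, b]%classic : set R) by exact: measurable_itv.
    by rewrite -restrict_EFin; apply/(@integrable_mkcond _ _ _ mu _ _ mD).
  - exact: csupp1_integrableT cf.
  - by move=> y _; rewrite patchE; case: ifP.
have h2 : f x0 / 2 * (b - a) <= \int[mu]_(x in `[a, b]) f x.
  have -> : f x0 / 2 * (b - a) = \int[mu]_(x in `[a, b]) (fun=> f x0 / 2) x.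
    by rewrite Rintegral_cst // mu_itv.
  apply: le_Rintegral => //.
  apply: continuous_compact_integrable; first exact: segment_compact.
  by apply: continuous_subspaceT => x; exact: cst_continuous.
have := le_trans h2 h1; rewrite If leNgt => /negP; apply.
by rewrite mulr_gt0 // subr_gt0.
Qed.

Lemma taylor_is_derive f (l : R) x C : (forall h, `|f (x + h) - f x - h * l| <= C * h ^+ 2) ->
  is_derive x (1 : R) f l.
Proof.
move=> hC; have C0 : 0 <= C.
  by have := le_trans (normr_ge0 _) (hC 1); rewrite expr1n mulr1.
suff h : (fun h => h^-1 *: (f (h *: (1 : R) + x) - f x)) @ 0^' --> l.
  by split; [apply/cvg_ex; exists l | apply/cvg_lim].
have C1 : 0 < C + 1 by rewrite ltr_wpDl.
apply/cvgrPdist_le => e e0; have e1 : 0 < e / (C + 1) by exact: divr_gt0.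
near=> h.
have h0 : h != 0 by near: h; exact: nbhs_dnbhs_neq.
have -> : l - h^-1 *: (f (h *: (1 : R) + x) - f x) = - (h^-1 * (f (x + h) - f x - h * l)).
  rewrite [h *: (1 : R)]mulr1 [h + x]addrC [h^-1 *: _](_ : _ = h^-1 * (f (x + h) - f x)) //.
  by field.
rewrite normrN normrM normfV ler_pdivrMl ?normr_gt0 //.
apply: (le_trans (hC h)); rewrite -real_normK ?num_real // expr2 mulrA mulrC.
rewrite ler_wpM2l //.
have : `|h| <= e / (C + 1) by near: h; exact: dnbhs0_le.
rewrite ler_pdivlMr // mulrDr mulr1 [`|h| * C]mulrC => /(le_trans _); apply.
by rewrite lerDl.
Unshelve. all: by end_near. Qed.

Lemma int1_derive B C f g : csupp1 B f -> csupp1 B g ->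
  (forall x h, `|f (x + h) - f x - h * g x| <= C * h ^+ 2) -> int1 g = 0.
Proof.
move=> [cf f0] [cg g0] hC.
(* A positive bound larger than [B], so that [f] vanishes at both endpoints of the interval whatever
   the sign of [B]. *)
pose B1 := `|B| + 1.
have BB : B < B1 by rewrite /B1 (le_lt_trans (ler_norm B)) // ltrDl.
have B10 : 0 < B1 by rewrite /B1 ltr_wpDl.
have cg1 : csupp1 B1 g by split=> // x hx; apply: g0; exact: lt_trans hx.
rewrite (int1E cg1) /Rintegral.
have df (x : R) : is_derive x (1 : R) f (g x) := taylor_is_derive (hC x).
rewrite (@continuous_FTC2 _ g f (- B1) B1).
- by rewrite !f0 ?normrN ?(gtr0_norm B10) // -EFinB subrr.
- by rewrite gtrN.
- exact: continuous_subspaceT.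
- split=> [x _||]; first by case: (df x).
    by apply: cvg_at_right_filter; exact: cf.
  by apply: cvg_at_left_filter; exact: cf.
- by move=> x _; rewrite derive1E; case: (df x).
Qed.

End OneDim.

(** * Iterated integrals of compactly supported functions *)

Section Iterated.
Variable R : realType.
Implicit Types (B C : R).

Definition csupp m B (F : 'rV[R]_m -> R) := continuous F /\ forall y, B < `|y| -> F y = 0.

Definition rowcons m (x : R) (v : 'rV[R]_m) : 'rV[R]_m.+1 := row_mx (const_mx x : 'rV_1) v.

Lemma rowcons0 m x (v : 'rV[R]_m) : rowcons x v 0 ord0 = x.
Proof.
have -> : ord0 = lshift m ord0 :> 'I_(1 + m) by exact: val_inj.
exact: etrans (row_mxEl _ _ _ _) (mxE _ _ _ _).
Qed.

Lemma rowconsS m x (v : 'rV[R]_m) j : rowcons x v 0 (lift ord0 j) = v 0 j.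
Proof.
have -> : lift ord0 j = rshift 1 j :> 'I_(1 + m) by exact: val_inj.
exact: row_mxEr.
Qed.

Lemma row_shiftE m (y d : 'rV[R]_m) h j : (y + h *: d) 0 j = y 0 j + h * d 0 j.
Proof. by rewrite !mxE. Qed.

Lemma row_subE m (y d : 'rV[R]_m) j : (y - d) 0 j = y 0 j - d 0 j.
Proof. by rewrite !mxE. Qed.

Lemma rowconsP m (y z : 'rV[R]_m.+1) : y 0 ord0 = z 0 ord0 ->
  (forall j, y 0 (lift ord0 j) = z 0 (lift ord0 j)) -> y = z.
Proof.
move=> h0 hS; apply/rowP => k.
by case: (unliftP ord0 k) => [j ->|->].
Qed.

Definition slice m (F : 'rV[R]_m.+1 -> R) (x : R) : 'rV[R]_m -> R :=
  fun v => F (rowcons x v).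

Lemma iterated_integralS m (F : 'rV[R]_m.+1 -> R) :
  iterated_integral F = int1 (fun x => iterated_integral (slice F x)).
Proof. by []. Qed.

Lemma row_cons_norm m (x : R) (v : 'rV[R]_m) :
  `|x| <= `|rowcons x v| /\ `|v| <= `|rowcons x v|.
Proof.
split; first by have := norm_coord_le (rowcons x v) ord0; rewrite rowcons0.
rewrite norm_row_le //; apply/forallP => j.
by have := norm_coord_le (rowcons x v) (lift ord0 j); rewrite rowconsS.
Qed.

Lemma rowcons_cvg m (I : Type) (G : set_system I) {FG : Filter G} (f : I -> R)
    (h : I -> 'rV[R]_m) x v : f @ G --> x -> h @ G --> v ->
  (fun t => rowcons (f t) (h t)) @ G --> rowcons x v.
Proof.
move=> fx hv; apply/cvgrPdist_lt => e e0; near=> t.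
rewrite /Num.Def.normr /= mx_normrE; apply/bigmax_ltP; split => // -[a j] _ /=.
rewrite (ord1 a); case: (unliftP ord0 j) => [k ->|->].
  rewrite row_subE !rowconsS; apply: (@le_lt_trans _ _ `|v - h t|).
    by have := norm_coord_le (v - h t) k; rewrite row_subE.
  by near: t; move/cvgrPdist_lt/(_ _ e0): hv.
by rewrite row_subE !rowcons0; near: t; move/cvgrPdist_lt/(_ _ e0): fx.
Unshelve. all: by end_near. Qed.

Lemma csupp_slice m B (F : 'rV[R]_m.+1 -> R) x : csupp B F -> csupp B (slice F x).
Proof.
move=> [cF F0]; split=> [v|v Bv]; last first.
  by rewrite /slice F0 // (lt_le_trans Bv) //; case: (row_cons_norm x v).
apply: (@continuous_comp _ _ _ (rowcons x) F); last exact: cF.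
exact: (@rowcons_cvg m _ (nbhs v) (nbhs_filter v) (fun=> x) id x v (cvg_cst x) cvg_id).
Qed.

Lemma csupp_lin m B c (F G : 'rV[R]_m -> R) : csupp B F -> csupp B G ->
  csupp B (fun y => F y + c * G y).
Proof.
move=> [cF F0] [cG G0]; split=> [y|y By]; last by rewrite F0 // G0 // mulr0 addr0.
apply: (@continuousD _ _ _ F (fun y => c * G y)); first exact: cF.
by apply: (@continuousM _ _ (fun=> c) G); [exact: cst_continuous|exact: cG].
Qed.

(** Compactness of the ball that carries the support turns joint continuity into continuity of
    slices, uniformly in [v]. *)
Lemma slice_uniform m B (F : 'rV[R]_m.+1 -> R) x0 e : csupp B F -> 0 < e ->
  \forall x \near x0, forall v, `|slice F x v - slice F x0 v| <= e.
Proof.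
move=> cF e0.
have cK : compact (cball (0 : 'rV[R]_m) B) by exact: cball_compact.
have nc := (compact_near_coveringP _).1 cK R (nbhs x0)
  (fun x v => `|slice F x v - slice F x0 v| <= e) _.
have : \forall x \near x0, cball (0 : 'rV[R]_m) B `<=` (fun v => `|slice F x v - slice F x0 v| <= e).
  apply: nc => v _.
  pose Gp (p : 'rV[R]_m * R) := slice F p.2 p.1.
  have cG (w : 'rV[R]_m) x : {for (w, x), continuous Gp}.
    apply: (@continuous_comp _ _ _ (fun p : 'rV[R]_m * R => rowcons p.2 p.1) F).
      by apply: rowcons_cvg; [exact: cvg_snd|exact: cvg_fst].
    by case: cF => + _; apply.
  have cH : (fun p : 'rV[R]_m * R => Gp p - Gp (p.1, x0)) @ (v, x0) --> Gp (v, x0) - Gp (v, x0).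
    apply: cvgB; first exact: cG.
    apply: (@continuous_comp _ _ _ (fun p : 'rV[R]_m * R => rowcons x0 p.1) F).
      by apply: rowcons_cvg; [exact: cvg_cst|exact: cvg_fst].
    by case: cF => + _; apply.
  rewrite subrr in cH; move/cvgrPdist_le/(_ _ e0): cH.
  by apply: filterS => -[w x]; rewrite /= sub0r normrN.
apply: filterS => x hx v; have [vB|vB] := lerP `|v| B.
  by apply: hx; rewrite /cball /= subr0.
have [_ z] := csupp_slice x cF; have [_ z0] := csupp_slice x0 cF.
by rewrite z // z0 // subrr normr0 ltW.
Qed.

(** The three facts feed each other: linearity and the bound in dimension [m] make the inner
    integrals continuous in the outer variable, and the one-dimensional integral needs this
    continuity in dimension [m.+1]. *)
Lemma iterated_main m B : 0 < B ->
  (forall c (F G : 'rV[R]_m -> R), csupp B F -> csupp B G ->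
     iterated_integral (fun y => F y + c * G y) =
     iterated_integral F + c * iterated_integral G) /\
  (forall C (F : 'rV[R]_m -> R), csupp B F -> (forall y, `|F y| <= C) ->
     `|iterated_integral F| <= C * (2 * B) ^+ m) /\
  (if m is m'.+1 then forall F : 'rV[R]_m'.+1 -> R, csupp B F ->
     csupp1 B (fun x => iterated_integral (slice F x)) else True).
Proof.
move=> B0; elim: m => [|m [lin [bnd _]]].
  by split=> //; split=> // C F _ hC; rewrite expr0 mulr1; exact: hC.
have cont (F : 'rV[R]_m.+1 -> R) : csupp B F ->
    csupp1 B (fun x => iterated_integral (slice F x)).
  move=> cF; split=> [x0|x Bx]; last first.
    have := bnd 0 _ (csupp_slice x cF); rewrite mul0r => h.
    apply/eqP; rewrite -normr_le0; apply: h => y; rewrite normr_le0 /slice.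
    have [_ ->] := cF; first by [].
    by apply: (lt_le_trans Bx); case: (row_cons_norm x y).
  apply/cvgrPdist_le => e e0.
  have D0 : 0 < (2 * B) ^+ m by rewrite exprn_gt0 // mulr_gt0.
  have := slice_uniform x0 cF (divr_gt0 e0 D0); apply: filterS => x hx.
  have cs := csupp_slice x cF; have cs0 := csupp_slice x0 cF.
  rewrite distrC -[X in _ - X]mul1r -mulNr -(lin _ _ _ cs cs0).
  apply: le_trans (bnd (e / (2 * B) ^+ m) _ (csupp_lin _ cs cs0) _) _ => [y|].
    by rewrite mulN1r; exact: hx.
  by rewrite divfK // gt_eqF.
split=> [c F G cF cG|].
  rewrite !iterated_integralS -(int1_lin c (cont _ cF) (cont _ cG)).
  congr int1; apply/funext => x.
  exact: (lin c _ _ (csupp_slice x cF) (csupp_slice x cG)).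
split=> // C F cF hC; rewrite iterated_integralS.
have h x : `|iterated_integral (slice F x)| <= C * (2 * B) ^+ m.
  by apply: bnd; [exact: csupp_slice|move=> y; exact: hC].
apply: le_trans (int1_bound B0 (cont _ cF) h) _.
by rewrite -mulrA -exprSr.
Qed.

Section Facts.
Variables (m : nat) (B : R).
Hypothesis B0 : 0 < B.
Implicit Types F G : 'rV[R]_m -> R.

Lemma iterated_lin c F G : csupp B F -> csupp B G ->
  iterated_integral (fun y => F y + c * G y) = iterated_integral F + c * iterated_integral G.
Proof. by have [h _] := iterated_main m B0; exact: h. Qed.

Lemma iterated_bound C F : csupp B F -> (forall y, `|F y| <= C) ->
  `|iterated_integral F| <= C * (2 * B) ^+ m.
Proof. by have [_ [h _]] := iterated_main m B0; exact: h. Qed.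

End Facts.

Lemma iterated_slice m B (F : 'rV[R]_m.+1 -> R) : 0 < B -> csupp B F ->
  csupp1 B (fun x => iterated_integral (slice F x)).
Proof. by move=> B0; have [_ [_ h]] := iterated_main m.+1 B0; exact: h. Qed.

Lemma iterated_ge0 m (F : 'rV[R]_m -> R) : (forall y, 0 <= F y) -> 0 <= iterated_integral F.
Proof.
elim: m F => [|m IH] F F0; first exact: F0.
by rewrite iterated_integralS; apply: int1_ge0 => x; apply: IH => y; exact: F0.
Qed.

Lemma iterated_eq0 m B (F : 'rV[R]_m -> R) : 0 < B -> csupp B F -> (forall y, 0 <= F y) ->
  iterated_integral F = 0 -> forall y, F y = 0.
Proof.
move=> B0; elim: m F => [|m IH] F cF F0 h y; first by rewrite (thinmx0 y).
rewrite iterated_integralS in h.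
have h1 := int1_eq0 (iterated_slice B0 cF)
  (fun x => iterated_ge0 (fun v => F0 (rowcons x v))) h.
have -> : y = rowcons (y 0 ord0) (\row_j y 0 (lift ord0 j)).
  by apply: rowconsP => [|j]; rewrite (rowcons0, rowconsS) ?mxE.
exact: (IH _ (csupp_slice _ cF) (fun v => F0 _) (h1 _)).
Qed.

(** A uniform Taylor bound is assumed instead of differentiability because it survives integration
    over the inner variables when [i] is the outer one; for an inner [i] every slice already
    integrates to 0. *)
Lemma iterated_derive m B C (F G : 'rV[R]_m -> R) i : 0 < B -> csupp B F -> csupp B G ->
  (forall y h, `|F (y + h *: delta_mx 0 i) - F y - h * G y| <= C * h ^+ 2) ->
  iterated_integral G = 0.
Proof.
move=> B0; elim: m F G i => [|m IH] F G i cF cG hC; first by case: i hC.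
rewrite iterated_integralS.
case: (unliftP ord0 i) => [j ij|i0].
  have z x : iterated_integral (slice G x) = 0.
    apply: (IH (slice F x) (slice G x) j); try exact: csupp_slice.
    move=> v h; have := hC (rowcons x v) h; rewrite /slice.
    suff -> : rowcons x v + h *: delta_mx 0 i = rowcons x (v + h *: delta_mx 0 j) by [].
    apply: rowconsP => [|k]; rewrite row_shiftE !(rowcons0, rowconsS) ij.
      by rewrite mxE (negbTE (neq_lift _ _)) mulr0 addr0.
    by rewrite row_shiftE !mxE (inj_eq lift_inj).
  rewrite (_ : (fun x => _) = fun=> 0); last by apply/funext.
  by rewrite /int1 Rintegral_cst // mul0r.
apply: (@int1_derive _ B (C * (2 * B) ^+ m) (fun x => iterated_integral (slice F x))).
- exact: iterated_slice.
- exact: iterated_slice.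
move=> x h.
have c1 := csupp_slice (x + h) cF; have c2 := csupp_slice x cF; have c3 := csupp_slice x cG.
have -> : iterated_integral (slice F (x + h)) - iterated_integral (slice F x) -
    h * iterated_integral (slice G x) = iterated_integral (fun v =>
      slice F (x + h) v + -1 * slice F x v + (- h) * slice G x v).
  by rewrite (iterated_lin B0 _ (csupp_lin (-1) c1 c2) c3) (iterated_lin B0 _ c1 c2) mulN1r mulNr.
apply: le_trans (iterated_bound B0 (C := C * h ^+ 2) (csupp_lin _ (csupp_lin _ c1 c2) c3) _) _.
  move=> v; have := hC (rowcons x v) h; rewrite /slice mulN1r mulNr.
  suff -> : rowcons x v + h *: delta_mx 0 i = rowcons (x + h) v by [].
  apply: rowconsP => [|k]; rewrite row_shiftE !(rowcons0, rowconsS) i0 mxE ?eqxx ?mulr1 //.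
  by rewrite eq_sym (negbTE (neq_lift _ _)) mulr0 addr0.
by rewrite mulrAC.
Qed.

End Iterated.

(** Jacobi's formula for an abstract derivation: differentiate one row at a time and expand along
    that row. *)
Lemma det_derive (A : comPzRingType) (D : A -> A) N (G : 'M[A]_N) :
  (forall f g, D (f + g) = D f + D g) -> (forall f g, D (f * g) = D f * g + f * D g) ->
  D (\det G) = \sum_i \sum_j D (G i j) * cofactor G i j.
Proof.
move=> DD DM.
have D0 : D 0 = 0 by apply: (addrI (D 0)); rewrite -DD !addr0.
have D1 : D 1 = 0.
  by apply: (addrI (D 1)); rewrite addr0 -[in RHS](mulr1 1) DM mulr1 mul1r.
have Dsum (I : Type) (r : seq I) (P : pred I) (F : I -> A) :
    D (\sum_(i <- r | P i) F i) = \sum_(i <- r | P i) D (F i).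
  exact: (big_morph D DD D0).
have DN f : D (- f) = - D f by apply: (addrI (D f)); rewrite -DD !subrr.
have Dprod (F : 'I_N -> A) : D (\prod_i F i) = \sum_k D (F k) * \prod_(i | i != k) F i.
  have gen (r : seq 'I_N) : uniq r -> D (\prod_(i <- r) F i) =
      \sum_(k <- r) D (F k) * \prod_(i <- r | i != k) F i.
    elim: r => [|j r IH] /=; first by rewrite !big_nil D1.
    move=> /andP[jr ur]; rewrite !big_cons DM IH // eqxx /=; congr (_ * _ + _).
      rewrite [RHS]big_seq_cond big_seq; apply: eq_bigl => i.
      by case: (boolP (i \in r)) => // ir /=; apply/esym; apply: contraNneq jr => <-.
    rewrite mulr_sumr big_seq [RHS]big_seq; apply: eq_bigr => k kr.
    have jk : j != k by apply: contraNneq jr => ->.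
    by rewrite big_cons jk mulrCA.
  exact: gen (index_enum_uniq _).
have -> : D (\det G) = \sum_k \det (\matrix_(i, j) if i == k then D (G i j) else G i j).
  rewrite /determinant Dsum exchange_big /=; apply: eq_bigr => s _.
  rewrite -mulr_sumr.
  have Dsign (b : bool) f : D ((-1) ^+ b * f) = (-1) ^+ b * D f.
    by case: b; rewrite ?expr1 ?expr0 ?mulN1r ?mul1r ?DN.
  rewrite Dsign.
  rewrite Dprod; congr (_ * _); apply: eq_bigr => k _.
  rewrite [RHS](bigD1 k) //= mxE eqxx; congr (_ * _).
  by apply: eq_bigr => i ik; rewrite mxE (negbTE ik).
apply: eq_bigr => k _; rewrite (expand_det_row _ k); apply: eq_bigr => j _.
rewrite mxE eqxx; congr (_ * _); rewrite /cofactor; congr (_ * \det _).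
by apply/matrixP => a b; rewrite !mxE eq_sym (negbTE (neq_lift _ _)).
Qed.

(** Negative powers of the square root are closed under differentiation, so 1/sqrt comes first, and
    then sqrt s = s / sqrt s. *)
Lemma smooth_on_sqrt (R : realType) m (W : set 'rV[R]_m) (phi : 'rV[R]_m -> R) : open W ->
  (forall x, W x -> 0 < phi x) -> smooth_on W phi ->
  smooth_on W (fun x => Num.sqrt (phi x)).
Proof.
move=> oW pos sphi.
pose G := [set g : R -> R | exists c n, g = fun s : R => c * (Num.sqrt s)^-1 ^+ n].
have sV : smooth_on W (fun x => (Num.sqrt (phi x))^-1).
  apply: (@smooth_on_comp1 R m G [set s | 0 < s] W phi _ oW pos sphi
    (fun s => (Num.sqrt s)^-1)); last by exists 1, 1%N; apply/funext => s; rewrite mul1r expr1.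
  move=> _ [c [n ->]]; exists (fun s => (- (c * n%:R) / 2) * (Num.sqrt s)^-1 ^+ n.+2).
    by exists (- (c * n%:R) / 2), n.+2.
  move=> s /= s0.
  have r0 : Num.sqrt s != 0 by rewrite gt_eqF // sqrtr_gt0.
  have dV := is_deriveV r0 (is_derive1_sqrt s0).
  have dX := @is_deriveX _ _ _ n s 1 _ dV.
  have := is_deriveZ c dX.
  have -> : (c \*: (fun s : R => (Num.sqrt s)^-1) ^+ n) = (fun s1 : R => c * (Num.sqrt s1)^-1 ^+ n).
    by apply/funext => r; rewrite /= exprfctE.
  suff -> : c *: ((n%:R * (Num.sqrt s)^-1 ^+ n.-1) *: (- (Num.sqrt s) ^- 2 *: (2 * Num.sqrt s)^-1)) =
    - (c * n%:R) / 2 * (Num.sqrt s)^-1 ^+ n.+2 by [].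
  rewrite /GRing.scale /=.
  case: n {dX} => [|n]; first by rewrite !(mulr0, mul0r, oppr0).
  by rewrite /= !exprS; field.
apply: (smooth_on_ext oW _ (smooth_onM oW sphi sV)) => x Wx.
have p := pos x Wx.
rewrite -{1}[phi x]sqr_sqrtr ?ltW // expr2 mulfK //.
by rewrite gt_eqF // sqrtr_gt0.
Qed.

(** * Coordinate boxes with a bump of half the radius *)

Section Boxes.
Variables (R : realType) (m : nat) (M : smoothManifold R m).
Local Notation A := (Cinf M).
Local Notation V := (vfield M).
Implicit Types (b : box M) (x : M).

(** A bump of half the radius leaves a collar of the box in which everything built from it vanishes;
    [integral_div_box] relies on this room. *)
Definition half_box b : box M := Box (bchart b) (bcenter b) (bradius b / 2).

Lemma half_box_is_box b : is_box b -> is_box (half_box b).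
Proof.
move=> [ab r0 sub]; split=> //=; first by rewrite divr_gt0.
move=> y hy; apply: sub; rewrite /oball /= in hy *.
by apply: (lt_trans hy); lra.
Qed.

Lemma box_bump_dist b x : is_box b -> box_bump b x != 0 ->
  chart_dom (bchart b) x /\ oball (bcenter b) (bradius b) (chart_map (bchart b) x).
Proof.
move=> bb bx; have [dx hx] := box_bump_supp bb bx; split=> //.
by apply: row_dist_lt => //; exact: box_radius_gt0.
Qed.

Lemma box_bump_gt0 b x : is_box b -> chart_dom (bchart b) x ->
  oball (bcenter b) (bradius b) (chart_map (bchart b) x) -> 0 < box_bump b x.
Proof.
move=> bb dx hx; rewrite box_bumpE // ext_chartE //.
apply: bump_gt0 => [|j]; first exact: box_radius_gt0.
apply: le_lt_trans hx.
by have := norm_coord_le (chart_map (bchart b) x - bcenter b) j; rewrite !mxE.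
Qed.

Lemma half_box_bump b x : is_box b -> box_bump (half_box b) x != 0 -> box_bump b x != 0.
Proof.
move=> bb bx; have [dx hx] := box_bump_dist (half_box_is_box bb) bx.
rewrite gt_eqF // box_bump_gt0 //; apply: (lt_trans hx) => /=.
by have := box_radius_gt0 bb; lra.
Qed.

Lemma box_around_half x : exists b, is_box b /\ 0 < box_bump (half_box b) x.
Proof.
have [b [bb /lt0r_neq0 bx]] := box_around x.
have r0 := box_radius_gt0 bb; have [dx hx] := box_bump_dist bb bx.
(* Three times this radius is 2 r, and the new centre is within r of the old one, so the enlarged
   ball stays in the old ball of radius 3 r. *)
pose b' := Box (bchart b) (chart_map (bchart b) x) (2 / 3 * bradius b).
have bb' : is_box b'.
  split=> /=; [exact: box_atlas|by rewrite mulr_gt0 ?divr_gt0|].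
  have [_ _ sub] := bb; move=> y hy; apply: sub; rewrite /oball /= in hy hx *.
  apply: (le_lt_trans (ler_distD (chart_map (bchart b) x) _ _)).
  by lra.
exists b'; split=> //; apply: box_bump_gt0 => //; first exact: half_box_is_box.
by rewrite /oball /= subrr normr0 divr_gt0 // mulr_gt0 // divr_gt0.
Qed.

Lemma vbracket_eq0 (X Y : V) f x : (X (Y f) : A) x = 0 -> (Y (X f) : A) x = 0 ->
  (vbracket X Y f : A) x = 0.
Proof. by move=> h1 h2; rewrite vbracketE cinfB h1 h2 subrr. Qed.

Section Box.
Variable b : box M.
Hypothesis bb : is_box b.
Local Notation c := (bchart b).
Local Notation q := (bcenter b).
Local Notation r := (bradius b).

Lemma oball_cod : oball q r `<=` chart_cod c.
Proof.
have [_ _ sub] := bb; have r0 := box_radius_gt0 bb.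
by move=> y hy; apply: sub; rewrite /oball /= in hy *; apply: (lt_trans hy); lra.
Qed.

Lemma oball_bump y : oball q r y -> box_bump b (chart_inv c y) != 0.
Proof.
move=> hy; have [dy ey] := chart_invK (oball_cod hy).
by rewrite gt_eqF // box_bump_gt0 // ey.
Qed.

Lemma box_field_repr i f y : oball q r y -> (box_field b i f : A) (chart_inv c y) =
  'D_(delta_mx 0 i) (fun z => f (chart_inv c z)) y.
Proof.
move=> hy; have [dy ey] := chart_invK (oball_cod hy).
by rewrite box_field_core ?ey //; apply: box_bump_core => //; exact: oball_bump.
Qed.

(** By [vf_expansion] it suffices to test coordinate functions; their first derivatives are constant
    near [x], so the second ones vanish. *)
Lemma box_field_commute i j x f : box_bump b x != 0 ->
  (vbracket (box_field b i) (box_field b j) f : A) x = 0.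
Proof.
move=> bx; rewrite (vf_expansion bb _ _ bx) big1 // => k _.
have z i' j' k' : (box_field b i' (box_field b j' (box_coord b k')) : A) x = 0.
  have [dx hx] := box_bump_dist bb bx.
  have := @box_field_repr i' (box_field b j' (box_coord b k')) _ hx.
  rewrite (chart_mapK dx) => ->.
  rewrite (eq_derivable (g := fun=> (j' == k')%:R) _ (@oball_open _ _ _ _) hx _).2.
    exact: derive_cst.
  by move=> y hy; rewrite box_field_coord //; exact: oball_bump.
by rewrite (vbracket_eq0 (z _ _ _) (z _ _ _)) mul0r.
Qed.

End Box.
End Boxes.

(** * Divergence of a coordinate field and the Gram determinant *)

Section LocalDivergence.
Variables (R : realType) (m : nat) (M : smoothManifold R m) (n : nat).
Variable st : structure M n.
Local Notation A := (Cinf M).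
Local Notation V := (vfield M).
Local Notation g := (stg st).
Hypothesis Mcompact : compact [set: M].
Hypothesis gpos : forall (X : V) x, (exists f, (X f : A) x != 0) -> 0 < g X X x.
Variables (e : 'I_m -> V) (h : 'I_m -> A).

Definition gram : 'M[A]_m := \matrix_(i, j) g (e i) (e j).

Section At.
Variable x : M.
Hypothesis expand : forall (P : V -> A) X, alinear P ->
  P X x = \sum_i (X (h i) : A) x * P (e i) x.
Hypothesis dual : forall i j, (e i (h j) : A) x = (i == j)%:R.
Hypothesis commute : forall i j f, (vbracket (e i) (e j) f : A) x = 0.

Let gl Z : alinear (g^~ Z). Proof. by move=> f X Y; exact: stg_lin. Qed.
Let gr Z : alinear (g Z). Proof. by move=> f X Y; exact: g_linr. Qed.
Let G := map_mx (fun f : A => f x) gram.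
(** The inverse metric in the basis [e]: it inverts the Gram matrix by [GQ]. *)
Let Q : 'M[R]_m := \matrix_(k, l) \sum_a (stE st a (h k) : A) x * (stF st a (h l) : A) x.

Let GE i j : G i j = g (e i) (e j) x. Proof. by rewrite !mxE. Qed.

Let trace_box (B : V -> V -> A) : (forall Z, alinear (B^~ Z)) -> (forall Z, alinear (B Z)) ->
  (\sum_a B (stE st a) (stF st a)) x = \sum_k \sum_l Q k l * B (e k) (e l) x.
Proof.
move=> Bl Br; rewrite cinf_sum.
under eq_bigr => a _.
  rewrite (expand _ (Bl _)).
  under eq_bigr do rewrite (expand _ (Br _)) mulr_sumr.
  over.
rewrite exchange_big /=; apply: eq_bigr => k _.
rewrite exchange_big /=; apply: eq_bigr => l _.
by rewrite mxE mulr_suml; apply: eq_bigr => a _; rewrite mulrA.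
Qed.

Let GQ : G *m Q = 1%:M.
Proof.
apply/matrixP => j l; rewrite mxE.
transitivity (\sum_a g (stE st a) (e j) x * (stF st a (h l) : A) x).
  under eq_bigr do rewrite [Q _ _]mxE mulr_sumr.
  rewrite exchange_big; apply: eq_bigr => a _ /=.
  rewrite (expand _ (gl _)) mulr_suml; apply: eq_bigr => k _.
  by rewrite GE (stgC st (e j)) mulrCA mulrA.
transitivity ((e j (h l) : A) x); last by rewrite dual // !mxE.
rewrite [in RHS](st_frame2 st (e j)) vfield_sum cinf_sum; apply: eq_bigr => a _.
by rewrite vfieldZ cinfM stgC.
Qed.

Let QT : Q^T = Q.
Proof.
have GT : G^T = G by apply/matrixP => i j; rewrite mxE [LHS]GE [RHS]GE (stgC st (e j)).
have : Q^T *m G = 1%:M by rewrite -[G in LHS]GT -trmx_mul GQ trmx1.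
by move=> QG; rewrite -[LHS]mulmx1 -GQ mulmxA QG mul1mx.
Qed.

Lemma gram_det_gt0 : 0 < (\det gram) x.
Proof.
have [ o ho] := orthonormal_exists (@stgC _ _ _ _ st) (@stg_lin _ _ _ _ st) gpos x.
pose B : 'M[R]_m := \matrix_(i, j) (o i (h j) : A) x.
have BG : B *m G *m B^T = 1%:M.
  apply/matrixP => i j; rewrite !mxE -ho (expand _ (gr _)).
  apply: eq_bigr => l _; rewrite mulrC [B^T _ _]mxE [B j l]mxE; congr (_ * _).
  rewrite (expand _ (gl _)) mxE; apply: eq_bigr => k _.
  by rewrite [B i k]mxE GE.
have := congr1 determinant BG; rewrite !det_mulmx det_tr det1 -cinf_det => d.
have d2 : \det B ^+ 2 * (\det gram) x = 1 by rewrite -d expr2 mulrAC.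
have B2 : 0 < \det B ^+ 2.
  rewrite lt_def sqr_ge0 andbT; apply/eqP => z; move: d2; rewrite z mul0r => /eqP.
  by rewrite eq_sym oner_eq0.
by rewrite -(pmulr_rgt0 _ B2) d2.
Qed.

Lemma gram_det_derive i : (e i (\det gram) : A) x =
  (\det gram) x * \sum_k \sum_l Q k l * (e i (g (e k) (e l)) : A) x.
Proof.
rewrite (@det_derive A (e i : A -> A)); [|exact: vfD|exact: vfM].
have adjQ : \adj G = (\det gram) x *: Q.
  have := mul_mx_adj G; rewrite -cinf_det => e1.
  rewrite -[LHS]mul1mx -(mulmx1C GQ) -mulmxA e1 mul_mx_scalar //.
rewrite cinf_sum mulr_sumr; apply: eq_bigr => k _.
rewrite cinf_sum mulr_sumr; apply: eq_bigr => l _.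
rewrite cinfM mulrA mulrC [gram k l]mxE; congr (_ * _).
have -> : (cofactor gram k l) x = cofactor G k l.
  rewrite /cofactor [LHS]cinfM; congr (_ * _).
    by rewrite -signr_odd -[in RHS]signr_odd cinf_sign.
  by rewrite cinf_det; congr (\det _); apply/matrixP => i' j'; rewrite !mxE.
have -> : cofactor G k l = \adj G l k by rewrite mxE.
by rewrite adjQ mxE -[in LHS]QT [Q^T l k]mxE.
Qed.

(** The classical div e_i = e_i(log sqrt det g). Exchanging [e i] and [e l] in the covariant
    derivative costs a bracket, zero at [x], and a torsion term whose trace is g(J e_i, T) = 0;
    metric compatibility then produces the derivative of the Gram matrix. *)
Lemma div_local_frame i : 2 * (\det gram) x * (div st (e i)) x = (e i (\det gram) : A) x.
Proof.
rewrite gram_det_derive.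
pose nb := st_nab st.
have Bl Z : alinear (g (nb Z (e i))) by exact: gr.
have Br Z : alinear (fun Y => g (nb Y (e i)) Z).
  by move=> f X Y; rewrite /nb st_nab_lin stg_lin.
have dE : (div st (e i)) x = \sum_k \sum_l Q k l * g (nb (e l) (e i)) (e k) x.
  exact: (trace_box (B := fun X Y => g (nb Y (e i)) X)).
have zT : \sum_k \sum_l Q k l * (g (stJ st (e i)) (e l) * g (stT st) (e k)) x = 0.
  rewrite -(trace_box (B := fun X Y => g (stJ st (e i)) Y * g (stT st) X)).
  - have -> : \sum_a g (stJ st (e i)) (stF st a) * g (stT st) (stE st a) = g (stJ st (e i)) (stT st).
      rewrite [in RHS](st_frame2 st (stT st)) (alinear_sum _ _ (gr _)).
      by apply: eq_bigr => a _; rewrite mulrC.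
    by rewrite stJ_skew stJT g0r oppr0.
  - by move=> Z f X Y; rewrite gr; ring.
  - by move=> Z f X Y; rewrite gr; ring.
have key k l : g (nb (e l) (e i)) (e k) x = g (nb (e i) (e l)) (e k) x -
    (g (stJ st (e i)) (e l) * g (stT st) (e k)) x.
  have tor : nb (e l) (e i) = nb (e i) (e l) - vbracket (e i) (e l) - g (stJ st (e i)) (e l) *: stT st.
    by rewrite (st_torsion st) /nb !opprD !opprK; rewrite addrA addrA subrr add0r addrK.
  rewrite tor !gDl !gNl gZl [LHS]cinfB [X in X - _ = _]cinfB.
  suff -> : g (vbracket (e i) (e l)) (e k) x = 0 by rewrite subr0.
  rewrite (@tensorial _ _ _ Mcompact _ _ 0 x (gl (e k))) ?g0l //.
have dE2 : (div st (e i)) x = \sum_k \sum_l Q k l * g (nb (e i) (e l)) (e k) x.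
  rewrite dE -[RHS]subr0 -[X in _ = _ - X]zT -sumrB; apply: eq_bigr => k _.
  by rewrite -sumrB; apply: eq_bigr => l _; rewrite key mulrBr.
have dE3 : (div st (e i)) x = \sum_k \sum_l Q k l * g (nb (e i) (e k)) (e l) x.
  rewrite dE2 exchange_big; apply: eq_bigr => k _; apply: eq_bigr => l _.
  by rewrite -{1}QT mxE.
have -> : \sum_k \sum_l Q k l * (e i (g (e k) (e l)) : A) x = (div st (e i)) x + (div st (e i)) x.
  rewrite {1}dE3 dE2 -big_split; apply: eq_bigr => k _ /=.
  rewrite -big_split; apply: eq_bigr => l _ /=.
  by rewrite st_nab_metric cinfD mulrDr /nb (stgC st (e k)).
by ring.
Qed.

End At.
End LocalDivergence.

(** * Positivity of the integral and the divergence theorem *)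

Section RiemannianIntegral.
Variables (R : realType) (n : nat) (M : smoothManifold R (2 * n).+1).
Variable S : sasakian M.
Variable st : structure M n.
Hypothesis stgE : forall X Y, stg st X Y = metric S X Y.
Hypothesis Mcompact : compact [set: M].
Variable integral : (M -> R) -> R.
Hypothesis integralP : is_riemannian_integral S integral.
Local Notation A := (Cinf M).
Local Notation V := (vfield M).
Local Notation m := (2 * n).+1.
Implicit Types (f u : A) (X : V) (x : M).

Let gpos X x : (exists f, (X f : A) x != 0) -> 0 < stg st X X x.
Proof. by move=> h; rewrite stgE; exact: metric_pos. Qed.

Lemma integral_lin (a : R) f u : integral (a *: f + u : A) = a * integral f + integral u.
Proof. by have [h _] := integralP; exact: h. Qed.

Lemma integralD f u : integral (f + u : A) = integral f + integral u.
Proof. by rewrite -[f in LHS]scale1r integral_lin mul1r. Qed.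

Lemma integral0 : integral (0 : A) = 0.
Proof. by apply: (addrI (integral (0 : A))); rewrite -integralD !addr0. Qed.

Lemma integralZ (a : R) f : integral (a *: f : A) = a * integral f.
Proof. by rewrite -[_ *: f]addr0 integral_lin integral0 addr0. Qed.

Lemma integral_sum (I : Type) (r : seq I) (P : pred I) (F : I -> A) :
  integral (\sum_(i <- r | P i) F i : A) = \sum_(i <- r | P i) integral (F i).
Proof.
by apply: (big_morph (fun f : A => integral f)) => [f u|]; [exact: integralD|exact: integral0].
Qed.

Section Box.
Variable b : box M.
Hypothesis bb : is_box b.
Local Notation c := (bchart b).
Local Notation q := (bcenter b).
Local Notation r := (bradius b).

Definition gram_det : A := \det (gram st (box_field b)).

Lemma box_gram_det_gt0 x : box_bump b x != 0 -> 0 < gram_det x.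
Proof.
move=> bx; apply: (gram_det_gt0 gpos (h := box_coord b)).
by move=> P X; exact: local_expansion.
Qed.

(** [coord_field] is picked pointwise by [xget]; on the core [box_field b i] has its defining
    property, and the metric sees only the values of fields at [x]. *)
Lemma density_core x : box_core b x -> riemannian_density S c x = Num.sqrt (gram_det x).
Proof.
move=> cx; rewrite /riemannian_density /gram_det cinf_det; congr (Num.sqrt (\det _)).
have isF i : is_coord_field c x i (box_field b i).
  by move=> f; exact: box_field_core.
have val i f : (coord_field c x i f : A) x = (box_field b i f : A) x.
  by rewrite [RHS]isF; exact: (xgetPex 0 (ex_intro _ _ (isF i))).
apply/matrixP => i j; rewrite !mxE stgE.
rewrite (@tensorial _ _ _ Mcompact (metric S ^~ _) _ _ x _ (val i)); last first.
  by move=> f X Y; exact: metric_lin.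
by apply: tensorial => // f X Y; rewrite metricC metric_lin ![metric S _ (box_field b i)]metricC.
Qed.

Definition local_density f : 'rV[R]_m -> R :=
  (fun y => f (chart_inv c y) * Num.sqrt (gram_det (chart_inv c y))) \_ (chart_cod c).

Lemma local_density_off f s y : (forall x, f x != 0 -> oball q s (chart_map c x)) ->
  ~ oball q s y -> local_density f y = 0.
Proof.
move=> fs ny; rewrite /local_density patchE; case: ifPn => // /set_mem cy.
have [->|/fs] := eqVneq (f (chart_inv c y)) 0; first by rewrite mul0r.
by have [_ ->] := chart_invK cy.
Qed.

Section Local.
Variable f : A.
Hypothesis fsupp : forall x, f x != 0 -> box_bump b x != 0.

Lemma local_density0 y : ~ oball q r y -> local_density f y = 0.
Proof.
by apply: local_density_off => x /fsupp bx; have [] := box_bump_dist bb bx.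
Qed.

Lemma local_density_near y : chart_cod c y -> \forall z \near y,
  f (chart_inv c z) * Num.sqrt (gram_det (chart_inv c z)) = local_density f z.
Proof.
move=> cy; have oc : open (chart_cod c) by exact: chart_cod_open.
have := open_nbhs_nbhs (conj oc cy).
by apply: filterS => z cz; rewrite /local_density patchE mem_set.
Qed.

Lemma local_density_csupp : csupp (`|q| + r) (local_density f).
Proof.
split=> [y|y hy]; last first.
  apply: local_density0 => yq; move: hy; rewrite ltNge => /negP; apply.
  rewrite -[y](subrK q) (le_trans (ler_normD _ _)) // addrC lerD2l.
  exact: ltW.
have [cy|ncy] := pselect (chart_cod c y).
  have e := local_density_near cy.
  rewrite /continuous_at -(nbhs_singleton e).
  apply: cvg_trans (near_eq_cvg e) _.
  have cf := smooth_on_continuous (smooth_repr f (box_atlas bb)) cy.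
  have cg := smooth_on_continuous (smooth_repr gram_det (box_atlas bb)) cy.
  apply: cvgM; first exact: cf.
  exact: (continuous_comp cg (@sqrt_continuous R _)).
have oC : open (~` cball q r) by apply: closed_openC; exact: cball_closed.
have nC : (~` cball q r) y.
  move=> hy; apply: ncy; apply: (box_sub bb _ hy).
  by have := box_radius_gt0 bb; lra.
rewrite /continuous_at (local_density0 (y := y)); last by move=> /ltW.
have e : {near y, cst 0 =1 local_density f}.
  have := open_nbhs_nbhs (conj oC nC); apply: filterS => z nz.
  by rewrite local_density0 // => /ltW.
exact: cvg_trans (near_eq_cvg e) (cvg_cst _).
Qed.

(** The support lies in the image of a closed ball, which is compact and hence closed, so the
    closure of the support stays in the chart, as [is_riemannian_integral] asks. *)
Lemma integral_local : integral f = iterated_integral (local_density f).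
Proof.
have [_ h] := integralP; rewrite (h c f (box_atlas bb)); last first.
  have cl : closed (chart_inv c @` cball q r).
    apply: chart_image_closed; first exact: cball_compact.
    by apply: (box_sub bb); have := box_radius_gt0 bb; lra.
  apply: (@subset_trans _ (chart_inv c @` cball q r)).
    rewrite [X in _ `<=` X](closure_id _).1 //; apply: closure_subset => x /fsupp bx.
    have [dx hx] := box_bump_dist bb bx.
    by exists (chart_map c x); [exact: ltW|exact: chart_mapK].
  move=> _ [y hy <-]; have cy : chart_cod c y.
    by apply: (box_sub bb _ hy); have := box_radius_gt0 bb; lra.
  by have [] := chart_invK cy.
congr iterated_integral; apply/funext => y; rewrite /local_density !patchE.
case: ifPn => // /set_mem cy.
have [->|/fsupp bx] := eqVneq (f (chart_inv c y)) 0; first by rewrite !mul0r.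
by rewrite density_core //; exact: box_bump_core.
Qed.

Let rad0 : 0 < `|q| + r. Proof. by rewrite ltr_wpDl // (box_radius_gt0 bb). Qed.

Lemma integral_local_ge0 : (forall x, 0 <= f x) -> 0 <= integral f.
Proof.
move=> f0; rewrite integral_local; apply: iterated_ge0 => y.
by rewrite /local_density patchE; case: ifP => // _; rewrite mulr_ge0 // sqrtr_ge0.
Qed.

Lemma integral_local_eq0 : (forall x, 0 <= f x) -> integral f = 0 -> f = 0.
Proof.
move=> f0; rewrite integral_local => h.
have d0 y : 0 <= local_density f y.
  by rewrite /local_density patchE; case: ifP => // _; rewrite mulr_ge0 // sqrtr_ge0.
have z := iterated_eq0 rad0 local_density_csupp d0 h.
apply: cinf_ext => x; rewrite cinf0; apply/eqP/negPn/negP => fx.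
have bx := fsupp fx; have [dx hx] := box_bump_dist bb bx.
have := z (chart_map c x); rewrite /local_density patchE mem_set; last exact: oball_cod.
rewrite (chart_mapK dx) => /eqP; rewrite mulf_eq0 (negbTE fx) /=.
by rewrite sqrtr_eq0 leNgt box_gram_det_gt0.
Qed.

End Local.
End Box.

(** The bump is squared so that the divergence of a field cut off by a weight still contains the
    bump as a factor. *)
Lemma half_cover : exists N (b : 'I_N -> box M), (forall i, is_box (b i)) /\
  exists w : 'I_N -> A, (forall i x, 0 <= w i x) /\ \sum_i w i = 1 /\
    forall i, exists v : A, w i = v * box_bump (half_box (b i)) ^+ 2.
Proof.
have [N [b [bb pos]]] := @positive_cover _ _ _ Mcompact (@is_box _ _ M)
  (fun b => box_bump (half_box b) ^+ 2)
  (fun b _ x => sqr_ge0 (box_bump (half_box b) x))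
  (fun x => let: ex_intro b (conj bb bx) := box_around_half x in
            ex_intro _ b (conj bb (exprn_gt0 2 bx))).
have nz x : (\sum_i box_bump (half_box (b i)) ^+ 2) x != 0 by rewrite gt_eqF.
exists N, b; split=> //; exists (fun i => inverse (\sum_i box_bump (half_box (b i)) ^+ 2) *
   box_bump (half_box (b i)) ^+ 2); split; last split.
- move=> i x; rewrite cinfM inverseE //; apply: mulr_ge0; first by rewrite invr_ge0 ltW.
  exact: (sqr_ge0 (box_bump (half_box (b i)) x)).
- by rewrite -mulr_sumr mulrC cinf_mulV.
- by move=> i; eexists.
Qed.

Lemma integral_ge0 f : (forall x, 0 <= f x) -> 0 <= integral f.
Proof.
move=> f0; have [N [b [bb [w [w0 [w1 wv]]]]]] := half_cover.
rewrite -[f]mul1r -w1 mulr_suml integral_sum; apply: sumr_ge0 => i _.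
apply: (integral_local_ge0 (bb i)) => x; last by rewrite cinfM mulr_ge0.
have [v ->] := wv i; rewrite expr2 !cinfM => h; apply: half_box_bump => //.
by apply: contraNneq h => ->; rewrite !mulr0 mul0r.
Qed.

Lemma integral_eq0 f : (forall x, 0 <= f x) -> integral f = 0 -> f = 0.
Proof.
move=> f0 h; have [N [b [bb [w [w0 [w1 wv]]]]]] := half_cover.
have supp i x : (w i * f) x != 0 -> box_bump (b i) x != 0.
  have [v ->] := wv i; rewrite expr2 !cinfM => z; apply: half_box_bump => //.
  by apply: contraNneq z => ->; rewrite !mulr0 mul0r.
have wf0 i x : 0 <= (w i * f) x by rewrite cinfM mulr_ge0.
move: h; rewrite -[f]mul1r -w1 mulr_suml integral_sum => /eqP.
rewrite psumr_eq0 => [/allP z|i _]; last exact: (integral_local_ge0 (bb i) (supp i)).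
apply: big1 => i _; apply: (integral_local_eq0 (bb i) (supp i)) => //.
by apply/eqP; exact: z (mem_index_enum _).
Qed.

Section Stokes.
Variables (b : box M) (v : A) (i : 'I_m).
Hypothesis bb : is_box b.
Local Notation c := (bchart b).
Local Notation q := (bcenter b).
Local Notation r := (bradius b).
Local Notation e := (box_field b).

Let B := box_bump (half_box b).
Let u : A := v * B ^+ 2.
Let f : A := div st (u *: e i).
Let rho y := Num.sqrt (gram_det b (chart_inv c y)).

Let fB : exists k : A, f = B * k.
Proof.
exists (v * B * div st (e i) + (e i v : A) * B + v * (2 * (e i B : A))).
by rewrite /f divZ /u expr2 !vfM; ring.
Qed.

Let half_dist x : B x != 0 -> oball q (r / 2) (chart_map c x).
Proof. by move=> /(box_bump_dist (half_box_is_box bb))[]. Qed.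

Let f_half x : f x != 0 -> B x != 0.
Proof. by have [k ->] := fB; rewrite cinfM => h; apply: contraNneq h => ->; rewrite mul0r. Qed.

Let u_half x : u x != 0 -> B x != 0.
Proof.
by rewrite /u expr2 !cinfM => h; apply: contraNneq h => ->; rewrite mul0r mulr0.
Qed.

Let f_supp x : f x != 0 -> box_bump b x != 0.
Proof. by move/f_half/half_box_bump; exact. Qed.

Let u_supp x : u x != 0 -> box_bump b x != 0.
Proof. by move/u_half/half_box_bump; exact. Qed.

Let D := oball q r.
Let oD : open D. Proof. exact: oball_open. Qed.

Let smooth_D (w : A) : smooth_on D (fun y => w (chart_inv c y)).
Proof. exact: smooth_onW (oball_cod bb) (smooth_repr w (box_atlas bb)). Qed.

Let gram_pos y : D y -> 0 < gram_det b (chart_inv c y).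
Proof. by move=> hy; apply: box_gram_det_gt0 => //; exact: oball_bump. Qed.

Let smooth_rho : smooth_on D rho.
Proof. exact: smooth_on_sqrt oD gram_pos (smooth_D _). Qed.

Let densityE w y : D y -> local_density b w y = w (chart_inv c y) * rho y.
Proof. by move=> hy; rewrite /local_density patchE mem_set //; exact: oball_cod. Qed.

Let smooth_u : smooth_on D (local_density b u).
Proof.
apply: (smooth_on_ext oD _ (smooth_onM oD (smooth_D u) smooth_rho)) => y hy.
by rewrite densityE.
Qed.

(** The Gram determinant is [rho ^+ 2], so [div_local_frame] makes the partial of [rho] equal to
    [rho] times the divergence of [e i]; the product rule does the rest. *)
Let derive_u y : D y -> 'D_(delta_mx 0 i) (local_density b u) y = local_density b f y.
Proof.
move=> hy; have du : derivable (fun y => u (chart_inv c y)) y (delta_mx 0 i).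
  exact: smooth_on_derivable (smooth_D u) hy.
have dr : derivable rho y (delta_mx 0 i) by exact: smooth_on_derivable smooth_rho hy.
rewrite (eq_derivable (g := (fun y => u (chart_inv c y)) * rho) _ oD hy _).2; last first.
  by move=> z hz; rewrite densityE.
rewrite deriveM // -(box_field_repr bb) // densityE //.
have bx := oball_bump bb hy.
have g0 := gram_pos hy.
have r0 : rho y != 0 by rewrite gt_eqF // sqrtr_gt0.
have := @div_local_frame _ _ _ _ st Mcompact (box_field b) (box_coord b) (chart_inv c y)
  (fun P X Pl => local_expansion Mcompact bb bx X Pl) (fun j k => box_field_coord bb bx j k)
  (fun j k w => box_field_commute bb j k w bx) i.
rewrite -/(gram_det b) (box_field_repr bb) //.
rewrite (eq_derivable (g := rho * rho) _ oD hy _).2; last first.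
  by move=> z hz; rewrite /rho -[in LHS](sqr_sqrtr (ltW (gram_pos hz))) expr2.
rewrite deriveM // -[gram_det b _](sqr_sqrtr (ltW g0)) -/(rho y) => h.
have {h} h : 'D_(delta_mx 0 i) rho y = rho y * (div st (e i)) (chart_inv c y).
  apply: (mulfI r0); apply: (mulfI (_ : 2 != 0 :> R)); first by rewrite pnatr_eq0.
  rewrite [RHS](_ : _ = 2 * rho y ^+ 2 * div st (e i) (chart_inv c y)); last by ring.
  rewrite h; rewrite /GRing.scale /=; ring.
rewrite h /f divZ cinfD cinfM /GRing.scale /=; ring.
Qed.

Let csupp_bounded (F : 'rV[R]_m -> R) K : csupp K F -> exists2 C : R, 0 <= C & forall y, `|F y| <= C.
Proof.
move=> [cF F0]; have [y _|C C0 hC] := compact_bounded_abs (f := F) (@cball_compact _ _ 0 K).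
  exact: cF.
exists C => // y; have [yK|/F0 ->] := lerP `|y| K; last by rewrite normr0.
by apply: hC; rewrite /cball /= subr0.
Qed.

(** [iterated_derive] wants a Taylor bound for all points and steps, while [C2_taylor] provides one
    on a closed ball inside the box; the collar bridges the gap. *)
Lemma integral_div_box : integral f = 0.
Proof.
have r0 := box_radius_gt0 bb.
have cu := local_density_csupp bb u_supp; have cf := local_density_csupp bb f_supp.
rewrite (integral_local bb f_supp).
have [K1 K10 hK1] := csupp_bounded cu; have [K2 K20 hK2] := csupp_bounded cf.
have sub : cball q (3 / 4 * r) `<=` D.
  by move=> y hy; rewrite /D /oball /cball /= in hy *; apply: (le_lt_trans hy); lra.
have [C C0 hC] := C2_taylor oD sub i smooth_u.
(* Both functions vanish beyond r/2. Steps of length at least r/8 are met by crude bounds; a shorter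
   step starting within 5/8 r stays within 3/4 r, and one starting outside 5/8 r stays outside
   r/2. *)
pose d := r / 8; have d0 : 0 < d by rewrite /d; lra.
have norm_e (t : R) : `|t *: delta_mx 0 i : 'rV[R]_m| <= `|t|.
  rewrite norm_row_le //; apply/forallP => j; rewrite !mxE eqxx /= normrM.
  by case: (j == i); rewrite ?normr1 ?mulr1 // normr0 mulr0.
have off (w : A) y : (forall x, w x != 0 -> B x != 0) -> r / 2 < `|y - q| -> local_density b w y = 0.
  move=> wB hy; apply: (@local_density_off _ _ (r / 2)) => [x /wB|]; first exact: half_dist.
  by rewrite /oball /= ltNge (ltW hy).
apply: (@iterated_derive _ _ (`|q| + r) (C + (2 * K1 / d ^+ 2 + K2 / d))
  (local_density b u) _ i) => //; first by rewrite ltr_wpDl.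
move=> y t; set y' := y + _.
have dist : `|y' - y| <= `|t| by rewrite /y' addrC addKr; exact: norm_e.
have rest : 0 <= 2 * K1 / d ^+ 2 + K2 / d.
  by rewrite addr_ge0 // divr_ge0 ?exprn_ge0 ?mulr_ge0 // ltW.
have [td|td] := lerP d `|t|.
  have t2 : d ^+ 2 <= t ^+ 2 by rewrite -[t ^+ 2]real_normK ?num_real // lerXn2r // nnegrE ltW.
  have h1 : `|local_density b u y' - local_density b u y - t * local_density b f y| <=
      K1 + K1 + `|t| * K2.
    apply: (le_trans (ler_normB _ _)); rewrite normrM; apply: lerD; last by rewrite ler_wpM2l.
    by apply: (le_trans (ler_normB _ _)); apply: lerD.
  apply: (le_trans h1); rewrite mulrDl.
  apply: ler_wpDl; first by rewrite mulr_ge0 ?sqr_ge0.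
  rewrite mulrDl; apply: lerD.
    have -> : K1 + K1 = 2 * K1 / d ^+ 2 * d ^+ 2 by field; rewrite gt_eqF.
    by rewrite ler_wpM2l // divr_ge0 ?exprn_ge0 ?mulr_ge0 // ltW.
  rewrite -[t ^+ 2]real_normK ?num_real // expr2 mulrA [K2 / d * _]mulrAC.
  have -> : `|t| * K2 = K2 * `|t| / d * d by field; rewrite gt_eqF.
  by rewrite ler_wpM2l // divr_ge0 ?mulr_ge0 // ltW.
have [yq|yq] := lerP `|y - q| (5 / 8 * r).
  have cy : cball q (3 / 4 * r) y by rewrite /cball /=; lra.
  have cy' : cball q (3 / 4 * r) y'.
    rewrite /cball /=; apply: (le_trans (ler_distD y _ _)).
    by rewrite /d in td; lra.
  rewrite -(derive_u (sub _ cy)); apply: (le_trans (hC y t cy cy')).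
  by rewrite ler_wpM2r ?sqr_ge0 // lerDl.
rewrite (off u y u_half) ?(off f y f_half) ?(off u y' u_half); try lra.
  by rewrite mulr0 !subr0 normr0 mulr_ge0 ?sqr_ge0 // addr_ge0.
have := ler_distD y' y q; rewrite [`|y - y'|]distrC; rewrite /d in td; lra.
Qed.

End Stokes.

(** The weights split the field into multiples of box fields whose coefficients carry the squared
    bump that [integral_div_box] expects. *)
Lemma integral_div X : integral (div st X) = 0.
Proof.
have [N [b [bb [w [w0 [w1 wv]]]]]] := half_cover.
have XE : X = \sum_i \sum_j (w i * (X (box_coord (b i) j) : A)) *: box_field (b i) j.
  apply: vfield_ext => f; rewrite -[X in LHS](scale1r X) -w1 scaler_suml !vfield_sum.
  apply: eq_bigr => i _; rewrite vfield_sum; apply: cinf_ext => x.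
  rewrite vfieldZ [LHS]cinfM cinf_sum.
  have [z|wx] := eqVneq (w i x) 0.
    by rewrite z mul0r big1 // => j _; rewrite vfieldZ !cinfM z !mul0r.
  have bx : box_bump (b i) x != 0.
    apply: half_box_bump => //; apply: contraNneq wx => z.
    by have [v ->] := wv i; rewrite expr2 !cinfM z !mulr0.
  rewrite (vf_expansion (bb i) _ _ bx) mulr_sumr; apply: eq_bigr => j _.
  by rewrite vfieldZ !cinfM mulrA.
rewrite XE div_sum integral_sum big1 // => i _.
rewrite div_sum integral_sum big1 // => j _.
have [v ->] := wv i; rewrite [v * _ * _]mulrAC.
exact: integral_div_box.
Qed.

End RiemannianIntegral.

(** * Vanishing from the Kaehler identities *)

Section Hodge.
Variables (R : realFieldType) (U : lmodType R) (dot : U -> U -> R).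
Hypothesis dotC : forall u v, dot u v = dot v u.
Hypothesis dot_lin : forall c u v w, dot (c *: u + v) w = c * dot u w + dot v w.
Hypothesis dot_ge0 : forall u, 0 <= dot u u.
Hypothesis dot_eq0 : forall u, dot u u = 0 -> u = 0.
Implicit Types (u v w : U) (P Q : U -> U).

Lemma dotDl u v w : dot (u + v) w = dot u w + dot v w.
Proof. by rewrite -[u in LHS]scale1r dot_lin mul1r. Qed.
Lemma dot0l w : dot 0 w = 0. Proof. by apply: (addrI (dot 0 w)); rewrite -dotDl !addr0. Qed.
Lemma dotZl c u w : dot (c *: u) w = c * dot u w.
Proof. by rewrite -[c *: u]addr0 dot_lin dot0l addr0. Qed.
Lemma dotNl u w : dot (- u) w = - dot u w. Proof. by rewrite -scaleN1r dotZl mulN1r. Qed.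
Lemma dotBl u v w : dot (u - v) w = dot u w - dot v w. Proof. by rewrite dotDl dotNl. Qed.
Lemma dotDr u v w : dot w (u + v) = dot w u + dot w v.
Proof. by rewrite dotC dotDl ![dot _ w]dotC. Qed.
Lemma dotNr u w : dot w (- u) = - dot w u. Proof. by rewrite dotC dotNl dotC. Qed.
Lemma dotBr u v w : dot w (u - v) = dot w u - dot w v. Proof. by rewrite dotDr dotNr. Qed.
Lemma dotZr c u w : dot w (c *: u) = c * dot w u. Proof. by rewrite dotC dotZl dotC. Qed.
Lemma dot0r w : dot w 0 = 0. Proof. by rewrite dotC dot0l. Qed.
Lemma dot_suml (I : Type) (r : seq I) (p : pred I) (F : I -> U) w :
  dot (\sum_(i <- r | p i) F i) w = \sum_(i <- r | p i) dot (F i) w.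
Proof. by apply: (big_morph (dot^~ w)) => [u v|]; [exact: dotDl|exact: dot0l]. Qed.
Lemma dot_sumr (I : Type) (r : seq I) (p : pred I) (F : I -> U) w :
  dot w (\sum_(i <- r | p i) F i) = \sum_(i <- r | p i) dot w (F i).
Proof. by rewrite dotC dot_suml; apply: eq_bigr => i _; rewrite dotC. Qed.

Lemma dot_quadratic c u v w z :
  dot (u + c *: v + c ^+ 2 *: w) z = dot u z + c * dot v z + c ^+ 2 * dot w z.
Proof. by rewrite !dotDl !dotZl. Qed.

Lemma dot_nondeg u v : (forall w, dot w u = dot w v) -> u = v.
Proof. by move=> h; apply/subr0_eq/dot_eq0; rewrite dotBr h subrr. Qed.

Definition operator P := forall (c : R) u v, P (c *: u + v) = c *: P u + P v.

Lemma opD P : operator P -> forall u v, P (u + v) = P u + P v.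
Proof. by move=> lP u v; rewrite -[u in LHS]scale1r lP scale1r. Qed.
Lemma op0 P : operator P -> P 0 = 0.
Proof. by move=> lP; apply: (addrI (P 0)); rewrite -opD // !addr0. Qed.
Lemma opN P : operator P -> forall u, P (- u) = - P u.
Proof. by move=> lP u; apply: (addrI (P u)); rewrite -opD // !subrr op0. Qed.
Lemma opB P : operator P -> forall u v, P (u - v) = P u - P v.
Proof. by move=> lP u v; rewrite opD // opN. Qed.
Lemma opZ P : operator P -> forall c u, P (c *: u) = c *: P u.
Proof. by move=> lP c u; rewrite -[c *: u]addr0 lP op0 // addr0. Qed.
Lemma op_sum P (I : Type) (r : seq I) (p : pred I) (F : I -> U) : operator P ->
  P (\sum_(i <- r | p i) F i) = \sum_(i <- r | p i) P (F i).
Proof. by move=> lP; apply: (big_morph P) => [u v|]; [exact: opD|exact: op0]. Qed.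

(** The commutator of L and Lam is kept out, since its value depends on the degree; the list is then
    stable under the exchange of L with Lam and D with Ds. *)
Record kaehler_identities (L Lam D Ds t j : U -> U) : Prop := KaehlerIdentities {
  opL : operator L; opLam : operator Lam; opD_ : operator D; opDs : operator Ds;
  opt : operator t; opj : operator j;
  adjointL : forall u v, dot (L u) v = dot u (Lam v);
  adjointD : forall u v, dot (D u) v = dot u (Ds v);
  skewt : forall u v, dot (t u) v = - dot u (t v);
  skewj : forall u v, dot (j u) v = - dot u (j v);
  kaehlerDD : forall u, D (D u) = - L (t u);
  kaehlerDL : forall u, D (L u) = L (D u);
  kaehlerDsL : forall u, Ds (L u) - L (Ds u) = D (j u) - j (D u);
  kaehlerDjj : forall u, (D (j (j u)) - j (D (j u))) - j (D (j u) - j (D u)) = - D u;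
  kaehlertL : forall u, t (L u) = L (t u);
  kaehlertD : forall u, t (D u) = D (t u);
  kaehlertj : forall u, t (j u) = j (t u);
  kaehlerjL : forall u, j (L u) = L (j u)
}.

Section Vanishing.
Variables L Lam D Ds t j : U -> U.
Hypothesis K : kaehler_identities L Lam D Ds t j.

Let lL := opL K.
Let lLam := opLam K.
Let lD := opD_ K.
Let lDs := opDs K.
Let lt := opt K.
Let lj := opj K.
Let adjL := adjointL K.
Let adjD := adjointD K.
Let adjt := skewt K.
Let adjj := skewj K.
Let DD := kaehlerDD K.
Let DL := kaehlerDL K.
Let DsL := kaehlerDsL K.
Let Djj := kaehlerDjj K.
Let tL := kaehlertL K.
Let tD := kaehlertD K.
Let tj := kaehlertj K.
Let jL := kaehlerjL K.

Let adjDs u v : dot u (D v) = dot (Ds u) v. Proof. by rewrite dotC adjD dotC. Qed.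

Let C u := D (j u) - j (D u).
Let Cs u := Ds (j u) - j (Ds u).

Let lC : operator C.
Proof. by move=> c u v; rewrite /C lj !lD lj scalerBr opprD addrACA. Qed.
Let lCs : operator Cs.
Proof. by move=> c u v; rewrite /Cs lj !lDs lj scalerBr opprD addrACA. Qed.

Let adjC u v : dot (C u) v = dot u (Cs v).
Proof. by rewrite /C /Cs dotBl dotBr adjD adjj adjj adjD; ring. Qed.

Let LamD u : Lam (D u) - D (Lam u) = Cs u.
Proof.
apply: dot_nondeg => w; rewrite -adjC /C -DsL dotBr dotBl -adjL [in RHS]adjL.
by rewrite adjDs [in LHS]adjDs -[dot (Ds w) _]adjL.
Qed.

Let DsDs u : Ds (Ds u) = t (Lam u).
Proof.
apply: dot_nondeg => w.
by rewrite -!adjD DD dotNl adjL adjt opprK.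
Qed.

Let tLam u : t (Lam u) = Lam (t u).
Proof.
apply: dot_nondeg => w.
by rewrite -[RHS]adjL -[LHS]opprK -adjt -[in LHS]adjL -tL adjt opprK.
Qed.

Let tDs u : t (Ds u) = Ds (t u).
Proof.
apply: dot_nondeg => w.
by rewrite -[RHS]adjD -[LHS]opprK -adjt -[in LHS]adjD -tD adjt opprK.
Qed.

Let jLam u : j (Lam u) = Lam (j u).
Proof.
apply: dot_nondeg => w.
by rewrite -[RHS]adjL -[LHS]opprK -adjj -[in LHS]adjL -jL adjj opprK.
Qed.

Let Csj u : Cs (j u) - j (Cs u) = - Ds u.
Proof.
apply: dot_nondeg => w.
rewrite dotBr -adjC -[dot w (j _)]opprK -adjj -adjC -[C w]/(D (j w) - j (D w)).
rewrite -[dot (D _ - _) (j u)]opprK opprK -[dot (_ - _) (j u)]opprK -adjj dotNr -adjD.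
have := Djj w; rewrite -/(C w) -/(C (j w)) => h.
by rewrite -dotNl -h dotBl; ring.
Qed.

(** Each identity is the adjoint of one in the list; [t] and [j] are skew, which accounts for their
    signs. *)
Lemma kaehler_dual : kaehler_identities Lam L Ds D (fun u => - t u) (fun u => - j u).
Proof.
split=> //.
- by move=> c u v; rewrite lt opprD scalerN.
- by move=> c u v; rewrite lj opprD scalerN.
- by move=> u v; rewrite dotC -adjL dotC.
- by move=> u v; rewrite dotNl dotNr adjt.
- by move=> u v; rewrite dotNl dotNr adjj.
- by move=> u; rewrite (opN lLam) opprK DsDs tLam.
- by move=> u; apply: dot_nondeg => w; rewrite -adjD -!adjL -adjD DL.
- by move=> u; rewrite -opprB LamD /Cs (opN lDs) opprB opprK addrC.
- move=> u; rewrite !(opN lj, opN lDs, opN lLam) !opprK -[RHS]Csj /Cs.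
  by rewrite (opB lj) (opD lj) (opN lj) !opprD !opprK [- j _ + _]addrC.
- by move=> u; rewrite (opN lLam) tLam.
- by move=> u; rewrite (opN lDs) tDs.
- by move=> u; rewrite (opN lt) (opN lj) tj.
- by move=> u; rewrite (opN lLam) jLam.
Qed.

Let CL u : C (L u) = L (C u).
Proof. by rewrite /C jL !DL jL -opB. Qed.

Let LamCs u : Lam (Cs u) = Cs (Lam u).
Proof. by apply: dot_nondeg => w; rewrite -adjL -adjC CL adjL adjC. Qed.

Let CD u : C (D u) = - D (C u).
Proof.
rewrite /C DD (opN lj) jL (opB lD) DD tj.
by rewrite opprB.
Qed.

Let LamC u : Lam (C u) - C (Lam u) = - Ds u.
Proof.
have e1 : Lam (D (j u)) = D (Lam (j u)) + Cs (j u) by rewrite -LamD addrC subrK.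
have e2 : Lam (D u) = D (Lam u) + Cs u by rewrite -LamD addrC subrK.
rewrite -Csj /C opB // e1 -[Lam (j (D u))]jLam e2 opD // jLam.
by apply: dot_nondeg => w; rewrite !(dotDr, dotNr); ring.
Qed.

(** Neither D nor C squares to 0. What is used is Ds = [C, Lam], Cs = [Lam, D] and that C and D
    anticommute: both sides then expand into the same four products. *)
Let box u : D (Ds u) + Ds (D u) = C (Cs u) + Cs (C u).
Proof.
have e v : Ds v = C (Lam v) - Lam (C v) by rewrite -opprB LamC opprK.
have f v : Cs v = Lam (D v) - D (Lam v) by rewrite LamD.
rewrite (e u) (e (D u)) (f u) (f (C u)) (opB lC) !CD (opN lLam) (opB lD).
by apply: dot_nondeg => w; rewrite !(dotDr, dotNr); ring.
Qed.

Let box_norm u : dot (Ds u) (Ds u) + dot (D u) (D u) = dot (Cs u) (Cs u) + dot (C u) (C u).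
Proof.
rewrite -adjDs [dot (D u) _]adjD -dotDr box dotDr -[dot u (C _)]dotC adjC.
by rewrite [dot u (Cs _)](esym (adjC _ _)).
Qed.

(** The constants are values of n minus the degree: [c] for [a] and [t a], [c + 1] for [b], one
    degree lower, and [c + 3] for [Lam b]. With the dual identities signs and degrees are reversed,
    and [c] is k - 1 - n. *)
Lemma kaehler_vanishing (a b : U) (c : R) : 0 <= c ->
  Lam a = 0 -> Ds a = 0 -> D a = L b ->
  Lam (L b) - L (Lam b) = (c + 1) *: b ->
  Lam (L (Lam b)) - L (Lam (Lam b)) = (c + 3) *: Lam b ->
  Lam (L (t a)) - L (Lam (t a)) = c *: t a ->
  (c = 0 -> t a + D b = 0) ->
  D a = 0 /\ t a = 0.
Proof.
move=> c0 La Dsa Da Hb HLb Hta h0.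
have Csa : Cs a = Lam (L b) by rewrite -LamD La op0 // subr0 Da.
have LLb : Lam (Lam (L b)) = 0 by rewrite -Csa LamCs La op0.
have Lb0 : Lam b = 0.
  have e1 : Lam (L b) = (c + 1) *: b + L (Lam b) by rewrite -Hb subrK.
  have e2 : Lam (L (Lam b)) = (c + 3) *: Lam b + L (Lam (Lam b)) by rewrite -HLb subrK.
  (* Moving [L] to the left through both [Lam], the left side becomes (2 c + 4) |Lam b|^2 + |Lam
     (Lam b)|^2. *)
  have : dot (Lam (Lam (L b))) (Lam b) = 0 by rewrite LLb dot0l.
  rewrite e1 opD // opZ // e2 !dotDl !dotZl adjL => e3.
  have p1 := dot_ge0 (Lam b); have p2 := dot_ge0 (Lam (Lam b)).
  by apply: dot_eq0; nra.
have Csab : Cs a = (c + 1) *: b by rewrite Csa -Hb Lb0 op0 // subr0.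
have nD : dot (D a) (D a) = (c + 1) * dot b b.
  by rewrite {1}Da adjL -[Lam (D a)](subrK (D (Lam a))) LamD La op0 // addr0 Csab dotZr.
have := box_norm a; rewrite Dsa dot0l add0r nD Csab dotZl dotZr => nb.
have pb := dot_ge0 b; have pC := dot_ge0 (C a).
have [cz|cn] := eqVneq c 0; last first.
  have cp : 0 < c by rewrite lt_def cn.
  have b0 : b = 0 by apply: dot_eq0; nra.
  have Da0 : D a = 0 by rewrite Da b0 op0.
  split=> //; have Lta : L (t a) = 0 by rewrite -[L _]opprK -DD Da0 op0 // oppr0.
  have : c *: t a = 0 by rewrite -Hta Lta -tLam La !(op0 lLam, op0 lL, op0 lt) subrr.
  by move/eqP; rewrite scaler_eq0 (negbTE cn) => /eqP.
have {h0} h := h0 cz.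
have ta : t a = 0.
  apply: dot_eq0; have -> : dot (t a) (t a) = - dot (D b) (t a).
    by rewrite -dotNl; congr (dot _ _); apply/eqP; rewrite -addr_eq0 h.
  by rewrite adjD -tDs Dsa op0 // dot0r oppr0.
have Db : D b = 0 by move: h; rewrite ta add0r.
have Csb : Cs a = b by rewrite Csab cz add0r scale1r.
(* Here Ds Ds = t Lam, which passes through [j] to reach [Lam a = 0]. With [D b = 0], [box_norm]
   then gives [C b = 0], and |b|^2 = <Cs a, b> = <a, C b>. *)
have Dsb : Ds b = 0.
  rewrite -Csb /Cs Dsa op0 // subr0 DsDs -jLam La !op0 //.
have Cb : C b = 0.
  have := box_norm b; rewrite Dsb Db dot0l addr0 => e.
  by apply: dot_eq0; have := dot_ge0 (Cs b); have := dot_ge0 (C b); lra.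
have b0 : b = 0 by apply: dot_eq0; rewrite -{1}Csb dotC -[LHS]adjC Cb dot0l.
by rewrite Da b0 op0.
Qed.

End Vanishing.

(** * Families polynomial in the parameter and their lowest coefficients *)

Lemma poly_ext_nneg (p q : {poly R}) : (forall s, 0 <= s -> p.[s] = q.[s]) -> p = q.
Proof.
move=> h; apply/eqP; rewrite -subr_eq0; apply/negPn/negP => nz.
set r := [seq (k%:R : R) | k <- seq.iota 0 (size (p - q))].
have ra : all (root (p - q)) r.
  by apply/allP => _ /mapP[k _ ->]; rewrite rootE hornerD hornerN h ?ler0n // subrr.
have ru : uniq r by rewrite map_inj_uniq ?seq.iota_uniq //; exact: mulrIn (oner_neq0 _).
by have := max_poly_roots nz ra ru; rewrite size_map seq.size_iota ltnn.
Qed.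

Definition pairing_poly (v w : nat -> U) (N N' : nat) : {poly R} :=
  \sum_(a < N) \sum_(b < N') dot (v a) (w b) *: 'X^(a + b).

Lemma pairing_polyE (v w : nat -> U) (N N' : nat) (s : R) : (pairing_poly v w N N').[s] =
  dot (\sum_(a < N) s ^+ a *: v a) (\sum_(b < N') s ^+ b *: w b).
Proof.
rewrite /pairing_poly horner_sum dot_suml; apply: eq_bigr => a _.
rewrite horner_sum dot_sumr; apply: eq_bigr => b _.
by rewrite hornerZ hornerXn dotZl dotZr exprD; ring.
Qed.

Lemma coef_pairing (v w : nat -> U) (N N' k : nat) : (pairing_poly v w N N')`_k =
  \sum_(a < N) \sum_(b < N') dot (v a) (w b) *+ (k == a + b)%N.
Proof.
rewrite /pairing_poly coef_sum; apply: eq_bigr => a _.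
rewrite coef_sum; apply: eq_bigr => b _.
by rewrite coefZ coefXn mulr_natr.
Qed.

Lemma coef_pairing_low (v w : nat -> U) (N N' p k : nat) : (forall a, (a < p)%N -> v a = 0) -> (k < p)%N ->
  (pairing_poly v w N N')`_k = 0.
Proof.
move=> v0 kp; rewrite coef_pairing; apply: big1 => a _; apply: big1 => b _.
case: eqP => [e|_]; rewrite ?mulr0n // v0 ?dot0l ?mul0rn //.
by apply: leq_ltn_trans kp; rewrite e leq_addr.
Qed.

Lemma coef_pairing_diag (v : nat -> U) (N r : nat) : (r < N)%N -> (forall a, (a < r)%N -> v a = 0) ->
  (pairing_poly v v N N)`_(r + r) = dot (v r) (v r).
Proof.
move=> rN v0; rewrite coef_pairing (bigD1 (Ordinal rN)) //= [X in _ + X]big1 ?addr0.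
  rewrite (bigD1 (Ordinal rN)) //= eqxx mulr1n big1 ?addr0 // => b br.
  by rewrite eqn_add2l; case: eqP => // e; case/eqP: br; apply: val_inj.
move=> a ar; apply: big1 => b _; case: eqP => [e|_]; rewrite ?mulr0n // mulr1n.
case: (ltngtP a r) => [lt|gt|e2]; first by rewrite v0 // dot0l.
  by rewrite [v b]v0 ?dot0r // -(ltn_add2l r) e ltn_add2r.
by case/eqP: ar; apply: val_inj.
Qed.

(** Strong induction on [r]: once the lower coefficients vanish, s^(2 r) has coefficient |v r|^2 +
    |w r|^2 on the left, while every power below [p] is absent on the right. *)
Lemma energy_vanishing (v w y z : nat -> U) (N K K' p : nat) :
  (forall a, (a < p)%N -> y a = 0) ->
  (forall s, 0 <= s ->
    dot (\sum_(a < N) s ^+ a *: v a) (\sum_(a < N) s ^+ a *: v a) +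
    dot (\sum_(a < N) s ^+ a *: w a) (\sum_(a < N) s ^+ a *: w a) =
    dot (\sum_(a < K) s ^+ a *: y a) (\sum_(a < K') s ^+ a *: z a)) ->
  forall r, (r < N)%N -> (r + r < p)%N -> v r = 0 /\ w r = 0.
Proof.
move=> y0 h.
have E : pairing_poly v v N N + pairing_poly w w N N = pairing_poly y z K K'.
  by apply: poly_ext_nneg => s s0; rewrite hornerD !pairing_polyE h.
elim/ltn_ind => r IH rN rp.
have low a : (a < r)%N -> v a = 0 /\ w a = 0.
  move=> ar; apply: IH => //; first exact: ltn_trans rN.
  by apply: leq_ltn_trans rp; rewrite leq_add // ltnW.
have := congr1 (fun P : {poly R} => P`_(r + r)) E.
rewrite coefD (coef_pairing_low _ _ _ y0 rp).
rewrite !coef_pairing_diag //; try by move=> a /low[].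
move=> /eqP; rewrite paddr_eq0 // => /andP[/eqP/dot_eq0 ? /eqP/dot_eq0 ?].
by split.
Qed.

(** The shift of coefficients induced by multiplication by [s]. *)
Definition pre (u : nat -> U) r := if r is r'.+1 then u r' else 0.

Lemma quadratic_family (P0 P1 P2 : U -> U) (u : nat -> U) q (s : R) :
  operator P0 -> operator P1 -> operator P2 -> (forall r, (q < r)%N -> u r = 0) ->
  let Us := \sum_(i < q.+1) s ^+ i *: u i in
  P0 Us + s *: P1 Us + s ^+ 2 *: P2 Us =
  \sum_(i < q.+3) s ^+ i *: (P0 (u i) + P1 (pre u i) + P2 (pre (pre u) i)).
Proof.
move=> l0 l1 l2 u0 /=.
have famE (P : U -> U) : operator P ->
    P (\sum_(i < q.+1) s ^+ i *: u i) = \sum_(i < q.+1) s ^+ i *: P (u i).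
  by move=> lP; rewrite op_sum //; apply: eq_bigr => i _; rewrite opZ.
under [RHS]eq_bigr do rewrite !scalerDr.
rewrite !big_split /= !famE //; congr (_ + _ + _).
- by rewrite [RHS]big_ord_recr [X in _ = X + _]big_ord_recr /= !u0 // op0 // !scaler0 !addr0.
- rewrite [RHS]big_ord_recr [X in _ = X + _]big_ord_recl /= u0 // op0 // !scaler0 add0r addr0 scaler_sumr.
  by apply: eq_bigr => i _; rewrite scalerA -exprS.
- rewrite [RHS]big_ord_recl [X in _ = _ + X]big_ord_recl /= op0 // !scaler0 !add0r scaler_sumr.
  by apply: eq_bigr => i _; rewrite scalerA -exprD.
Qed.

Lemma quadratic_vanishing (u v w : U) :
  (forall s : R, 0 < s -> u + s *: v + s ^+ 2 *: w = 0) -> [/\ u = 0, v = 0 & w = 0].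
Proof.
move=> h.
have e (z : U) : [/\ dot u z = 0, dot v z = 0 & dot w z = 0].
  have k s : 0 < s -> dot u z + s * dot v z + s ^+ 2 * dot w z = 0.
    by move=> s0; rewrite -dot_quadratic h // dot0l.
  have k1 := k 1 ltr01; have k2 := k 2 (ltr0n _ 2); have k3 := k 3 (ltr0n _ 3).
  by split; lra.
by split; apply: dot_eq0; case: (e u) (e v) (e w) => ? _ _ [_ ? _] [_ _ ?].
Qed.

End Hodge.

(** * The rescaled Laplacian *)

Section FormInner.
Variables (R : realType) (n : nat) (M : smoothManifold R (2 * n).+1).
Hypothesis Mcompact : compact [set: M].
Variable S : sasakian M.
Variable st : structure M n.
Hypothesis stgE : forall X Y, stg st X Y = metric S X Y.
Variable integral : (M -> R) -> R.
Hypothesis integralP : is_riemannian_integral S integral.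
Local Notation A := (Cinf M).
Local Notation V := (vfield M).
Local Notation form := (form M).
Local Notation m := (2 * n).+1.
Local Notation T := (stT st).
Local Notation iT := (iota (stT st)).
Local Notation eT := (eps st (stT st)).
Local Notation L := (lef st).
Local Notation Lam := (lam st).
Local Notation D := (dhor st).
Local Notation Ds := (shor st).
Local Notation t := (tder st).
Local Notation j := (jop st).
Local Notation N := (num st).
Implicit Types (f : A) (X Y : V) (s : seq V) (a b : form) (x : M).

Let gpos X x : (exists f, (X f : A) x != 0) -> 0 < stg st X X x.
Proof. by move=> h; rewrite stgE; exact: metric_pos. Qed.

Let top a s : (m < size s)%N -> a s = 0.
Proof. exact: form_top. Qed.

Section AtPoint.
Variables (x : M) (o : 'I_m -> V).
Hypothesis ho : orthonormal (stg st) x o.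

Lemma dotk_orthonormal k a b :
  dotk st k a b x = \sum_(s : k.-tuple 'I_m) a (map o s) x * b (map o s) x.
Proof.
elim: k a b => [|k IH] a b.
  rewrite dotk0 cinfM (bigD1 [tuple]) //= big1 ?addr0 // => s /negP[].
  by apply/eqP; exact: tuple0.
rewrite dotkS (trace_orthonormal Mcompact (stgC st) (stg_lin st) (st_frame st)
  (B := fun X Y => dotk st k (iota X a) (iota Y b)) ho).
- rewrite sum_tuple_cons; apply: eq_bigr => i _.
  by rewrite IH; apply: eq_bigr => s _.
- by move=> Z f X Y; rewrite iota_linl dotk_linl.
- by move=> Z f X Y; rewrite iota_linl dotk_linr.
Qed.

Lemma fdot_orthonormal a b : fdot st a b x = \sum_(k < m.+1)
  (k`!%:R)^-1 * \sum_(s : k.-tuple 'I_m) a (map o s) x * b (map o s) x.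
Proof.
rewrite /fdot cinf_sum; apply: eq_bigr => k _.
by rewrite cinfZ dotk_orthonormal.
Qed.

Lemma orthonormal_vanish k a : (forall s : k.-tuple 'I_m, a (map o s) x = 0) ->
  forall s, size s = k -> a s x = 0.
Proof.
elim: k a => [|k IH] a h [|X s] //= => [_|[sk]]; first exact: (h [tuple]).
have Pl : alinear (fun X => a (X :: s)) by move=> f Y Z; exact: (form_lin a [::]).
rewrite (parseval Mcompact (stg_lin st) X ho Pl) big1 // => i _.
rewrite -iotaE IH ?mulr0 // => r; rewrite iotaE.
exact: (h [tuple of i :: r]).
Qed.

End AtPoint.

(** [form_dot] takes an orthonormal frame chosen separately at each point; comparison with the
    global dual frames shows that the result is smooth and independent of the choice. *)
Lemma form_dotE a b : form_dot S (form_val a) (form_val b) = fdot st a b :> (M -> R).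
Proof.
apply/funext => x; rewrite /form_dot; set o := xget _ _.
have ho : orthonormal (stg st) x o.
  have [ o' h'] := orthonormal_exists (stgC st) (stg_lin st) gpos x.
  have : is_orthonormal_frame S x o by apply: xgetPex; exists o' => i i'; rewrite -stgE h'.
  by move=> h i i'; rewrite stgE h.
by rewrite (fdot_orthonormal ho).
Qed.

Lemma fdot_ge0 a x : 0 <= fdot st a a x.
Proof.
have [ o ho] := orthonormal_exists (stgC st) (stg_lin st) gpos x.
rewrite (fdot_orthonormal ho); apply: sumr_ge0 => k _.
by rewrite mulr_ge0 ?invr_ge0 ?ler0n //; apply: sumr_ge0 => s _; rewrite -expr2 sqr_ge0.
Qed.

Lemma fdot_eq0 a : fdot st a a = 0 -> a = 0.
Proof.
move=> h; apply: form_ext => s; apply: cinf_ext => x; rewrite form0 cinf0.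
case: (ltnP m (size s)) => sm; first by rewrite top // cinf0.
have [ o ho] := orthonormal_exists (stgC st) (stg_lin st) gpos x.
apply: (orthonormal_vanish ho) (erefl (size s)) => r.
have : fdot st a a x == 0 by rewrite h.
rewrite (fdot_orthonormal ho).
rewrite psumr_eq0 => [/allP/(_ (Ordinal (n := m.+1) sm) (mem_index_enum _))|k _]; last first.
  by rewrite mulr_ge0 ?invr_ge0 ?ler0n //; apply: sumr_ge0 => s' _; rewrite -expr2 sqr_ge0.
rewrite /= mulf_eq0 invr_eq0 pnatr_eq0 (negbTE (lt0n_neq0 (fact_gt0 _))) /=.
rewrite psumr_eq0 => [/allP/(_ r (mem_index_enum _))|s' _]; last by rewrite -expr2 sqr_ge0.
by rewrite /= mulf_eq0 orbb => /eqP.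
Qed.

Definition ldot a b : R := integral (fdot st a b).

Lemma ldotE a b : L2dot S integral (form_val a) (form_val b) = ldot a b.
Proof. by rewrite /L2dot form_dotE. Qed.

Lemma ldotC a b : ldot a b = ldot b a. Proof. by rewrite /ldot fdotC. Qed.

Lemma ldot_lin (c : R) a a' b : ldot (c *: a + a') b = c * ldot a b + ldot a' b.
Proof. by rewrite /ldot fdotDl fdotZl (integral_lin integralP). Qed.

Lemma ldot_ge0 a : 0 <= ldot a a.
Proof. exact: (integral_ge0 stgE Mcompact integralP (fdot_ge0 a)). Qed.

Lemma ldot_eq0 a : ldot a a = 0 -> a = 0.
Proof. by move/(integral_eq0 stgE Mcompact integralP (fdot_ge0 a))/fdot_eq0. Qed.

Lemma ldot_lef a b : ldot (L a) b = ldot a (Lam b).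
Proof. by rewrite /ldot fdot_lef. Qed.

Lemma ldot_eps X a b : ldot (eps st X a) b = ldot a (iota X b).
Proof. by rewrite /ldot fdot_eps. Qed.

Lemma ldot_iota X a b : ldot (iota X a) b = ldot a (eps st X b).
Proof. by rewrite /ldot fdot_iota. Qed.

Lemma ldot_num a b : ldot (N a) b = ldot a (N b).
Proof. by rewrite /ldot fdot_num. Qed.

Lemma ldot_jop a b : ldot (j a) b = - ldot a (j b).
Proof. by rewrite /ldot fdot_jop -scaleN1r (integralZ integralP) mulN1r. Qed.

Lemma ldot_tder a b : ldot (t a) b = - ldot a (t b).
Proof.
apply/eqP; rewrite -addr_eq0 /ldot -(integralD integralP) fdot_tder.
by rewrite (integral_div stgE Mcompact integralP).
Qed.

Lemma ldot_dhor a b : ldot (D a) b = ldot a (Ds b).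
Proof.
have [W h] := fdot_dhor st top a b.
by rewrite /ldot h (integralD integralP) (integral_div stgE Mcompact integralP) addr0.
Qed.

Lemma ldot_nondeg a b : (forall c, ldot c a = ldot c b) -> a = b.
Proof. exact: (dot_nondeg ldotC ldot_lin ldot_eq0). Qed.

Lemma kaehler_forms : kaehler_identities ldot L Lam D Ds t j.
Proof.
split.
- exact: lef_linear.
- exact: lam_linear.
- exact: dhor_linear.
- exact: shor_linear.
- exact: tder_linear.
- exact: jop_linear.
- exact: ldot_lef.
- exact: ldot_dhor.
- exact: ldot_tder.
- exact: ldot_jop.
- exact: dhor_square.
- exact: dhor_lef.
- exact: shor_lef.
- exact: dhor_jop2.
- exact: tder_lef.
- by move=> a; rewrite dhor_tder.
- by move=> a; rewrite jop_tder.
- exact: jop_lef.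
Qed.

Lemma kaehler_forms_dual :
  kaehler_identities ldot Lam L Ds D (fun a => - t a) (fun a => - j a).
Proof. exact: (kaehler_dual ldotC ldot_lin ldot_eq0 kaehler_forms). Qed.

Lemma ldotNr a b : ldot a (- b) = - ldot a b.
Proof. exact: (dotNr ldotC ldot_lin). Qed.

Lemma tder_lam a : t (Lam a) = Lam (t a).
Proof. by apply: oppr_inj; rewrite (kaehlertL kaehler_forms_dual) linearN. Qed.

Lemma lam_iotaT a : Lam (iT a) = iT (Lam a).
Proof. by apply: ldot_nondeg => c; rewrite -ldot_lef -!ldot_eps -ldot_lef eps_lef. Qed.

Lemma lam_epsT a : Lam (eT a) = eT (Lam a).
Proof. by rewrite lam_eps stJT iota0l addr0. Qed.

Lemma shor_iotaT a : Ds (iT a) = - iT (Ds a).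
Proof.
apply: ldot_nondeg => c.
by rewrite ldotNr -ldot_dhor -!ldot_eps -ldot_dhor dhor_eps (dotNl ldot_lin) opprK.
Qed.

Lemma shor_epsT a : Ds (eT a) = - eT (Ds a).
Proof.
apply: ldot_nondeg => c.
by rewrite ldotNr -ldot_dhor -!ldot_iota -ldot_dhor dhor_iota (dotNl ldot_lin) opprK.
Qed.

Lemma num_lef a : N (L a) = L (N a) + 2%:R *: L a.
Proof.
apply: ldot_nondeg => c; transitivity (ldot (Lam (N c)) a).
  by rewrite -ldot_num [LHS]ldotC ldot_lef ldotC.
rewrite num_lam [LHS](dotDl ldot_lin) [X in _ + X](dotZl ldot_lin).
rewrite [RHS](dotDr ldotC ldot_lin) [X in _ = _ + X](dotZr ldotC ldot_lin).
by rewrite ldot_num ![ldot (Lam c) _]ldotC -!ldot_lef ![ldot _ c]ldotC.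
Qed.

Lemma num_epsT a : N (eT a) = eT (N a) + eT a.
Proof.
apply: ldot_nondeg => c; rewrite (dotDr ldotC ldot_lin).
rewrite -ldot_num -!ldot_iota num_iota.
by rewrite (dotDl ldot_lin) ldot_num.
Qed.

Definition dt (c : R) a := L (iT a) + c *: D a + c ^+ 2 *: eT (t a).
(** The adjoint of [dt], term by term; the sign in the last term comes from the skewness of the Lie
    derivative along the Reeb field. *)
Definition dts (c : R) a := eT (Lam a) + c *: Ds a + c ^+ 2 *: - iT (t a).
Definition lap (c : R) a := dt c (dts c a) + dts c (dt c a).

Lemma ldot_dt c a b : ldot (dt c a) b = ldot a (dts c b).
Proof.
rewrite [LHS](dot_quadratic ldot_lin) [RHS]ldotC [RHS](dot_quadratic ldot_lin).
rewrite ldot_lef ldot_iota ldot_dhor ldot_eps ldot_tder iota_tder.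
by rewrite ![ldot a _]ldotC (dotNl ldot_lin).
Qed.

Lemma lap_energy c a : ldot (dt c a) (dt c a) + ldot (dts c a) (dts c a) = ldot (lap c a) a.
Proof.
rewrite [RHS](dotDl ldot_lin) ldot_dt addrC; congr (_ + _).
  by rewrite ldot_dt.
exact: ldotC.
Qed.

Hypothesis stTE : stT st = reeb S.
Hypothesis stJE : stJ st = acs S.
Local Notation theta := (contact_form S).

Lemma wedge_theta a : wedge theta (form_val a) = form_val (eT a).
Proof.
apply/funext => s; apply: (@wedge_deg1 _ _ _ (flat st T)) => [|X].
  by have [[_ h] _] := contact_formP S.
by rewrite /= stgE stTE metricT.
Qed.

Lemma dext_homogeneous k (c : cochain M) : homogeneous k c -> homogeneous k.+1 (dext c).
Proof.
move=> hc s sk; have omk i : (i < size s)%N -> size (omit i s) = (size s).-1.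
  move=> si; rewrite /omit size_cat size_drop size_take si.
  by rewrite subnS -subnS; lia.
rewrite /dext !big1 ?addr0 //.
  move=> i _; apply: big1 => i' _.
  have lt : (i' < i)%N := ltn_ord i'.
  rewrite hc ?scaler0 //= /omit size_cat size_drop size_take -/(omit _ _) omk //.
  by have := ltn_ord i; case: ifP; lia.
move=> i _; rewrite hc ?vf0 ?scaler0 // omk //.
by have := ltn_ord i; lia.
Qed.

(** Both sides vanish on the empty list and obey the same contraction rule, with i_X dtheta = g(J X,
    .) in the second term. *)
Lemma wedge_dtheta a : wedge (dext theta) (form_val a) = form_val (L a).
Proof.
have h2 : homogeneous 2 (dext theta).
  by apply: dext_homogeneous; have [[_ h] _] := contact_formP S.
apply/funext => s; rewrite -[RHS]/(L a s); elim: s a => [|X s IH] a.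
  by rewrite wedge_nil h2 // mul0r lef_nil.
rewrite (wedge_cons _ _ _ h2) expr2 mulrNN mulr1 scale1r -[RHS]iotaE iota_lef formD addrC.
congr (_ + _); first exact: (IH (iota X a)).
apply: (@wedge_deg1 _ _ _ (flat st (stJ st X))) => [r rk|Y]; first by rewrite /Defs.interior h2.
by rewrite /= stgE stJE metric_acs.
Qed.

Lemma tpartE a : tpart S (form_val a) = form_val (iT a).
Proof. by rewrite /tpart -stTE. Qed.

Lemma hpartE a : hpart S (form_val a) = form_val (a - eT (iT a)).
Proof. by rewrite /hpart tpartE wedge_theta. Qed.

Lemma d_b_horE a : iT a = 0 -> d_b_hor S (form_val a) = form_val (D a).
Proof.
move=> a0; rewrite /d_b_hor (dext_dform st) -stTE.
rewrite -[Defs.interior _ _]/(form_val (iT (dform st a))) wedge_theta.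
by rewrite /dform a0 linear0 addr0 iota_dnab a0 linear0 subr0.
Qed.

(** [d_b] treats the two parts of a form separately; they reassemble into [dhor] because it
    anticommutes with the wedge by theta. In [d_T] that wedge removes the vertical part. *)
Lemma d_tE c a : d_t S c (form_val a) = form_val (dt c a).
Proof.
have ii : iT (iT a) = 0 by exact: iotaXX.
have ih : iT (a - eT (iT a)) = 0.
  by rewrite linearB /= iota_eps stTT fscale1 ii linear0 subr0 subrr.
rewrite /d_t /d_0 /d_b /d_T tpartE hpartE wedge_dtheta !d_b_horE // !wedge_theta.
have -> : lie (reeb S) (form_val (a - eT (iT a))) = form_val (t (a - eT (iT a))).
  by apply/funext => s; rewrite lieE nabT_Lie stTE.
rewrite wedge_theta eps_tder.
have e1 : eT (a - eT (iT a)) = eT a by rewrite linearB /= epsXX subr0.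
have e2 : D a = D (a - eT (iT a)) - eT (D (iT a)).
  by rewrite linearB /= dhor_eps opprK addrK.
by rewrite e1 /dt e2 eps_tder.
Qed.

(** An adjoint is unique by nondegeneracy of the inner product, so the given [dstar] must be the
    explicit [dts]. *)
Lemma dstarE (dstar : cochain M -> cochain M) c a :
  is_formal_adjoint S integral (d_t S c) dstar -> dstar (form_val a) = form_val (dts c a).
Proof.
move=> [h1 h2]; have hb := h1 _ (form_isP a); rewrite -[LHS]/(form_val (mk_form hb)).
congr form_val; apply: ldot_nondeg => b; rewrite -ldot_dt -!ldotE -d_tE.
by rewrite h2 //; exact: form_isP.
Qed.

Lemma LaplacianE (dstar : R -> cochain M -> cochain M) c a :
  is_formal_adjoint S integral (d_t S c) (dstar c) ->
  Laplacian S dstar c (form_val a) = form_val (lap c a).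
Proof. by move=> h; rewrite /Laplacian !(d_tE, dstarE _ h). Qed.

Let lL : operator L. Proof. exact: lef_linear. Qed.
Let lLam : operator Lam. Proof. exact: lam_linear. Qed.
Let leT : operator eT. Proof. exact: eps_linear. Qed.
Let liT : operator iT. Proof. exact: iota_linear. Qed.
Let lt : operator t. Proof. exact: tder_linear. Qed.
Let lD : operator D. Proof. exact: dhor_linear. Qed.
Let lDs : operator Ds. Proof. exact: shor_linear. Qed.

Lemma lam_lef_eigen (r : R) a : iT a = 0 -> N a = r *: a ->
  Lam (L a) - L (Lam a) = (n%:R - r) *: a.
Proof.
move=> a0 Na; rewrite lam_lef a0 linear0 addr0 Na.
by apply: form_ext => s; rewrite formB formB formD [in RHS]formZ !formZ scalerBl; ring.
Qed.

Lemma num_iotaT_eigen (r : R) a : N a = r *: a -> N (iT a) = (r - 1) *: iT a.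
Proof.
move=> Na; apply: (addIr (iT a)); rewrite -num_iota Na.
by rewrite scalerBl scale1r subrK; exact: linearZ.
Qed.

Lemma num_epsT_eigen (r : R) a : N a = r *: a -> N (eT a) = (r + 1) *: eT a.
Proof. by move=> Na; rewrite num_epsT Na linearZ /= scalerDl scale1r. Qed.

Lemma num_lam_eigen (r : R) a : N a = r *: a -> N (Lam a) = (r - 2) *: Lam a.
Proof.
move=> Na; apply: (addIr (2%:R *: Lam a)); rewrite -num_lam Na.
by rewrite scalerBl subrK; exact: linearZ.
Qed.

Lemma num_lef_eigen (r : R) a : N a = r *: a -> N (L a) = (r + 2) *: L a.
Proof. by move=> Na; rewrite num_lef Na [RHS]scalerDl; congr (_ + _); exact: linearZ. Qed.

Lemma lam_lef_tder (c : R) a : Lam (L a) - L (Lam a) = c *: a ->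
  Lam (L (t a)) - L (Lam (t a)) = c *: t a.
Proof.
move=> h; rewrite -tder_lef -!tder_lam -tder_lef.
by rewrite -(opB lt) h; exact: (opZ lt).
Qed.

Lemma iotaTT a : iT (iT a) = 0. Proof. exact: iotaXX. Qed.

Lemma horizontal_zero a : iT a = 0 -> eT a = 0 -> a = 0.
Proof. by move=> h1 h2; rewrite -[LHS](iotaT_epsT st) h1 h2 !linear0 addr0. Qed.

Lemma iotaT_epsT_hor a : iT a = 0 -> iT (eT a) = a.
Proof. by move=> h; rewrite -[RHS](iotaT_epsT st) h linear0 addr0. Qed.

(** The hypotheses are the coefficients of orders 0 and 1, and for [k = n] also 2, of [dt] and [dts]
    along a family u0 + s u1 + s^2 u2 + ... *)
Lemma zero_modes_low k (u0 u1 u2 : form) : (k <= n)%N ->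
  N u0 = k%:R *: u0 -> N u1 = k%:R *: u1 ->
  L (iT u0) = 0 -> eT (Lam u0) = 0 ->
  L (iT u1) + D u0 = 0 -> eT (Lam u1) + Ds u0 = 0 ->
  (k = n -> L (iT u2) + D u1 + eT (t u0) = 0) ->
  [/\ D u0 = 0, Ds u0 = 0 & t u0 = 0].
Proof.
move=> kn N0 N1 v0 w0 v1 w1 v2.
have kn' : k%:R <= n%:R :> R by rewrite ler_nat.
(* [iT u0] is horizontal of degree k - 1, where [Lam, L] = n - k + 1 > 0; as [L] kills it, minus
   |Lam (iT u0)|^2 is a positive multiple of |iT u0|^2. *)
have s0 : iT u0 = 0.
  have := lam_lef_eigen (iotaTT u0) (num_iotaT_eigen N0).
  rewrite v0 linear0 sub0r => /(congr1 (ldot (iT u0))).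
  rewrite ldotNr ldotC ldot_lef [RHS](dotZr ldotC ldot_lin) => e.
  have p1 := ldot_ge0 (Lam (iT u0)); have p2 := ldot_ge0 (iT u0).
  by apply: ldot_eq0; nra.
have la : Lam u0 = 0 by apply: horizontal_zero => //; rewrite -lam_iotaT s0 linear0.
have da : Ds u0 = 0.
  apply: horizontal_zero; first by rewrite -[LHS]opprK -shor_iotaT s0 linear0 oppr0.
  have := congr1 eT w1; rewrite linearD /= epsXX add0r linear0; exact.
(* With this choice the order 1 equation reads [D u0 = L b]. *)
pose b := - iT u1.
have Ib : iT b = 0 by rewrite linearN /= iotaTT oppr0.
have Nb : N b = (k%:R - 1) *: b.
  by rewrite /b linearN /= (num_iotaT_eigen N1) scalerN.
have e1 : D u0 = L b.
  by rewrite /b linearN /=; apply/eqP; rewrite -addr_eq0 addrC v1.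
have Ha := lam_lef_eigen s0 N0.
have Hb : Lam (L b) - L (Lam b) = (n%:R - k%:R + 1) *: b.
  by rewrite (lam_lef_eigen Ib Nb); congr (_ *: _); ring.
have Hlb : Lam (L (Lam b)) - L (Lam (Lam b)) = (n%:R - k%:R + 3) *: Lam b.
  rewrite (@lam_lef_eigen (k%:R - 1 - 2)); first by congr (_ *: _); ring.
    by rewrite -lam_iotaT Ib linear0.
  exact: num_lam_eigen.
have c0 : 0 <= n%:R - k%:R :> R by rewrite subr_ge0.
have mid : n%:R - k%:R = 0 :> R -> t u0 + D b = 0.
  move=> /eqP; rewrite subr_eq0 eqr_nat => /eqP nk.
  have iD3 (x y z : form) : iT (x + y + z) = iT x + iT y + iT z by rewrite !(opD liT).
  (* Contraction with the Reeb field removes the unknown [u2] from the order 2 equation and turns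
     [D u1] into [D b]. *)
  have := congr1 iT (v2 (esym nk)); rewrite iD3 iotaT_lef iotaTT (op0 lL) (op0 liT) add0r.
  rewrite iotaT_epsT_hor; last by rewrite iota_tder s0 (op0 lt).
  by rewrite /b (opN lD) dhor_iota opprK addrC.
by have [D0 t0] := kaehler_vanishing ldotC ldot_lin ldot_ge0 ldot_eq0 kaehler_forms
  c0 la da e1 Hb Hlb (lam_lef_tder Ha) mid.
Qed.

(** The mirror case: [u0] is theta wedge a horizontal form [a] of degree k - 1 >= n which [L] kills,
    and the dual identities are applied to [a]. *)
Lemma zero_modes_high k (u0 u1 u2 : form) : (n < k)%N ->
  N u0 = k%:R *: u0 -> N u1 = k%:R *: u1 ->
  L (iT u0) = 0 -> eT (Lam u0) = 0 ->
  L (iT u1) + D u0 = 0 -> eT (Lam u1) + Ds u0 = 0 ->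
  (k = n.+1 -> eT (Lam u2) + Ds u1 - iT (t u0) = 0) ->
  [/\ D u0 = 0, Ds u0 = 0 & t u0 = 0].
Proof.
move=> nk N0 N1 v0 w0 v1 w1 w2.
have nk' : n.+1%:R <= k%:R :> R by rewrite ler_nat.
have kr : n%:R + 1 <= k%:R :> R by rewrite -natr1 in nk'.
have IN (u : form) : N u = k%:R *: u -> N (iT (eT u)) = k%:R *: iT (eT u).
  move=> Nu; rewrite (num_iotaT_eigen (num_epsT_eigen Nu)); congr (_ *: _); ring.
(* The horizontal part h of [u0] is primitive of degree k > n, so |L h|^2 = (n - k) |h|^2, which
   forces h = 0. *)
have h0 : iT (eT u0) = 0.
  have := lam_lef_eigen (iotaTT _) (IN _ N0).
  have -> : Lam (iT (eT u0)) = 0 by rewrite lam_iotaT lam_epsT w0 linear0.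
  rewrite linear0 subr0 => /(congr1 (ldot (iT (eT u0)))).
  rewrite -ldot_lef [RHS](dotZr ldotC ldot_lin) => e.
  have p1 := ldot_ge0 (L (iT (eT u0))); have p2 := ldot_ge0 (iT (eT u0)).
  by apply: ldot_eq0; nra.
pose a := iT u0; have ua : u0 = eT a by rewrite -[LHS](iotaT_epsT st) h0 add0r.
have Ia : iT a = 0 by exact: iotaTT.
have Na := num_iotaT_eigen N0.
have Da : D a = 0.
  have := congr1 iT v1; rewrite linearD /= iotaT_lef iotaTT !linear0 add0r => e.
  by rewrite /a dhor_iota e oppr0.
(* The horizontal part of [u1]; the order 1 equation becomes [Ds a = Lam b]. *)
pose b := iT (eT u1); have Ib : iT b = 0 by exact: iotaTT.
have Nb := IN _ N1; rewrite -/b in Nb.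
have e1 : Ds a = Lam b.
  have := congr1 iT w1; rewrite linearD /= -lam_epsT -lam_iotaT -/b linear0.
  move/eqP; rewrite addr_eq0 => /eqP ->.
  by rewrite /a shor_iotaT.
have c0 : 0 <= k%:R - 1 - n%:R :> R by lra.
have flip (x : form) (r r' : R) : Lam (L x) - L (Lam x) = r *: x -> r = - r' ->
    L (Lam x) - Lam (L x) = r' *: x.
  by move=> h rr; rewrite -opprB h rr scaleNr opprK.
have Hb : L (Lam b) - Lam (L b) = (k%:R - 1 - n%:R + 1) *: b.
  by apply: (flip _ _ _ (lam_lef_eigen Ib Nb)); ring.
have HLb : L (Lam (L b)) - Lam (L (L b)) = (k%:R - 1 - n%:R + 3) *: L b.
  apply: (flip _ _ _ (lam_lef_eigen _ (num_lef_eigen Nb))); last by ring.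
  by rewrite iotaT_lef Ib linear0.
have Hta : L (Lam (- t a)) - Lam (L (- t a)) = (k%:R - 1 - n%:R) *: - t a.
  rewrite (linearN Lam) (linearN L) (linearN L) (linearN Lam) -opprD scalerN; congr (- _).
  by apply: (flip _ _ _ (lam_lef_tder (lam_lef_eigen Ia Na))); ring.
have mid : k%:R - 1 - n%:R = 0 :> R -> - t a + Ds b = 0.
  move=> e; have /eqP : k%:R = n.+1%:R :> R by rewrite -natr1; lra.
  rewrite eqr_nat => /eqP /w2 /(congr1 eT) /(congr1 iT).
  have eD3 (x y z : form) : iT (eT (x + y - z)) = iT (eT x) + iT (eT y) - iT (eT z).
    by rewrite (opB leT) (opD leT) (opB liT) (opD liT).
  rewrite eD3 epsXX (op0 leT) (op0 liT) add0r.
  rewrite iota_tder -/a [iT (eT (t a))]iotaT_epsT_hor; last by rewrite iota_tder Ia (op0 lt).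
  by rewrite /b shor_iotaT shor_epsT (opN liT) opprK addrC.
have [Da' ta] := kaehler_vanishing ldotC ldot_lin ldot_ge0 ldot_eq0 kaehler_forms_dual
  c0 v0 Da e1 Hb HLb Hta mid.
have t0 : t a = 0 by apply: oppr_inj; rewrite ta oppr0.
by rewrite ua dhor_eps shor_epsT -eps_tder Da Da' t0 (op0 leT) oppr0.
Qed.

Lemma lap_eq0 c a : lap c a = 0 -> dt c a = 0 /\ dts c a = 0.
Proof.
move=> h; have := lap_energy c a; rewrite h (dot0l ldot_lin) => /eqP.
by rewrite paddr_eq0 ?ldot_ge0 // => /andP[/eqP/ldot_eq0 ? /eqP/ldot_eq0].
Qed.

Lemma lap0 c : dt c 0 + dts c 0 = 0.
Proof.
rewrite /dt /dts !(op0 liT, op0 leT, op0 lL, op0 lLam, op0 lt, op0 lD, op0 lDs).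
by rewrite oppr0 !scaler0 !addr0.
Qed.

(** Vanishing for all [c > 0] kills each coefficient of the two quadratic polynomials [dt c a] and
    [dts c a], hence reaches [c = 0], a value that [F_space] also asks for. *)
Lemma lap_vanishing a : (forall c, 0 < c -> lap c a = 0) -> forall c, lap c a = 0.
Proof.
move=> h c.
have [v0 v1 v2] := quadratic_vanishing ldot_lin ldot_eq0 (fun (e : R) he => (lap_eq0 (h e he)).1).
have [w0 w1 w2] := quadratic_vanishing ldot_lin ldot_eq0 (fun (e : R) he => (lap_eq0 (h e he)).2).
rewrite /lap; have -> : dt c a = 0 by rewrite /dt v0 v1 v2 !scaler0 !addr0.
have -> : dts c a = 0 by rewrite /dts w0 w1 w2 !scaler0 !addr0.
exact: lap0.
Qed.

Lemma family_vanishing k p q (us ws : nat -> form) K :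
  (3 <= p)%N -> (k = n \/ k = n.+1 -> (5 <= p)%N) ->
  (forall r, N (us r) = k%:R *: us r) ->
  (forall r, (q < r)%N -> us r = 0) ->
  (forall r, (r < p)%N -> ws r = 0) ->
  (forall c, 0 <= c -> lap c (\sum_(i < q.+1) c ^+ i *: us i) = \sum_(i < K) c ^+ i *: ws i) ->
  forall c, lap c (us 0%N) = 0.
Proof.
move=> p3 p5 Nu u0 w0 hl c.
pose v r := L (iT (us r)) + D (pre us r) + eT (t (pre (pre us) r)).
pose w r := eT (Lam (us r)) + Ds (pre us r) - iT (t (pre (pre us) r)).
have lin2 (P Q : form -> form) : operator P -> operator Q -> operator (P \o Q).
  by move=> lP lQ d x y; rewrite /= lQ lP.
have lN : operator (fun x : form => - x) by move=> d x y; rewrite opprD scalerN.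
have E d : 0 <= d -> ldot (\sum_(i < q.+3) d ^+ i *: v i) (\sum_(i < q.+3) d ^+ i *: v i) +
    ldot (\sum_(i < q.+3) d ^+ i *: w i) (\sum_(i < q.+3) d ^+ i *: w i) =
    ldot (\sum_(i < K) d ^+ i *: ws i) (\sum_(i < q.+1) d ^+ i *: us i).
  move=> d0; rewrite -hl // -lap_energy; congr (ldot _ _ + ldot _ _).
  - exact: esym (quadratic_family d (lin2 _ _ lL liT) lD (lin2 _ _ leT lt) u0).
  - exact: esym (quadratic_family d (lin2 _ _ lL liT) lD (lin2 _ _ leT lt) u0).
  - exact: esym (quadratic_family d (lin2 _ _ leT lLam) lDs (lin2 _ _ lN (lin2 _ _ liT lt)) u0).
  - exact: esym (quadratic_family d (lin2 _ _ leT lLam) lDs (lin2 _ _ lN (lin2 _ _ liT lt)) u0).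
have V := energy_vanishing ldotC ldot_lin ldot_ge0 ldot_eq0 w0 E.
have [v0 w0'] := V 0%N isT (ltnW (ltnW p3)).
have [v1 w1] := V 1%N isT p3.
rewrite /v /w /= !linear0 ?oppr0 !addr0 in v0 w0' v1 w1.
have V2 : k = n \/ k = n.+1 -> v 2%N = 0 /\ w 2%N = 0.
  by move=> /p5 p5'; apply: V.
have [D0 Ds0 t0] : [/\ D (us 0%N) = 0, Ds (us 0%N) = 0 & t (us 0%N) = 0].
  case: (leqP k n) => kn.
    apply: (zero_modes_low kn (Nu _) (Nu _) v0 w0' v1 w1 (u2 := us 2%N)) => e.
    by have [] := V2 (or_introl e).
  apply: (zero_modes_high kn (Nu _) (Nu _) v0 w0' v1 w1 (u2 := us 2%N)) => e.
  by have [] := V2 (or_intror e).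
rewrite /lap; have -> : dt c (us 0%N) = 0 by rewrite /dt v0 D0 t0 (op0 leT) !scaler0 !addr0.
have -> : dts c (us 0%N) = 0 by rewrite /dts w0' Ds0 t0 (op0 liT) oppr0 !scaler0 !addr0.
exact: lap0.
Qed.

Lemma form_val_family q (us : nat -> form) (c : R) :
  poly_family q (fun i => form_val (us i)) c = form_val (\sum_(i < q.+1) c ^+ i *: us i).
Proof. by rewrite (big_morph (@form_val _ _ M) (id1 := 0) (op1 := +%R)). Qed.

Lemma poly_family0 q (us : nat -> cochain M) : poly_family q us 0 = us 0%N.
Proof.
rewrite /poly_family big_ord_recl expr0 scale1r big1 ?addr0 // => i _.
by rewrite exprS mul0r scale0r.
Qed.

Lemma F_spaceE (dstar : R -> cochain M -> cochain M) k p :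
  (forall c, 0 <= c -> is_formal_adjoint S integral (d_t S c) (dstar c)) ->
  (3 <= p)%N -> (k = n \/ k = n.+1 -> (5 <= p)%N) ->
  F_space (Laplacian S dstar) p k =
  \bigcap_(c in [set c : R | 0 < c]) Ker_on k (Laplacian S dstar c).
Proof.
move=> had p3 p5; apply/seteqP; split=> u.
  move=> [Ou [q [us [Ous us0 [K [ws [Ows ws0 hl]]]]]]] c /= c0; split=> //.
  (* Entries beyond [q] do not enter the family and are arbitrary; they are set to 0, as the
     coefficient count of [quadratic_family] requires. *)
  pose us' r := if (r <= q)%N then mk_form (Ous r).1 else 0.
  pose ws' r := mk_form (Ows r).1.
  have usE i : (i <= q)%N -> us i = form_val (us' i) by rewrite /us' => ->.
  have fam (s : R) : poly_family q us s = form_val (\sum_(i < q.+1) s ^+ i *: us' i).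
    by rewrite -form_val_family; apply: eq_bigr => i _; rewrite usE // -ltnS.
  rewrite -us0 poly_family0 usE // LaplacianE; last exact: had (ltW c0).
  rewrite (@family_vanishing k p q us' ws' K.+1) //.
  - move=> r; rewrite /us'; case: ifP => _; last by rewrite linear0 scaler0.
    by apply: num_homogeneous; exact: (Ous r).2.
  - by move=> r; rewrite ltnNge /us' => /negbTE ->.
  - by move=> r rp; apply: val_inj; rewrite /= ws0.
  - move=> s s0; apply: val_inj; rewrite -[LHS](LaplacianE _ (had s s0)) -fam hl //.
    exact: form_val_family K ws' s.
move=> hu; have [[fu hk] _] := hu 1 ltr01; split; first by split.
(* A common kernel element is its own constant family, with image 0. *)
exists 0%N, (fun=> u); split; first by move=> _; split.
  exact: poly_family0.
exists 0%N, (fun=> 0); split=> //.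
  by move=> _; split=> //; exact: (form_isP (0 : form)).
move=> c c0; have fam (z : cochain M) : poly_family 0 (fun=> z) c = z.
  by rewrite /poly_family big_ord1 expr0 scale1r.
rewrite !fam -[u]/(form_val (mk_form fu)) LaplacianE; last exact: had.
rewrite lap_vanishing // => s s0; have [_] := hu s s0.
rewrite -[u]/(form_val (mk_form fu)) LaplacianE; last exact: had (ltW s0).
by move=> h; apply: val_inj.
Qed.

End FormInner.

Theorem corollary1p4 (R : realType) (n : nat)
  (M : smoothManifold R (2 * n).+1) (Mcompact : compact [set: M])
  (S : sasakian M)
  (integral : (M -> R) -> R) (integralP : is_riemannian_integral S integral)
  (dstar : R -> cochain M -> cochain M)
  (dstarP : forall t : R, 0 <= t ->
     is_formal_adjoint S integral (d_t S t) (dstar t))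
  (k : nat) (hk : (k <= (2 * n).+1)%N) :
  ((k <> n /\ k <> n.+1) ->
     F_space (Laplacian S dstar) 3 k =
     \bigcap_(t in [set t : R | 0 < t]) Ker_on k (Laplacian S dstar t)) /\
  ((k = n \/ k = n.+1) ->
     F_space (Laplacian S dstar) 5 k =
     \bigcap_(t in [set t : R | 0 < t]) Ker_on k (Laplacian S dstar t)).
Proof.
have [I [E [F frame]]] := dual_frame Mcompact (metricC S) (metric_lin S)
  (fun X x => @metric_pos _ _ _ S Mcompact X x).
pose st := sasakian_structure Mcompact frame.
have eqF p : (3 <= p)%N -> (k = n \/ k = n.+1 -> (5 <= p)%N) ->
    F_space (Laplacian S dstar) p k =
    \bigcap_(t in [set t : R | 0 < t]) Ker_on k (Laplacian S dstar t).
  exact: (@F_spaceE _ _ _ Mcompact S st (fun _ _ => erefl) _ integralP erefl erefl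
    dstar k p dstarP).
split; last by move=> _; apply: eqF.
by move=> [kn kn1]; apply: eqF => // -[].
Qed.
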